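(* Let $u\in\mathbb{K}$ be the solution of the parabolic obstacle problem with data $(f,u_0)$ and let $\widetilde u\in\mathbb{K}$ be the solution of the parabolic obstacle problem with the same obstacle $\phi$ and data $(\widetilde f,\widetilde u_0)$ (see context). Let $\alpha\geqslant\tfrac12$ and define $$ g(x,t)=\begin{cases} f-\widetilde f & \text{if } (x,t)\in Q_T,\ \widetilde u(x,t)>\phi(x),\\ \max\{0,\,f-\widetilde f\} & \text{if } (x,t)\in Q_T,\ \widetilde u(x,t)=\phi(x).\end{cases} $$ Then $$ \|(u-\widetilde u)(\cdot,T)\|_\Omega^2+\left(2-\frac1\alpha\right)\|\nabla(u-\widetilde u)\|_{Q_T}^2\leqslant \|u_0-\widetilde u_0\|_\Omega^2+\alpha\, C_F^2\,\|g\|_{Q_T}^2, $$ and consequently $$ \|(u-\widetilde u)(\cdot,T)\|_\Omega^2+\left(2-\frac1\alpha\right)\|\nabla(u-\widetilde u)\|_{Q_T}^2\leqslant \|u_0-\widetilde u_0\|_\Omega^2+\alpha\, C_F^2\,\|f-\widetilde f\|_{Q_T}^2 . $$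
   Context: $\Omega\subset\mathbb{R}^n$ is open, connected and bounded with Lipschitz continuous boundary, $T>0$, and $Q_T=\Omega\times(0,T)$. The obstacle $\phi=\phi(x)$ satisfies $\phi\in H^2(\Omega)$ and $\phi\leqslant0$ a.e. on $\partial\Omega$ (in the sense of traces). The data satisfy $f,\widetilde f\in L^2(Q_T)$, $u_0,\widetilde u_0\in H^1_0(\Omega)$, $u_0\geqslant\phi$ and $\widetilde u_0\geqslant\phi$ a.e. in $\Omega$. Subscript $t$ is the time derivative and $\nabla$ is the spatial gradient. $\|\cdot\|_\Omega$ and $\|\cdot\|_{Q_T}$ denote the $L^2(\Omega)$ and $L^2(Q_T)$ norms (of scalar or vector functions). Admissible class: $$\mathbb{K}=\{w\in L^2((0,T),H^1_0(\Omega)):\ w_t\in L^2((0,T),H^{-1}(\Omega)),\ w\geqslant\phi \text{ a.e. in } Q_T\}.$$ Elements of $\mathbb{K}$ are identified with their representatives continuous in time with values in $L^2(\Omega)$. Parabolic obstacle problem with data $(f,u_0)$: find $u\in\mathbb{K}$ with $u(\cdot,0)=u_0$ such that for all $w\in\mathbb{K}$ $$\int_{Q_T}u_t(w-u)\,dx\,dt+\int_{Q_T}\nabla u\cdot\nabla(w-u)\,dx\,dt\geqslant\int_{Q_T}f(w-u)\,dx\,dt,$$ where the first integral is understood as the duality pairing between $L^2((0,T),H^{-1}(\Omega))$ and $L^2((0,T),H_0^1(\Omega))$. It is known that this problem has a unique solution; the problem with data $(\widetilde f,\widetilde u_0)$ is the same with $f,u_0$ replaced by $\widetilde f,\widetilde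 u_0$. $C_F>0$ is the constant in the Friedrichs inequality $\|w\|_\Omega\leqslant C_F\|\nabla w\|_\Omega$ for all $w\in H^1_0(\Omega)$. *)

(* Defs.v *)
From HB Require Import structures.
From mathcomp Require Import all_boot all_order all_algebra.
From mathcomp Require Import all_classical all_reals all_analysis.

Set Implicit Arguments.
Unset Strict Implicit.
Unset Printing Implicit Defensive.

Import Order.TTheory GRing.Theory Num.Theory.
Import numFieldNormedType.Exports.

Local Open Scope classical_set_scope.
Local Open Scope ring_scope.

(* Points of R^n are row vectors.  The library norm on 'rV[R]_n is the max
   norm: it is used for topological notions only, and Euclidean lengths are
   written enorm. *)

(* Borel sigma-algebra of R^n, presented as the product sigma-algebra. *)
Definition rV_display : measure_display.
Proof. exact: default_measure_display. Qed.

Section rV_measurable.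
Context (R : realType) (n : nat).

Definition rV_coord (i : 'I_n) (x : 'rV[R]_n) : measurableTypeR R := x ord0 i.

Definition rV_measurable : set (set 'rV[R]_n) := g_sigma_preimage rV_coord.

Let rV_set0 : rV_measurable set0.
Proof. exact: sigma_algebra0. Qed.

Let rV_setC A : rV_measurable A -> rV_measurable (~` A).
Proof. exact: sigma_algebraC. Qed.

Let rV_bigcup (F : (set 'rV[R]_n)^nat) :
  (forall i, rV_measurable (F i)) -> rV_measurable (\bigcup_i F i).
Proof. exact: sigma_algebra_bigcup. Qed.

HB.instance Definition _ := @isMeasurable.Build rV_display
  'rV[R]_n rV_measurable rV_set0 rV_setC rV_bigcup.

End rV_measurable.

Section lebesgue_rV.
Context (R : realType).

Lemma measurable_rV_coord n (i : 'I_n) :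
  measurable_fun [set: 'rV[R]_n] (@rV_coord R n i).
Proof.
move=> _ Y mY; rewrite setTI; apply: sub_sigma_algebra => /=.
rewrite -bigcup_seq/=; exists i => /=; first by rewrite mem_index_enum.
by exists Y => //; rewrite setTI.
Qed.

Lemma measurable_fun_rVP d (T : measurableType d) n (f : T -> 'rV[R]_n) :
  (forall i, measurable_fun [set: T] (@rV_coord R n i \o f)) ->
  measurable_fun [set: T] f.
Proof.
move=> mf; move=> _ A mA.
suff : g_sigma_preimage (fun i => @rV_coord R n i \o f) `<=` measurable.
  by apply; rewrite g_sigma_preimage_comp; exists A.
apply: smallest_sub; first exact: sigma_algebra_measurable.
rewrite -bigcup_seq/=; apply: bigcup_sub => i _ _ [B mB <-].
exact: mf.
Qed.

Definition rV_cons n (p : 'rV[R]_n * measurableTypeR R) : 'rV[R]_n.+1 :=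
  row_mx (const_mx p.2 : 'rV[R]_1) p.1.

Lemma measurable_rV_cons n : measurable_fun setT (@rV_cons n).
Proof.
apply: (@measurable_fun_rVP _ _ n.+1) => i.
case: (split_ordP (i : 'I_(1 + n))) => j ij.
  rewrite (_ : _ \o _ = snd); first exact: measurable_snd.
  by apply/funext => p; rewrite /= ij; exact: etrans (row_mxEl _ _ _ _) (mxE _ _ _ _).
rewrite (_ : _ \o _ = @rV_coord R n j \o fst).
  apply: measurableT_comp; [exact: measurable_rV_coord|exact: measurable_fst].
by apply/funext => p; rewrite /= ij; exact: row_mxEr.
Qed.

Section product_step.
Variables (n : nat) (m : {measure set 'rV[R]_n -> \bar R}).

Definition product_step : set 'rV[R]_n.+1 -> \bar R :=
  pushforward (m \x lebesgue_measure)%E (@rV_cons n).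

Let product_step0 : product_step set0 = 0%E.
Proof. by rewrite /product_step /pushforward preimage_set0 measure0. Qed.

Let product_step_ge0 A : (0 <= product_step A)%E.
Proof. exact: integral_ge0. Qed.

Let product_step_sigma_additive : semi_sigma_additive product_step.
Proof.
rewrite /product_step.
exact: (@measure_semi_sigma_additive _ _ _
  (measure_function_pushforward__canonical__measure_function_Measure
    (m \x lebesgue_measure)%E (measurable_rV_cons (n := n)))).
Qed.

HB.instance Definition _ := isMeasure.Build _ _ _ product_step
  product_step0 product_step_ge0 product_step_sigma_additive.

End product_step.

(* Lebesgue measure on R^n, as the n-fold product of the one-dimensional one. *)
Fixpoint lebesgue_rV (n : nat) : {measure set 'rV[R]_n -> \bar R} :=
  match n with
  | 0 => dirac (0 : 'rV[R]_0)
  | n'.+1 => product_step (lebesgue_rV n')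
  end.

End lebesgue_rV.

Section euclidean.
Context (R : realType) (n : nat).
Implicit Types a b : 'rV[R]_n.

Definition dotrV a b : R := \sum_i a ord0 i * b ord0 i.

Definition enorm a : R := Num.sqrt (dotrV a a).

End euclidean.

Section L2.
Context (R : realType) d (X : measurableType d).
Variable mu : {measure set X -> \bar R}.

Definition L2norm (D : set X) (f : X -> R) : \bar R :=
  'N[mu]_(2%:E)[(EFin \o f) \_ D]%E.

Definition L2 (D : set X) (f : X -> R) : Prop :=
  measurable_fun D f /\ (L2norm D f < +oo)%E.

End L2.

Section smooth.
Context (R : realType) (V : normedModType R).

(* On a finite-dimensional V this is the usual class C^k. *)
Fixpoint Ck (k : nat) (f : V -> R) : Prop :=
  continuous f /\
  match k with
  | 0 => True
  | k'.+1 => forall v : V,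
      (forall x, derivable f x v) /\ Ck k' (fun x => 'D_v f x)
  end.

Definition smooth (f : V -> R) : Prop := forall k, Ck k f.

(* C_c^oo(U), functions being extended by 0 outside U. *)
Definition test_fun (U : set V) (f : V -> R) : Prop :=
  smooth f /\
  exists K : set V, [/\ compact K, K `<=` U & forall x, ~ K x -> f x = 0].

End smooth.

Section sobolev.
Context (R : realType) (n : nat).
Local Notation Rn := 'rV[R]_n.
Local Notation mu := (lebesgue_rV R n).
Variable Omega : set Rn.

Definition partial (i : 'I_n) (f : Rn -> R) (x : Rn) : R :=
  'D_(delta_mx ord0 i) f x.

Definition grad (f : Rn -> R) (x : Rn) : Rn := \row_i partial i f x.

(* H1 w G : w is in H^1(Omega) and G is its weak gradient.  The weak gradient
   is determined by w up to null sets; carrying it along with w avoids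
   choosing a representative. *)
Definition H1 (w : Rn -> R) (G : Rn -> Rn) : Prop :=
  [/\ L2 mu Omega w,
      forall i, L2 mu Omega (fun x => G x ord0 i) &
      forall (i : 'I_n) (psi : Rn -> R), test_fun Omega psi ->
        \int[mu]_(x in Omega) (w x * partial i psi x) =
        - \int[mu]_(x in Omega) (G x ord0 i * psi x)].

Definition H2 (w : Rn -> R) : Prop :=
  exists G : Rn -> Rn, H1 w G /\
    forall i, exists G' : Rn -> Rn, H1 (fun x => G x ord0 i) G'.

Definition H1norm (p : (Rn -> R^o) * (Rn -> Rn)) : \bar R :=
  L2norm mu Omega (fun x => Num.sqrt (p.1 x ^+ 2 + enorm (p.2 x) ^+ 2)).

(* H^1_0(Omega), the closure of C_c^oo(Omega) in H^1(Omega). *)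
Definition H10 (w : Rn -> R) (G : Rn -> Rn) : Prop :=
  H1 w G /\
  exists psi : nat -> Rn -> R, (forall k, test_fun Omega (psi k)) /\
    H1norm (psi k \- w, grad (psi k) \- G) @[k --> \oo] --> 0%E.

(* H^{-1}(Omega), the dual of H^1_0(Omega): only the values of xi at elements
   of H^1_0(Omega) are meaningful. *)
Definition Hm1 (xi : (Rn -> R) -> R) : Prop :=
  (forall (a : R) w G w' G', H10 w G -> H10 w' G' ->
    xi (fun x => a * w x + w' x) = a * xi w + xi w') /\
  exists C : R, forall w G, H10 w G ->
    (`|xi w|%:E <= C%:E * H1norm (w, G))%E.

Definition Hm1norm (xi : (Rn -> R) -> R^o) : \bar R :=
  ereal_sup [set y | exists w G,
    [/\ H10 w G, (H1norm (w, G) <= 1)%E & y = `|xi w|%:E]].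

End sobolev.

Section lipschitz_domain.
Context (R : realType) (n : nat).
Local Notation Rn := 'rV[R]_n.
Variable Omega : set Rn.

(* Local coordinates y = (x - chart_centre) *m chart_rot: the entry of y at
   chart_dir is the vertical coordinate, the others form y' : 'rV_n.-1. *)
Record chart := Chart {
  chart_centre : Rn ;
  chart_rot : 'M[R]_n ;
  chart_dir : 'I_n ;
  chart_radius : R ;
  chart_height : R ;
  chart_graph : 'rV[R]_n.-1 -> R }.

Definition chart_coord (c : chart) (x : Rn) : Rn := (x - chart_centre c) *m chart_rot c.

(* In the cylinder of the given radius and height, Omega is the part strictly
   above the graph. *)
Definition lipschitz_chart (c : chart) : Prop :=
  [/\ chart_rot c *m (chart_rot c)^T = 1%:M, 0 < chart_radius c, 0 < chart_height c,
      (exists k : R, k.-lipschitz (chart_graph c)) /\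
      (forall y', `|y'| < chart_radius c -> `|chart_graph c y'| < chart_height c) &
      forall x, let y := chart_coord c x in
        `|col' (chart_dir c) y| < chart_radius c -> `|y ord0 (chart_dir c)| < chart_height c ->
        (Omega x <-> chart_graph c (col' (chart_dir c) y) < y ord0 (chart_dir c))].

Definition lipschitz_boundary : Prop :=
  forall x0, (closure Omega `\` interior Omega) x0 ->
    exists c, lipschitz_chart c /\ chart_centre c = x0.

(* The boundary point lying over y'. *)
Definition chart_point (c : chart) (y' : 'rV[R]_n.-1) : Rn :=
  chart_centre c + (\row_j (if unlift (chart_dir c) j is Some k then y' ord0 k
                      else chart_graph c y')) *m (chart_rot c)^T.

(* tau is the trace on the boundary of the H^1 function with value and weak
   gradient (w, G): the L^2(boundary) limit of the restrictions of smooth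
   functions converging to w in H^1(Omega).  The surface measure on a Lipschitz
   graph is sqrt (1 + |grad graph|^2) dy', which has bounded density with
   respect to dy' and is bounded below by it; hence convergence in
   L^2(boundary) and null sets can be tested chart by chart with dy'. *)
Definition is_trace (w : Rn -> R) (G : Rn -> Rn) (tau : Rn -> R) : Prop :=
  exists psi : nat -> Rn -> R,
    [/\ forall k, smooth (psi k),
        H1norm Omega (psi k \- w, grad (psi k) \- G) @[k --> \oo] --> 0%E &
        forall c, lipschitz_chart c ->
          let B := [set y' : 'rV[R]_n.-1 | `|y'| < chart_radius c] in
          L2 (lebesgue_rV R n.-1) B (tau \o chart_point c) /\
          L2norm (lebesgue_rV R n.-1) B
            ((psi k \- tau) \o chart_point c) @[k --> \oo] --> 0%E].

Definition trace_le0 (w : Rn -> R) : Prop :=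
  exists G tau, [/\ H1 Omega w G, is_trace w G tau &
    forall c, lipschitz_chart c ->
      {ae lebesgue_rV R n.-1, forall y',
        `|y'| < chart_radius c -> tau (chart_point c y') <= 0}].

End lipschitz_domain.

Section bochner.
Context (R : realType) (V : lmodType R).

Definition simple_curve (S : set V) (s : R -> V) : Prop :=
  exists m (A : 'I_m -> set (measurableTypeR R)) (v : 'I_m -> V),
    [/\ forall j, measurable (A j), forall j, S (v j) &
        s = fun t => \sum_j \1_(A j) t *: v j].

(* L^2(D; S) for a subspace S of V normed by N: strongly measurable S-valued
   functions whose squared norm is integrable. *)
Definition bochner_L2 (D : set (measurableTypeR R)) (S : set V)
    (N : V -> \bar R) (w : R -> V) : Prop :=
  [/\ {ae lebesgue_measure, forall t, D t -> S (w t)},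
      exists s : nat -> R -> V, (forall k, simple_curve S (s k)) /\
        {ae lebesgue_measure, forall t, D t ->
          N (s k t - w t) @[k --> \oo] --> 0%E} &
      (\int[lebesgue_measure]_(t in D) (N (w t) ^+ 2) < +oo)%E].

End bochner.

Section obstacle_problem.
Context (R : realType) (n : nat).
Local Notation Rn := 'rV[R]_n.
Local Notation lebT := (@lebesgue_measure R).
Local Notation mu := (lebesgue_rV R n).
Local Notation muQ := (lebesgue_rV R n \x lebT)%E.
Variables (Omega : set Rn) (T : R).

Definition cyl : set (Rn * measurableTypeR R) := Omega `*` `]0, T[.

(* A function of time with values in functions of space, seen on the cylinder. *)
Definition onQ (E : Type) (w : R -> Rn -> E) (p : Rn * measurableTypeR R) : E :=
  w p.2 p.1.

(* wt is the distributional time derivative of w with values in H^{-1}(Omega):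
   int_0^T eta' w dt = - int_0^T eta wt dt in H^{-1}(Omega), tested against
   every z in H^1_0(Omega). *)
Definition weak_dt (w : R -> Rn -> R) (wt : R -> (Rn -> R) -> R) : Prop :=
  forall (eta : R -> R), test_fun (`]0, T[ : set R) eta ->
  forall z Z, H10 Omega z Z ->
    \int[lebT]_(t in `]0, T[) (derive1 eta t * \int[mu]_(x in Omega) (w t x * z x)) =
    - \int[lebT]_(t in `]0, T[) (eta t * wt t z).

(* w belongs to the admissible class for the obstacle phi, with spatial weak
   gradient Dw and time derivative wt.  The function w is the representative
   that is continuous from [0, T] to L^2(Omega), so w 0 and w T make sense. *)
Record admissible (phi : Rn -> R) (w : R -> Rn -> R) (Dw : R -> Rn -> Rn)
    (wt : R -> (Rn -> R) -> R) : Prop := Admissible {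
  adm_meas : measurable_fun cyl (onQ w) ;
  adm_meas_grad : forall i, measurable_fun cyl (fun p => onQ Dw p ord0 i) ;
  adm_L2H10 : bochner_L2 (V := ((Rn -> R^o) * (Rn -> Rn))%type)
    `]0, T[ [set p | H10 Omega p.1 p.2] (H1norm Omega) (fun t => (w t, Dw t)) ;
  adm_L2Hm1 : bochner_L2 (V := (Rn -> R) -> R^o)
    `]0, T[ [set xi | Hm1 Omega xi] (Hm1norm Omega) wt ;
  adm_dt : weak_dt w wt ;
  adm_cont : forall t, t \in `[0, T] ->
    L2 mu Omega (w t) /\
    L2norm mu Omega (w s \- w t) @[s --> within `[0, T] (nbhs t)] --> 0%E ;
  adm_obstacle : {ae muQ, forall p, cyl p -> phi p.1 <= onQ w p} }.

Definition obstacle_solution (phi : Rn -> R) (f : Rn * measurableTypeR R -> R)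
    (u0 : Rn -> R) (u : R -> Rn -> R) (Du : R -> Rn -> Rn)
    (ut : R -> (Rn -> R) -> R) : Prop :=
  [/\ admissible phi u Du ut,
      {ae mu, forall x, Omega x -> u 0 x = u0 x} &
      forall w Dw wt, admissible phi w Dw wt ->
        \int[lebT]_(t in `]0, T[) ut t (w t \- u t) +
        \int[muQ]_(p in cyl)
          dotrV (onQ Du p) (onQ Dw p - onQ Du p) >=
        \int[muQ]_(p in cyl) (f p * (onQ w p - onQ u p))].

(* Almost everywhere in the cylinder an admissible v satisfies v >= phi, so the
   second case is v = phi. *)
Definition contact_data (phi : Rn -> R) (v : R -> Rn -> R)
    (h : Rn * measurableTypeR R -> R) (p : Rn * measurableTypeR R) : R :=
  if phi p.1 < onQ v p then h p else Num.max 0 (h p).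

Definition friedrichs_constant (C : R) : Prop :=
  forall w G, H10 Omega w G ->
    (L2norm mu Omega w <= C%:E * L2norm mu Omega (fun x => enorm (G x)))%E.

End obstacle_problem.

(* Main.v *)
(** Put e = u - u'.  Testing the problem for u with u' and the problem for u' with u, and adding,
    gives <e_t, e> + ||D e||^2 <= (f - f', e) over the cylinder.  Almost everywhere
    (f - f') e <= g e: outside the contact set of u' both sides agree, and on it u' = phi <= u, so
    e >= 0 while f - f' <= g.  By Young's inequality and the Friedrichs inequality on almost every
    time slice, 2 (g, e) <= a CF^2 ||g||^2 + a^-1 ||D e||^2.  The first estimate then follows from
    ||e(T)||^2 - ||e(0)||^2 <= 2 <e_t, e>, and the second one from |g| <= |f - f'|.

    The inequality for <e_t, e> comes from the polarisation
    ||e(t)||^2 - ||e(s)||^2 <= 2 (e(t) - e(s), e(t)), where e(t) - e(s), tested against a fixed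
    element of H^1_0, is the integral of e_t over [s, t].  One averages this with s = t - h over t,
    replaces e(t) in the second slot by a simple curve that is close in L^2(0, T; H^1_0), and lets
    h tend to 0. *)
Require Import Defs.
From HB Require Import structures.
From mathcomp Require Import all_boot all_order all_algebra.
From mathcomp Require Import all_classical all_reals all_analysis.
From mathcomp Require Import measurable_realfun lra ring.

Set Implicit Arguments.
Unset Strict Implicit.
Unset Printing Implicit Defensive.

Import Order.TTheory GRing.Theory Num.Theory.
Import numFieldNormedType.Exports.

Local Open Scope classical_set_scope.
Local Open Scope ring_scope.

(** * Null sets and square integrable functions *)

(** The obstacle is the time derivative: [weak_dt] tests it only against smooth scalar functions
    times a fixed element of H^1_0, while the proof needs its pairing with the moving element e(t),
    which has no time derivative in H^1_0. Freezing e(t) at the later time of a pair t - h, t keeps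
    each use of [weak_dt] at a fixed element; the polarisation drops only ||e(t) - e(s)||^2, which
    is harmless since an upper bound is wanted. No density of smooth curves enters, only simple
    curves, which strong measurability provides. An integral has a value here for every function,
    measurable or not, and elements of the dual are arbitrary outside H^1_0. Everything is therefore
    restricted to times off a null set, where all curves lie in their spaces; removing that set
    requires no measurability of the integrand, and measurability of the pairings is proved on what
    is left. The constants come from Young's inequality with weight a CF^2: Friedrichs turns the
    second square into a^-1 ||D e||^2, which leaves 2 - a^-1 on the left. *)

Section null_sets.
Context d (T : measurableType d) (R : realType) (mu : {measure set T -> \bar R}).
Import HBNNSimple.

(** Neither [f] nor [D] is assumed measurable, so null sets can be discarded before an integrand is
    known to be measurable. The comparison takes place in the definition of the integral as a
    supremum over simple functions: cutting one off on [N] keeps its integral and makes it a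
    competitor on the smaller set. *)
Lemma ge0_integral_setD_null (D N : set T) (f : T -> \bar R) :
  measurable N -> mu N = 0%E -> (forall x, D x -> 0 <= f x)%E ->
  (\int[mu]_(x in D) f x = \int[mu]_(x in D `\` N) f x)%E.
Proof.
move=> mN N0 f0.
have f0' A : A `<=` D -> forall x, (0 <= (f \_ A) x)%E.
  by move=> AD x; rewrite patchE; case: ifPn => //; rewrite inE => /AD /f0.
rewrite integral_mkcond [RHS]integral_mkcond !ge0_integralTE; last 2 first.
- by apply: f0'; exact: subDsetl.
- exact: f0'.
apply/eqP; rewrite eq_le; apply/andP; split; apply: ge_ereal_sup => _ [h /= hf <-].
- have mCN : measurable (~` N) by exact: measurableC.
  pose h' := mul_nnsfun h (indic_nnsfun R mCN).
  have h'E x : h' x = h x * \1_(~` N) x by [].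
  apply: le_ereal_sup_tmp; exists (sintegral mu h'); last first.
    rewrite -!integralT_nnsfun.
    rewrite (@ge0_negligible_integral _ _ _ mu setT N)//; last 2 first.
    + exact/measurable_EFinP.
    + by move=> x _; rewrite lee_fin.
    rewrite [leRHS](@ge0_negligible_integral _ _ _ mu setT N)//; last 2 first.
    + exact/measurable_EFinP.
    + by move=> x _; rewrite lee_fin.
    rewrite le_eqVlt; apply/orP; left; apply/eqP/eq_integral => x; rewrite inE => -[_ Nx].
    by rewrite h'E indicE mem_set ?mulr1.
  exists h' => // x; rewrite h'E indicE.
  have [xN|xN] := boolP (x \in ~` N); last by rewrite mulr0 f0'//; exact: subDsetl.
  rewrite mulr1 (le_trans (hf x))// !patchE in_setD.
  move: xN; rewrite in_setC => ->; rewrite andbT.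
  by case: ifP.
- apply: le_ereal_sup_tmp; exists (sintegral mu h) => //.
  exists h => // x; rewrite (le_trans (hf x))// !patchE in_setD.
  case: ifPn => [/andP[->//]|_]; case: ifPn => //; rewrite inE; exact: f0.
Qed.

Lemma integral_setD_null (D N : set T) (f : T -> \bar R) :
  measurable N -> mu N = 0%E ->
  (\int[mu]_(x in D) f x = \int[mu]_(x in D `\` N) f x)%E.
Proof.
move=> mN N0; rewrite integralE [RHS]integralE.
by congr (_ - _)%E; apply: ge0_integral_setD_null.
Qed.

Lemma Rintegral_setD_null (D N : set T) (f : T -> R) :
  measurable N -> mu N = 0%E ->
  \int[mu]_(x in D) f x = \int[mu]_(x in D `\` N) f x.
Proof. by move=> mN N0; rewrite /Rintegral (integral_setD_null _ _ mN N0). Qed.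

End null_sets.

Lemma Rintegral_support d (T : measurableType d) (R : realType)
    (mu : {measure set T -> \bar R}) (A D : set T) (f : T -> R) :
  A `<=` D -> (forall x, D x -> ~ A x -> f x = 0) ->
  \int[mu]_(x in D) f x = \int[mu]_(x in A) f x.
Proof.
move=> AD f0; rewrite Rintegral_mkcond [RHS]Rintegral_mkcond.
apply: eq_Rintegral => x _; rewrite !patchE.
have [Ax|nAx] := pselect (A x); first by rewrite !mem_set//; exact: AD.
rewrite (memNset nAx); case: ifPn => //; rewrite inE => Dx; exact: f0.
Qed.

Section integrable_EFin.
Context d (T : measurableType d) (R : realType) (mu : {measure set T -> \bar R}).
Variable D : set T.
Hypothesis mD : measurable D.
Implicit Types f g : T -> R.

Lemma integrableD_EFin f g :
  mu.-integrable D (EFin \o f) -> mu.-integrable D (EFin \o g) ->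
  mu.-integrable D (EFin \o (fun x => f x + g x)).
Proof. by move=> fi gi; exact: eq_integrable (integrableD mD fi gi). Qed.

Lemma integrableZ_EFin (k : R) f : mu.-integrable D (EFin \o f) ->
  mu.-integrable D (EFin \o (fun x => k * f x)).
Proof. by move=> fi; exact: eq_integrable (integrableZl mD k fi). Qed.

Lemma integrableB_EFin f g :
  mu.-integrable D (EFin \o f) -> mu.-integrable D (EFin \o g) ->
  mu.-integrable D (EFin \o (fun x => f x - g x)).
Proof. by move=> fi gi; exact: eq_integrable (integrableB mD fi gi). Qed.

Lemma integrable_sum_EFin (I : Type) (s : seq I) (h : I -> T -> R) :
  (forall i, mu.-integrable D (EFin \o h i)) ->
  mu.-integrable D (EFin \o (fun x => \sum_(i <- s) h i x)).
Proof.
move=> hi; elim: s => [|i s IH].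
  by under [X in integrable _ _ X]eq_fun do rewrite /= big_nil; exact: integrable0.
have := integrableD_EFin (hi i) IH; apply: eq_integrable => // x _ /=.
by rewrite big_cons.
Qed.

Lemma Rintegral_sum (I : Type) (s : seq I) (h : I -> T -> R) :
  (forall i, mu.-integrable D (EFin \o h i)) ->
  \int[mu]_(x in D) (\sum_(i <- s) h i x) = \sum_(i <- s) \int[mu]_(x in D) h i x.
Proof.
move=> hi; elim: s => [|i s IH].
  rewrite big_nil; under eq_Rintegral do rewrite big_nil.
  by rewrite /Rintegral integral0.
rewrite big_cons -IH -RintegralD//; last exact: integrable_sum_EFin.
by apply: eq_Rintegral => x _; rewrite big_cons.
Qed.

Lemma le_Rintegral_subset (A : set T) f : measurable A -> A `<=` D ->
  mu.-integrable D (EFin \o f) -> (forall x, D x -> 0 <= f x) ->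
  \int[mu]_(x in A) f x <= \int[mu]_(x in D) f x.
Proof.
move=> mA AD fi f0; rewrite [leLHS]Rintegral_mkcond [leRHS]Rintegral_mkcond.
apply: le_Rintegral => //.
- by rewrite -restrict_EFin -integrable_mkcond//; exact: integrableS fi.
- by rewrite -restrict_EFin -integrable_mkcond.
- move=> x _; rewrite !patchE; case: ifPn => [|_].
    by rewrite inE => /AD Dx; rewrite mem_set.
  by case: ifPn => //; rewrite inE => /f0.
Qed.

Lemma integrable_cst_EFin (k : R) : (mu D < +oo)%E ->
  mu.-integrable D (EFin \o (fun=> k)).
Proof.
move=> Dfin; apply: (measurable_bounded_integrable (f := fun=> k)) => //.
by exists `|k|; split; [exact: num_real|move=> y ky t _; exact: ltW].
Qed.

End integrable_EFin.

Section L2_theory.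
Context d (T : measurableType d) (R : realType) (mu : {measure set T -> \bar R}).
Variable D : set T.
Hypothesis mD : measurable D.
Implicit Types f g : T -> R.

Lemma sqr_L2norm f :
  (L2norm mu D f ^+ 2 = \int[mu]_(x in D) (f x ^+ 2)%:E)%E.
Proof.
have e2 (y : \bar R) : (0 <= y)%E -> (y ^+ 2 = y `^ 2)%E.
  case: y => [r|_|//]; last by rewrite poweRyr ?pnatr_eq0.
  by rewrite lee_fin => r0; rewrite poweR_EFin powR_mulrn// EFin_expe.
rewrite e2; last exact: Lnorm_ge0.
rewrite /L2norm poweR_Lnorm// [RHS]integral_mkcond; apply: eq_integral => x _.
rewrite !patchE; case: ifP => _ /=; last by rewrite normr0 powR0 ?pnatr_eq0.
by rewrite powR_mulrn// real_normK// num_real.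
Qed.

Lemma L2norm_ge0 f : (0 <= L2norm mu D f)%E. Proof. exact: Lnorm_ge0. Qed.

Lemma L2_integrable_sqr f : L2 mu D f ->
  mu.-integrable D (EFin \o (fun x => f x ^+ 2)).
Proof.
move=> [mf ff]; apply/integrableP; split.
  exact/measurable_EFinP/measurable_funX.
under eq_integral do rewrite gee0_abs ?lee_fin ?sqr_ge0//.
rewrite -sqr_L2norm; move: ff (L2norm_ge0 f).
by case: (L2norm _ _ _) => // r _ _; rewrite -EFin_expe ltry.
Qed.

Lemma sqr_integrable_L2 f : measurable_fun D f ->
  mu.-integrable D (EFin \o (fun x => f x ^+ 2)) -> L2 mu D f.
Proof.
move=> mf /integrableP[_ fi]; split => //.
have : (L2norm mu D f ^+ 2 < +oo)%E.
  rewrite sqr_L2norm; apply: le_lt_trans fi.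
  by under [X in (_ <= X)%E]eq_integral do rewrite gee0_abs ?lee_fin ?sqr_ge0//.
by move: (L2norm_ge0 f); case: (L2norm _ _ _) => // r _ _; rewrite ltry.
Qed.

Lemma sqr_L2normE f : L2 mu D f ->
  (L2norm mu D f ^+ 2 = (\int[mu]_(x in D) (f x ^+ 2))%:E)%E.
Proof.
by move=> /L2_integrable_sqr fi; rewrite sqr_L2norm fineK//; exact: integrable_fin_num.
Qed.

Lemma L2normE f : L2 mu D f ->
  L2norm mu D f = (Num.sqrt (\int[mu]_(x in D) (f x ^+ 2)))%:E.
Proof.
move=> Lf; have := sqr_L2normE Lf; move: (L2norm_ge0 f) Lf.2.
case: (L2norm _ _ _) => // r r0 _; rewrite -EFin_expe => -[<-].
by rewrite sqrtr_sqr ger0_norm.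
Qed.

Lemma L2_mul_integrable f g : L2 mu D f -> L2 mu D g ->
  mu.-integrable D (EFin \o (fun x => f x * g x)).
Proof.
move=> Lf Lg.
apply: (le_integrable mD (g := EFin \o (fun x => f x ^+ 2 + g x ^+ 2))).
- by apply/measurable_EFinP/measurable_funM; [exact: Lf.1|exact: Lg.1].
- move=> x Dx /=; rewrite lee_fin [leRHS]ger0_norm ?addr_ge0 ?sqr_ge0//.
  rewrite normrM -(real_normK (num_real (f x))) -(real_normK (num_real (g x))).
  set a := `|f x|; set b := `|g x|; have := sqr_ge0 (a - b).
  have := sqr_ge0 (a + b); rewrite !expr2; lra.
- by have := integrableD mD (L2_integrable_sqr Lf) (L2_integrable_sqr Lg).
Qed.

Lemma L2_lin (a : R) f g : L2 mu D f -> L2 mu D g ->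
  L2 mu D (fun x => a * f x + g x).
Proof.
move=> Lf Lg; apply: sqr_integrable_L2.
  by apply: measurable_funD; [apply: measurable_funM => //; exact: Lf.1|exact: Lg.1].
have If := L2_integrable_sqr Lf; have Ig := L2_integrable_sqr Lg.
have Ifg := L2_mul_integrable Lf Lg.
have := integrableD mD (integrableZl mD (a ^+ 2) If)
  (integrableD mD (integrableZl mD (2 * a) Ifg) Ig).
by apply: eq_integrable => // x _ /=; rewrite -!EFinM -!EFinD; congr (_%:E); ring.
Qed.

Lemma L2_cst0 : L2 mu D (fun=> 0 : R).
Proof.
apply: sqr_integrable_L2 => //.
by under [X in integrable _ _ X]eq_fun do rewrite /= expr0n; exact: integrable0.
Qed.

Lemma L2D f g : L2 mu D f -> L2 mu D g -> L2 mu D (fun x => f x + g x).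
Proof. by move=> /(L2_lin 1)/[apply]; congr L2; apply/funext => x; rewrite mul1r. Qed.

Lemma L2Z (a : R) f : L2 mu D f -> L2 mu D (fun x => a * f x).
Proof.
by move=> /(L2_lin a)/(_ L2_cst0); congr L2; apply/funext => x; rewrite addr0.
Qed.

Lemma L2N f : L2 mu D f -> L2 mu D (fun x => - f x).
Proof. by move=> /(L2Z (-1)); congr L2; apply/funext => x; rewrite mulN1r. Qed.

Lemma L2B f g : L2 mu D f -> L2 mu D g -> L2 mu D (fun x => f x - g x).
Proof. by move=> Lf /L2N; exact: L2D. Qed.

Lemma bounded_L2 f (M : R) : (mu D < +oo)%E -> measurable_fun D f ->
  (forall x, D x -> `|f x| <= M) -> L2 mu D f.
Proof.
move=> Dfin mf fM; apply: sqr_integrable_L2 => //.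
apply: measurable_bounded_integrable => //; first exact: measurable_funX.
exists (M ^+ 2); split; first exact: num_real.
move=> y My x Dx; apply: le_trans (ltW My).
by rewrite normrX lerXn2r ?nnegrE// ?fM// (le_trans (normr_ge0 (f x)))// fM.
Qed.

Lemma le_L2 f g : measurable_fun D f -> L2 mu D g ->
  (forall x, D x -> `|f x| <= `|g x|) -> L2 mu D f.
Proof.
move=> mf Lg fg; apply: sqr_integrable_L2 => //.
apply: le_integrable (L2_integrable_sqr Lg) => //.
- exact/measurable_EFinP/measurable_funX.
- by move=> x Dx /=; rewrite lee_fin !normrX lerXn2r ?nnegrE// fg.
Qed.

End L2_theory.

(** * Smooth step functions *)

Section Ck_theory.
Context (R : realType) (V : normedModType R).
Implicit Types f g : V -> R.

Lemma Ck_continuous k f : Ck k f -> continuous f.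
Proof. by case: k => [|k] []. Qed.

Lemma CkW k f : Ck k.+1 f -> Ck k f.
Proof.
elim: k f => [f [cf _]//|k IH f [cf df]]; split => // v.
by have [dfv Cf] := df v; split => //; exact: IH.
Qed.

Lemma Ck_lin k (a : R) f g : Ck k f -> Ck k g -> Ck k (fun x => a * f x + g x).
Proof.
elim: k f g => [|k IH] f g [cf df] [cg dg]; split => //.
- by move=> x; apply: cvgD; [apply: cvgM; [exact: cvg_cst|exact: cf]|exact: cg].
- by move=> x; apply: cvgD; [apply: cvgM; [exact: cvg_cst|exact: cf]|exact: cg].
move=> v; have [dfv Cf] := df v; have [dgv Cg] := dg v; split.
  by move=> x; apply: (derivableD (f := a *: f)) => //; exact: derivableZ.
rewrite (_ : (fun x => _) = (fun x => a * 'D_v f x + 'D_v g x)); first exact: IH.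
apply/funext => x; rewrite (deriveD (f := a *: f))//; last exact: derivableZ.
by rewrite deriveZ.
Qed.

Lemma Ck_cst k (c : R) : Ck k (cst c : V -> R).
Proof.
elim: k c => [|k IH] c; split => //; try exact: cst_continuous.
move=> v; split; first by move=> x; exact: derivable_cst.
by rewrite (_ : (fun x => _) = cst 0)//; apply/funext => x; rewrite derive_cst.
Qed.

Lemma CkM k f g : Ck k f -> Ck k g -> Ck k (fun x => f x * g x).
Proof.
elim: k f g => [|k IH] f g Cf Cg.
  by split => // x; apply: cvgM; [exact: (Ck_continuous Cf)|exact: (Ck_continuous Cg)].
split; first by move=> x; apply: cvgM; [exact: (Ck_continuous Cf)|exact: (Ck_continuous Cg)].
move=> v; have [dfv Cf'] := Cf.2 v; have [dgv Cg'] := Cg.2 v; split.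
  by move=> x; exact: derivableM.
rewrite (_ : (fun x => _) = (fun x => 1 * (f x * 'D_v g x) + g x * 'D_v f x)).
  by apply: Ck_lin; apply: IH => //; exact: CkW.
by apply/funext => x; rewrite deriveM// mul1r.
Qed.

Lemma test_fun_lin (U : set V) (a : R) f g : test_fun U f -> test_fun U g ->
  test_fun U (fun x => a * f x + g x).
Proof.
move=> [sf [K [cK KU K0]]] [sg [L [cL LU L0]]]; split.
  by move=> k; exact: Ck_lin.
exists (K `|` L); split; first exact: compactU.
  by move=> x [/KU|/LU].
by move=> x /not_orP[/K0-> /L0->]; rewrite mulr0 addr0.
Qed.

Lemma test_fun0 (U : set V) : test_fun U (fun=> 0 : R).
Proof. by split; [move=> k; exact: Ck_cst|exists set0; split => //; exact: compact0]. Qed.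

End Ck_theory.

Section smooth_step.
Context (R : realType).
Implicit Types (f g : R -> R) (x : R).

Lemma derivable_continuous f x : derivable f x 1 -> {for x, continuous f}.
Proof. by move=> /derivable1_diffP/differentiable_continuous. Qed.

(** On the line the derivative along [v] is [v] times the derivative along 1, so the quantification
    over directions in [Ck] reduces to a single derivative. *)
Lemma Ck_is_derive k f f' :
  (forall x, is_derive x (1 : R) f (f' x)) -> Ck k f' -> Ck k.+1 f.
Proof.
move=> df Cf'; have df1 x : derivable f x 1 by have [] := df x.
split; first by move=> x; exact: derivable_continuous.
move=> v.
have dfx x : differentiable f x by exact/derivable1_diffP.
split; first by move=> x; exact: diff_derivable.
rewrite (_ : (fun x => _) = (fun x => v * f' x + 0)).
  by apply: Ck_lin => //; exact: Ck_cst.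
apply/funext => x; rewrite deriveE// addr0.
have -> : v = v *: (1 : R) by rewrite /GRing.scale /= mulr1.
by rewrite linearZ -deriveE// (@derive_val _ _ _ _ _ _ _ (df x)) /GRing.scale /= mulr1.
Qed.

(* The powers of [x^-1] make the family stable under differentiation. *)
Definition flat (m : nat) (x : R) : R :=
  if 0 < x then x^-1 ^+ m * expR (- x^-1) else 0.

Lemma flat_le0 m x : x <= 0 -> flat m x = 0.
Proof. by move=> x0; rewrite /flat ltNge x0. Qed.

Lemma flat_ge0 m x : 0 <= flat m x.
Proof.
rewrite /flat; case: ifP => // x0.
by rewrite mulr_ge0 ?expR_ge0// exprn_ge0// invr_ge0 ltW.
Qed.

(** With y = 1/x, the exponential series gives exp y >= y^(m+2) / (m+2)!, hence y^m exp(-y) <=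
    (m+2)! y^(-2). Order two is what makes the difference quotient at 0 tend to 0. *)
Lemma flat_le_sqr m x : flat m x <= m.+2`!%:R * x ^+ 2.
Proof.
rewrite /flat; case: ifP => x0; last by rewrite mulr_ge0// sqr_ge0.
have y0 : 0 < x^-1 by rewrite invr_gt0.
have := expR_ge1Dxn m.+1 (ltW y0); set F := m.+2`!%:R => h.
have F0 : 0 < F by rewrite ltr0n fact_gt0.
have {h} h : x^-1 ^+ m.+2 / F <= expR x^-1 by apply: le_trans h; rewrite lerDr.
rewrite expRN -ler_pdivrMr ?exprn_gt0//.
rewrite -[leLHS]mulrA mulrC -[in leLHS]invfM -[leLHS]mulrC.
rewrite ler_pdivrMr ?mulr_gt0 ?exprn_gt0 ?expR_gt0//.
have -> : F * (expR x^-1 * x ^+ 2) = (F * expR x^-1) * x ^+ 2 by ring.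
rewrite ler_pdivrMr// in h.
have -> : x^-1 ^+ m = x^-1 ^+ m.+2 * x ^+ 2.
  by rewrite -addn2 exprD -mulrA -exprMn mulVf ?gt_eqF// expr1n mulr1.
by rewrite ler_pM2r ?exprn_gt0// mulrC.
Qed.

(** For x > 0 put y = 1/x, so that y' = - y^2; differentiating y^m exp(-y) gives y^(m+2) exp(-y) - m
    y^(m+1) exp(-y). At 0 the formula survives because both terms vanish there. *)
Lemma is_derive_flat m x :
  is_derive x (1 : R) (flat m) (flat m.+2 x - m%:R * flat m.+1 x).
Proof.
have [x0|x0|->] := ltgtP x 0.
- rewrite !flat_le0 ?ltW// mulr0 subr0.
  apply: (@near_eq_is_derive _ _ _ (cst 0)).
  by near=> y; rewrite flat_le0//; apply: ltW; near: y; exact: lt_nbhsl.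
- have E : \near x, x^-1 ^+ m * expR (- x^-1) = flat m x.
    by near=> y; rewrite /flat ifT//; near: y; exact: lt_nbhsr.
  apply: (near_eq_is_derive E).
  have dV : is_derive x (1 : R) (fun y : R => y^-1) (- x ^- 2).
    apply: is_derive_eq (is_deriveV (f := id) _ (is_derive_id _ _)) _.
      by rewrite gt_eqF.
    by rewrite /GRing.scale /= mulr1.
  have dX : is_derive x (1 : R) (fun y : R => y^-1 ^+ m)
      ((m%:R * x^-1 ^+ m.-1) *: (- x ^- 2)).
    rewrite (_ : (fun y => _) = (fun y : R => y^-1) ^+ m); first exact: (is_deriveX m dV).
    by apply/funext => y; rewrite exprfctE.
  have dN : is_derive x (1 : R) (fun y : R => - y^-1) (- - x ^- 2).
    exact: (is_deriveN dV).
  have dE : is_derive x (1 : R) (fun y : R => expR (- y^-1)) (expR (- x^-1) * (- - x ^- 2)).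
    by apply: (is_derive1_comp (f := expR) (g := fun y : R => - y^-1)); exact: is_derive_expR.
  apply: is_derive_eq (is_deriveM dX dE) _.
  rewrite /flat x0 /GRing.scale /= opprK -exprVn.
  by case: m {dX E} => [|m]; rewrite ?exprS/=; ring.
- rewrite !flat_le0// mulr0 subr0.
  have c : h^-1 *: (flat m (h *: 1 + 0) - flat m 0) @[h --> 0^'] --> (0 : R).
    apply/cvgrPdist_le => /= e e0; near=> h.
    rewrite (flat_le0 m (lexx 0)) addr0 subr0 sub0r normrN /GRing.scale/= mulr1.
    have h0 : h != 0 by near: h; exact: nbhs_dnbhs_neq.
    rewrite normrM normfV (ger0_norm (flat_ge0 _ _)) ler_pdivrMl ?normr_gt0//.
    apply: le_trans (flat_le_sqr _ _) _.
    rewrite -(real_normK (num_real h)) expr2 mulrA mulrC ler_wpM2l//.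
    rewrite -ler_pdivlMl ?ltr0n ?fact_gt0//.
    by near: h; apply: dnbhs0_le; rewrite mulr_gt0// invr_gt0 ltr0n fact_gt0.
  by apply: DeriveDef; [apply/cvg_ex; exists 0|apply/cvg_lim].
Unshelve. all: by end_near. Qed.

Lemma flat_continuous m : continuous (flat m).
Proof.
by move=> x; apply: derivable_continuous; have [] := is_derive_flat m x.
Qed.

(** The induction must cover all [m] at once, since differentiating [flat m] produces [flat m.+1]
    and [flat m.+2]. The composition with [g] is built in because [smooth_step] nests [flat 0]
    inside itself. *)
Lemma Ck_flat_comp k m g : Ck k g -> Ck k (flat m \o g).
Proof.
elim: k m g => [|k IH] m g Cg.
  by split => // x; apply: continuous_comp; [exact: (Ck_continuous Cg)|exact: flat_continuous].
have [dg Cg'] := Cg.2 1.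
apply: (@Ck_is_derive _ _ (fun x => (1 * (flat m.+2 \o g) x + - (m%:R * (flat m.+1 \o g) x + 0)) * 'D_1 g x)).
  move=> x; apply: is_derive_eq (is_derive1_comp (is_derive_flat m (g x)) (DeriveDef (dg x) erefl)) _.
  by rewrite mul1r addr0.
have Cgk := CkW Cg.
apply: CkM => //.
rewrite (_ : (fun x => _) = (fun x => (- m%:R) * (flat m.+1 \o g) x + (flat m.+2 \o g) x)).
  by apply: Ck_lin; apply: IH.
by apply/funext => x; rewrite mul1r addr0 mulNr addrC.
Qed.

(* As [expR 1 * flat 0 1 = 1] and [flat 0] vanishes on negative numbers, this is [0] for
   [x <= 0] and [1] for [1 <= x]. *)
Definition smooth_step (x : R) : R := 1 - expR 1 * flat 0 (1 - expR 1 * flat 0 x).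

Lemma flat0_le1 x : x <= 1 -> expR 1 * flat 0 x <= 1.
Proof.
move=> x1; rewrite /flat; case: ifP => x0; last by rewrite mulr0.
rewrite expr0 mul1r -expRD expR_le1 subr_le0.
by rewrite -[leLHS]invr1 lef_pV2 ?posrE.
Qed.

Lemma flat0_ge1 x : 1 <= x -> 1 <= expR 1 * flat 0 x.
Proof.
move=> x1; have x0 : 0 < x by exact: lt_le_trans x1.
by rewrite /flat x0 expr0 mul1r -expRD -[leLHS]expR0 ler_expR subr_ge0 invf_le1.
Qed.

Lemma smooth_step_le0 x : x <= 0 -> smooth_step x = 0.
Proof.
move=> x0; rewrite /smooth_step (flat_le0 0 x0) mulr0 subr0.
by rewrite /flat ltr01 expr0 mul1r invr1 -expRD subrr expR0 subrr.
Qed.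

Lemma smooth_step_ge1 x : 1 <= x -> smooth_step x = 1.
Proof.
move=> x1; rewrite /smooth_step (flat_le0 _ (x := 1 - _)) ?mulr0 ?subr0//.
by rewrite subr_le0 flat0_ge1.
Qed.

Lemma smooth_step_ge0 x : 0 <= smooth_step x.
Proof. by rewrite subr_ge0 flat0_le1// gerBl mulr_ge0 ?expR_ge0 ?flat_ge0. Qed.

Lemma smooth_step_le1 x : smooth_step x <= 1.
Proof. by rewrite gerBl mulr_ge0 ?expR_ge0 ?flat_ge0. Qed.

Lemma Ck_smooth_step k g : Ck k g -> Ck k (smooth_step \o g).
Proof.
move=> Cg; rewrite (_ : _ \o _ = (fun x => - expR 1 *
  (flat 0 \o (fun x => - expR 1 * (flat 0 \o g) x + cst 1 x)) x + cst 1 x)).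
  apply: Ck_lin; last exact: Ck_cst.
  by apply/Ck_flat_comp/Ck_lin; [exact: Ck_flat_comp|exact: Ck_cst].
by apply/funext => x; rewrite /= /smooth_step !mulNr ![_ + 1]addrC.
Qed.

Lemma Ck_affine k (a b : R) : Ck k (fun x : R => a * x + b).
Proof.
case: k => [|k].
  by split => // x; apply: cvgD; [apply: cvgM; [exact: cvg_cst|exact: cvg_id]|exact: cvg_cst].
apply: (@Ck_is_derive _ _ (cst a)); last exact: Ck_cst.
move=> x; have d := is_deriveD (is_deriveZ a (is_derive_id x (1 : R))) (is_derive_cst b x (1 : R)).
by apply: is_derive_eq d _; rewrite addr0 /GRing.scale /= mulr1.
Qed.

Lemma smooth_smooth_step : smooth smooth_step.
Proof.
move=> k.
have -> : smooth_step = smooth_step \o (fun x => 1 * x + 0).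
  by apply/funext => y /=; rewrite mul1r addr0.
exact/Ck_smooth_step/Ck_affine.
Qed.

Lemma is_derive_smooth_step x : is_derive x (1 : R) smooth_step ('D_1 smooth_step x).
Proof. by have [_ /(_ 1)[d _]] := smooth_smooth_step 1; exact: DeriveDef. Qed.

Lemma derive_smooth_step_continuous : continuous ('D_1 smooth_step).
Proof. by have [_ /(_ 1)[_ [c _]]] := smooth_smooth_step 1. Qed.

Lemma derive_smooth_step_lt0 x : x < 0 -> 'D_1 smooth_step x = 0.
Proof.
move=> x0; rewrite (@near_eq_derive _ _ _ _ (cst 0) x) ?derive_cst//.
by near=> y; rewrite smooth_step_le0//; apply: ltW; near: y; exact: lt_nbhsl.
Unshelve. all: by end_near. Qed.

Lemma derive_smooth_step_gt1 x : 1 < x -> 'D_1 smooth_step x = 0.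
Proof.
move=> x1; rewrite (@near_eq_derive _ _ _ _ (cst (1 : R)) x) ?derive_cst//.
by near=> y; rewrite smooth_step_ge1//; apply: ltW; near: y; exact: lt_nbhsr.
Unshelve. all: by end_near. Qed.

Lemma derive_smooth_step_bounded : exists2 C : R, 0 < C & forall x, `|'D_1 smooth_step x| <= C.
Proof.
have c := derive_smooth_step_continuous.
have [M [_ hM]] := compact_bounded (continuous_compact (continuous_subspaceT c) (@segment_compact R 0 1)).
exists (`|M| + 1); first by rewrite ltr_pwDr.
move=> x; have lM : M < `|M| + 1 by rewrite ltr_pwDr// ler_norm.
have [x0|x0] := ltP x 0; first by rewrite derive_smooth_step_lt0// normr0.
have [x1|x1] := ltP 1 x; first by rewrite derive_smooth_step_gt1// normr0.
by apply: (hM _ lM); exists x => //=; rewrite in_itv /= x0 x1.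
Qed.

End smooth_step.

(** * Integrals and averages on the line *)

Section line_integrals.
Context (R : realType).
Local Notation leb := (@lebesgue_measure R).
Implicit Types (f g F : R -> R) (a b x : R).

Lemma lebesgue_measure_itv_le (ba bb : bool) a b : a <= b ->
  lebesgue_measure ([set` Interval (BSide ba a) (BSide bb b)] : set R) = (b - a)%:E :> \bar R.
Proof.
rewrite le_eqVlt => /predU1P[->|ab].
  by rewrite lebesgue_measure_itv /= ltxx subrr.
by rewrite lebesgue_measure_itv /= lte_fin ab -EFinD.
Qed.

Lemma lebesgue_measure_itv_lty (ba bb : bool) a b :
  (lebesgue_measure ([set` Interval (BSide ba a) (BSide bb b)] : set R) < +oo)%E.
Proof.
by rewrite lebesgue_measure_itv; case: ifP => _; rewrite ?ltry// -EFinD ltry.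
Qed.

Lemma continuous_integrable_itv f a b : continuous f ->
  leb.-integrable `[a, b] (EFin \o f).
Proof.
move=> cf; apply: continuous_compact_integrable; first exact: segment_compact.
exact: continuous_subspaceT.
Qed.

Lemma continuous_integrable_itvoc f a b : continuous f ->
  leb.-integrable `]a, b] (EFin \o f).
Proof.
move=> cf; apply: integrableS (continuous_integrable_itv a b cf) => //.
exact: subset_itv_oc_cc.
Qed.

Lemma continuous_integrable_itvoo f a b : continuous f ->
  leb.-integrable `]a, b[ (EFin \o f).
Proof.
move=> cf; apply: integrableS (continuous_integrable_itv a b cf) => //.
exact: subset_itv_oo_cc.
Qed.

Lemma Rintegral_itvoo_cc f a b : leb.-integrable `[a, b] (EFin \o f) ->
  \int[leb]_(t in `]a, b[) f t = \int[leb]_(t in `[a, b]) f t.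
Proof.
move=> fi; have s : `]a, b[ `<=` `[a, b] by exact: subset_itv_oo_cc.
rewrite Rintegral_itv_bndo_bndc; last exact: integrableS fi.
rewrite Rintegral_itv_obnd_cbnd//; apply: integrableS fi => //.
exact: subset_itv_oc_cc.
Qed.

Lemma Rintegral_itvoc_cc f a b : leb.-integrable `[a, b] (EFin \o f) ->
  \int[leb]_(t in `]a, b]) f t = \int[leb]_(t in `[a, b]) f t.
Proof.
move=> fi; rewrite Rintegral_itv_obnd_cbnd//; apply: integrableS fi => //.
exact: subset_itv_oc_cc.
Qed.

Lemma Rintegral_is_derive F f a b : a <= b -> continuous f ->
  (forall x, is_derive x (1 : R) F (f x)) ->
  \int[leb]_(t in `[a, b]) f t = F b - F a.
Proof.
rewrite le_eqVlt => /predU1P[->|ab] cf dF.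
  by rewrite subrr set_itv1 Rintegral_set1.
have cF : continuous F by move=> x; apply: derivable_continuous; have [] := dF x.
rewrite /Rintegral (@continuous_FTC2 _ f F)//.
- exact: continuous_subspaceT.
- split; first by move=> x _; have [] := dF x.
  + exact/cvg_at_right_filter/cF.
  + exact/cvg_at_left_filter/cF.
- by move=> x _; rewrite derive1E; have [] := dF x.
Qed.

Lemma ler_norm_Rintegral_cst d (X : measurableType d)
    (mu : {measure set X -> \bar R}) (D : set X) (f : X -> R) (K m : R) :
  measurable D -> mu.-integrable D (EFin \o f) -> mu D = m%:E ->
  (forall t, D t -> `|f t| <= K) -> `|\int[mu]_(t in D) f t| <= K * m.
Proof.
move=> mD fi Dm fK; apply: le_trans (le_normr_Rintegral mD fi) _.
rewrite (_ : K * m = \int[mu]_(t in D) K); last by rewrite Rintegral_cst// Dm.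
apply: le_Rintegral => //; first exact: integrable_norm.
by apply: integrable_cst_EFin; rewrite // Dm ltry.
Qed.

(** The base point -oo gives an integrable function one continuous primitive on the whole line. For
    continuous functions, [antiderivative_continuous] gives a primitive that is differentiable
    everywhere. *)
Definition prim f x : R := \int[leb]_(t in `]-oo, x]) f t.

Lemma primB f a b : leb.-integrable setT (EFin \o f) -> a <= b ->
  prim f b - prim f a = \int[leb]_(t in `]a, b]) f t.
Proof.
move=> fi ab; rewrite /prim Rintegral_itvB//.
exact: integrableS fi.
Qed.

Lemma prim_continuous f : leb.-integrable setT (EFin \o f) -> continuous (prim f).
Proof.
move=> fi x; apply/cvgrPdist_lt => /= e e0.
have [d [d0 hd]] := integral_normr_continuous fi e0.
have key y z : y <= z -> z - y < d -> `|prim f z - prim f y| < e.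
  move=> yz zyd; rewrite primB//.
  apply: le_lt_trans (le_normr_Rintegral _ _) _ => //.
    exact: integrableS fi.
  have m : (leb `]y, z] < d%:E)%E.
    rewrite lebesgue_measure_itv/= lte_fin.
    by case: ifP => _; rewrite ?lte_fin// -EFinD lte_fin.
  exact: (hd _ _ m).
near=> y; have xyd : `|x - y| < d by near: y; exact: cvgr_dist_lt.
have [xy|yx] := leP x y.
  by rewrite distrC key//; apply: le_lt_trans xyd; rewrite distrC ler_norm.
by rewrite key ?(ltW yx)//; apply: le_lt_trans xyd; exact: ler_norm.
Unshelve. all: by end_near. Qed.

Lemma prim_ge0 f x : (forall t, 0 <= f t) -> 0 <= prim f x.
Proof. by move=> f0; apply: Rintegral_ge0 => t _. Qed.

Lemma prim_le_int f x : leb.-integrable setT (EFin \o f) -> (forall t, 0 <= f t) ->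
  prim f x <= \int[leb]_t f t.
Proof.
by move=> fi f0; exact: le_Rintegral_subset.
Qed.

(** The fundamental theorem needs a base point to the left of [x], so no single one serves the whole
    line. The base point moves with [x], and subtracting the value at 0 makes the result independent
    of it. *)
Lemma antiderivative_continuous f : continuous f ->
  exists F, forall x, is_derive x (1 : R) F (f x).
Proof.
move=> cf.
pose F0 a x := \int[leb]_(t in `[a, x]) f t.
have dF0 a x : a < x -> is_derive x (1 : R) (F0 a) (f x).
  move=> ax; have [d e] := @continuous_FTC1_closed _ f a x (x + 1)
    (ltac:(by rewrite ltrDl)) (continuous_integrable_itv _ _ cf) ax (cf x).
  by apply: (DeriveDef d); rewrite -derive1E; exact: e.
exists (fun x => F0 (- (`|x| + 1)) x - F0 (- (`|x| + 1)) 0) => x.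
(* For |y - x| < 1 this lies to the left of the base point - (|y| + 1), so near [x] every moving
   base point can be replaced by the fixed [A]. *)
pose A := - (`|x| + 2).
have Ax : A < x by rewrite /A ltrNl (le_lt_trans (ler_norm _))// normrN ltrDl.
have A0 : A < 0 by rewrite oppr_lt0 ltr_wpDl.
apply: (@near_eq_is_derive _ _ _ (fun y => F0 A y - F0 A 0)).
  near=> y.
  have yx : `|y - x| < 1 by near: y; apply: cvgr_distC_lt.
  have Ay : A <= - (`|y| + 1).
    rewrite lerN2 -lerBrDr; have := ler_normD x (y - x).
    by rewrite (addrC x) subrK; move: yx; lra.
  have yy : - (`|y| + 1) <= y by rewrite lerNl (le_trans (ler_norm _))// normrN lerDl.
  have y0 : - (`|y| + 1) <= 0 by rewrite oppr_le0 addr_ge0.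
  have key z : - (`|y| + 1) <= z -> F0 A z - F0 A (- (`|y| + 1)) = F0 (- (`|y| + 1)) z.
    move=> yz; rewrite /F0 Rintegral_itvB ?bnd_simp//.
      exact/Rintegral_itvoc_cc/continuous_integrable_itv.
    exact: continuous_integrable_itv.
  by rewrite -(key y)// -(key 0)//; ring.
have := is_deriveB (dF0 A x Ax) (is_derive_cst (F0 A 0) x (1 : R)).
by rewrite subr0.
Unshelve. all: by end_near. Qed.

End line_integrals.

(** * Backward averages and their convergence *)

Section averages.
Context (R : realType).
Local Notation leb := (@lebesgue_measure R).
Implicit Types (f g F phi psi : R -> R) (a b c x : R).

Lemma Rintegral_dominated_cvg d (X : measurableType d)
    (mu : {measure set X -> \bar R}) (D : set X) (f_ : nat -> X -> R) (f g : X -> R) :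
  measurable D -> (forall n, measurable_fun D (f_ n)) ->
  (forall t, D t -> f_ n t @[n --> \oo] --> f t) ->
  mu.-integrable D (EFin \o g) ->
  (forall n t, D t -> `|f_ n t| <= g t) ->
  (\int[mu]_(t in D) f_ n t) @[n --> \oo] --> \int[mu]_(t in D) f t.
Proof.
move=> mD mf_ cf gi fg.
have mf : measurable_fun D f by exact: (measurable_fun_cvg mf_).
have ecf : {ae mu, forall t, D t -> (f_ n t)%:E @[n --> \oo] --> (f t)%:E}.
  by apply: aeW => t Dt; apply/cvg_EFin; [exact: nearW|exact: cf].
have efg : {ae mu, forall t n, D t -> (`|(f_ n t)%:E| <= (g t)%:E)%E}.
  by apply: aeW => t n Dt; rewrite lee_fin fg.
have [fi _] := dominated_convergence mD
  (fun n => (measurable_EFinP _ _).2 (mf_ n)) ((measurable_EFinP _ _).2 mf) ecf gi efg.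
have fin : (\int[mu]_(t in D) (f t)%:E)%E \is a fin_num by exact: integrable_fin_num.
by rewrite -[X in _ --> X]fineK// => /fine_cvg.
Qed.

Lemma derive_shifted_quotient F x (l : R) : is_derive x (1 : R) F l ->
  n.+1%:R * (F x - F (x - n.+1%:R^-1)) @[n --> \oo] --> l.
Proof.
move=> [dF eF].
have : h^-1 *: (F (h *: 1 + x) - F x) @[h --> 0^'] --> l by rewrite -eF.
move=> /cvgr_dnbhsP/(_ (fun n => - n.+1%:R^-1)) c.
have {}c := c (conj _ _); apply: cvg_trans (c _ _).
- apply: near_eq_cvg; near=> n => /=.
  by rewrite /GRing.scale /= mulr1 invrN invrK mulNr -mulrN opprB (addrC x).
- by move=> n; rewrite oppr_eq0 invr_eq0 pnatr_eq0.
- rewrite -oppr0; apply: cvgN; exact: cvg_harmonic.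
Unshelve. all: by end_near. Qed.

(** The Steklov mean with step h = 1/(n+1). The window lies behind [t] because the energy argument
    freezes e at the later of the two times t - h and t. *)
Definition avg f (n : nat) (t : R) : R :=
  n.+1%:R * \int[leb]_(s in `]t - n.+1%:R^-1, t]) f s.

Let sub_le t n : t - n.+1%:R^-1 <= t :> R.
Proof. by rewrite gerBl invr_ge0. Qed.

Let near_le (a t s : R) n : a <= t -> t - n.+1%:R^-1 < s -> a - 1 <= s.
Proof.
have : (n.+1%:R^-1 : R) <= 1 by rewrite invf_le1// ler1n.
move: (n.+1%:R^-1) => h; lra.
Qed.

Let lebesgue_itvoc (t : R) n :
  lebesgue_measure (`]t - n.+1%:R^-1, t] : set R) = (n.+1%:R^-1)%:E :> \bar R.
Proof. by rewrite lebesgue_measure_itv_le ?sub_le//; congr (_%:E); ring. Qed.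

Lemma avg_prim f n t : leb.-integrable setT (EFin \o f) ->
  avg f n t = n.+1%:R * (prim f t - prim f (t - n.+1%:R^-1)).
Proof. by move=> fi; rewrite /avg primB. Qed.

Lemma avg_antiderivative f F n t : continuous f ->
  (forall x, is_derive x (1 : R) F (f x)) ->
  avg f n t = n.+1%:R * (F t - F (t - n.+1%:R^-1)).
Proof.
move=> cf dF; rewrite /avg Rintegral_itvoc_cc; last exact: continuous_integrable_itv.
by rewrite (Rintegral_is_derive _ cf dF).
Qed.

Let quotient_continuous F n : continuous F ->
  continuous (fun t : R => n.+1%:R * (F t - F (t - n.+1%:R^-1))).
Proof.
move=> cF t; apply: cvgM; first exact: cvg_cst.
apply: cvgB; first exact: cF.
by apply: continuous_comp; [apply: cvgB; [exact: cvg_id|exact: cvg_cst]|exact: cF].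
Qed.

Lemma avg_integrable_continuous f n : leb.-integrable setT (EFin \o f) ->
  continuous (avg f n).
Proof.
move=> fi; rewrite (_ : avg f n = fun t => n.+1%:R * (prim f t - prim f (t - n.+1%:R^-1))).
  exact/quotient_continuous/prim_continuous.
by apply/funext => t; rewrite avg_prim.
Qed.

Lemma avg_continuous f n : continuous f -> continuous (avg f n).
Proof.
move=> cf; have [F dF] := antiderivative_continuous cf.
rewrite (_ : avg f n = fun t => n.+1%:R * (F t - F (t - n.+1%:R^-1))).
  by apply: quotient_continuous => x; apply: derivable_continuous; have [] := dF x.
by apply/funext => t; rewrite (avg_antiderivative _ _ cf dF).
Qed.

(* Shifting the variable turns the integral of a difference quotient into a difference of averages. *)
Lemma Rintegral_quotient f F a b n : continuous f ->
  (forall x, is_derive x (1 : R) F (f x)) -> a <= b ->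
  \int[leb]_(t in `[a, b]) (n.+1%:R * (f t - f (t - n.+1%:R^-1))) =
  avg f n b - avg f n a.
Proof.
move=> cf dF ab; rewrite !(avg_antiderivative _ _ cf dF) -mulrBr.
set h := n.+1%:R^-1.
apply: etrans (Rintegral_is_derive (F := fun t => n.+1%:R * (F t - F (t - h))) ab _ _) _.
- exact: quotient_continuous.
- move=> x.
  have d1 : is_derive x (1 : R) (fun t => t - h) 1.
    by have := is_deriveB (is_derive_id x (1 : R)) (is_derive_cst h x (1 : R)); rewrite subr0.
  have d2 : is_derive x (1 : R) (fun t => F (t - h)) (f (x - h)).
    by have := @is_derive1_comp _ F (fun t => t - h) x _ _ (dF (x - h)) d1; rewrite mulr1.
  exact: (is_deriveZ n.+1%:R (is_deriveB (dF x) d2)).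
- by ring.
Qed.

Lemma avg_ge0 f n t : (forall s, 0 <= f s) -> 0 <= avg f n t.
Proof. by move=> f0; rewrite mulr_ge0// Rintegral_ge0. Qed.

Lemma avg_le_cst f n t K : continuous f -> (forall s, f s <= K) -> avg f n t <= K.
Proof.
move=> cf fK; rewrite /avg -ler_pdivlMl// Rintegral_itvoc_cc; last exact: continuous_integrable_itv.
have m : leb `[t - n.+1%:R^-1, t] = (n.+1%:R^-1)%:E.
  by apply: etrans (lebesgue_measure_itv_le _ _ (sub_le t n)) _; congr (_%:E); ring.
apply: (@le_trans _ _ (\int[leb]_(s in `[t - n.+1%:R^-1, t]) K)); last first.
  by rewrite Rintegral_cst// (_ : fine _ = n.+1%:R^-1) 1?mulrC//; exact: (f_equal fine m).
apply: le_Rintegral => //; first exact: continuous_integrable_itv.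
by apply: (@continuous_integrable_itv _ (fun=> K)) => ?; exact: cvg_cst.
Qed.

(** The averages of [f] are difference quotients of [prim f], so their integral is a difference of
    averages of [prim f]. These lie between 0 and the total integral of [f]. *)
Lemma Rintegral_avg_le f a b n : leb.-integrable setT (EFin \o f) ->
  (forall s, 0 <= f s) -> a <= b ->
  \int[leb]_(t in `[a, b]) avg f n t <= \int[leb]_t f t.
Proof.
move=> fi f0 ab; have cp := prim_continuous fi.
have [P dP] := antiderivative_continuous cp.
under eq_Rintegral do rewrite avg_prim//.
rewrite (Rintegral_quotient _ cp dP ab).
apply: (@le_trans _ _ (avg (prim f) n b)).
  by rewrite gerBl avg_ge0// => s; exact: prim_ge0.
by apply: avg_le_cst => // s; exact: prim_le_int.
Qed.

Lemma continuous_bounded_itv f a b : continuous f ->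
  exists2 M, 0 <= M & forall t, a <= t <= b -> `|f t| <= M.
Proof.
move=> cf; have [M [_ hM]] := compact_bounded
  (continuous_compact (continuous_subspaceT cf) (@segment_compact R a b)).
exists (`|M| + 1) => // t tab.
by apply: (hM (`|M| + 1)); [rewrite ltr_pwDr// ler_norm|exists t => //=; rewrite in_itv].
Qed.

(** Each average is a difference quotient of an antiderivative, hence converges pointwise to [g].
    All windows stay in [a - 1, b] as the step is at most 1, and a bound of [g] there dominates. *)
Lemma avg_cvg_continuous g (A : set (measurableTypeR R)) a b : continuous g -> measurable A -> A `<=` `[a, b] ->
  (\int[leb]_(t in A) avg g n t) @[n --> \oo] --> \int[leb]_(t in A) g t.
Proof.
move=> cg mA Aab; have [F dF] := antiderivative_continuous cg.
have [M M0 hM] := continuous_bounded_itv (a - 1) b cg.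
apply: (@Rintegral_dominated_cvg _ _ _ _ _ _ (fun=> M)) => //.
- by move=> n; apply: measurable_funTS; apply: continuous_measurable_fun; exact: avg_continuous.
- move=> t At; under eq_fun do rewrite (avg_antiderivative _ _ cg dF).
  exact: derive_shifted_quotient.
- have iM : leb.-integrable `[a, b] (EFin \o (fun=> M)).
    by apply: (@continuous_integrable_itv _ (fun=> M)) => ?; exact: cvg_cst.
  exact: integrableS iM.
- move=> n t /Aab; rewrite /= in_itv /= => /andP[at_ tb].
  rewrite /avg normrM ger0_norm// -ler_pdivlMl// mulrC.
  apply: ler_norm_Rintegral_cst => //.
  + exact: continuous_integrable_itvoc.
  + exact: lebesgue_itvoc.
  + move=> s /=; rewrite in_itv /= => /andP[ts st]; apply: hM.
    rewrite (le_trans st tb) andbT.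
    exact: (near_le at_ ts).
Qed.

(** Approximate [psi] in L^1 by a continuous function. The error and its averages are both
    controlled by the L^1 norm of the error, the latter through [Rintegral_avg_le]; a third of [e]
    goes to each contribution. *)
Lemma avg_cvg psi (A : set (measurableTypeR R)) a b : leb.-integrable setT (EFin \o psi) -> a <= b ->
  measurable A -> A `<=` `[a, b] ->
  (\int[leb]_(t in A) avg psi n t) @[n --> \oo] --> \int[leb]_(t in A) psi t.
Proof.
move=> ip ab mA Aab.
pose D : set (measurableTypeR R) := `[a - 1, b]%classic.
have mD : measurable D by exact: measurable_itv.
have Dfin : (leb D < +oo)%E.
  by rewrite lebesgue_measure_itv; case: ifP => _; rewrite ?ltry// -EFinD ltry.
have AD : A `<=` D.
  by move=> t /Aab; rewrite /D /= !in_itv /= => /andP[at_ ->]; rewrite andbT lerBlDr ler_wpDr.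
have ipD : leb.-integrable D (EFin \o psi) by exact: integrableS ip.
have [g [cg _ glim]] := approximation_continuous_integrable mD Dfin ipD.
apply/cvgrPdist_le => /= e e0.
have e3 : 0 < e / 3 by rewrite divr_gt0.
have [m gm] : exists m, (\int[leb]_(z in D) `|(psi z - g m z)%:E| <= (e / 3)%:E)%E.
  move/fine_cvgP: glim => [[N1 _ fN] /cvgrPdist_le/(_ _ e3)[N2 _ h]].
  exists (N1 + N2)%N; rewrite -[leLHS]fineK ?fN//= ?leq_addr// lee_fin.
  have := h (N1 + N2)%N (leq_addl _ _); rewrite /= sub0r normrN.
  exact: (le_trans (ler_norm _)).
(* The error is cut off to [a - 1, b], which contains every window ending in [a, b]; it becomes
   integrable on the whole line and the splitting of the averages over [a, b] is unaffected. *)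
pose Delta : R -> R := (fun t => psi t - g m t) \_ D.
have iD : leb.-integrable setT (EFin \o Delta).
  rewrite -restrict_EFin -integrable_mkcond//.
  have igD : leb.-integrable D (EFin \o g m) by exact: continuous_integrable_itv.
  exact: (integrableB_EFin mD ipD igD).
have inD : leb.-integrable setT (EFin \o (fun t => `|Delta t|)) by exact: integrable_norm.
have De : \int[leb]_t `|Delta t| <= e / 3.
  rewrite -lee_fin fineK; last exact: integrable_fin_num.
  apply: le_trans gm; rewrite [leRHS]integral_mkcond.
  rewrite le_eqVlt; apply/orP; left; apply/eqP/eq_integral => t _.
  by rewrite /Delta !patchE; case: ifP => // _; rewrite normr0.
have avgE n t : `[a, b]%classic t -> avg psi n t = avg Delta n t + avg (g m) n t.
  rewrite /= in_itv /= => /andP[at_ tb].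
  have s : `]t - n.+1%:R^-1, t] `<=` D.
    move=> s; rewrite /D /= !in_itv /= => /andP[ts st]; rewrite (le_trans st tb) andbT.
    exact: (near_le at_ ts).
  rewrite /avg -mulrDr -RintegralD//.
  - congr (_ * _); apply: eq_Rintegral => y; rewrite inE => ty.
    by rewrite /Delta patchE mem_set ?subrK//; exact: s.
  - exact: integrableS iD.
  - exact: continuous_integrable_itvoc.
have cIA f : continuous f -> leb.-integrable A (EFin \o f).
  by move=> cf; apply: integrableS (continuous_integrable_itv a b cf).
have iA f : leb.-integrable setT (EFin \o f) -> leb.-integrable A (EFin \o f).
  by move=> fi; apply: integrableS fi.
near=> n.
have -> : \int[leb]_(t in A) psi t - \int[leb]_(t in A) avg psi n t =
  \int[leb]_(t in A) Delta t - \int[leb]_(t in A) avg Delta n t +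
  (\int[leb]_(t in A) g m t - \int[leb]_(t in A) avg (g m) n t).
  rewrite (@eq_Rintegral _ _ _ _ A (fun t => avg Delta n t + avg (g m) n t) (avg psi n)); last first.
    by move=> t; rewrite inE => /Aab /avgE.
  rewrite (@eq_Rintegral _ _ _ _ A (fun t => Delta t + g m t) psi); last first.
    by move=> t; rewrite inE => /AD Dt; rewrite /Delta patchE mem_set// subrK.
  rewrite !RintegralD//; first by ring.
  - exact/cIA/avg_integrable_continuous.
  - exact/cIA/avg_continuous.
  - exact: iA.
  - exact: cIA.
have le1 : `|\int[leb]_(t in A) Delta t| <= e / 3.
  apply: le_trans De; apply: le_trans (le_normr_Rintegral mA (iA _ iD)) _.
  exact: le_Rintegral_subset.
have le2 : `|\int[leb]_(t in A) avg Delta n t| <= e / 3.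
  apply: le_trans De; apply: le_trans (Rintegral_avg_le n inD _ ab) => //.
  have cD := avg_integrable_continuous (n := n) iD; have cnD := avg_integrable_continuous (n := n) inD.
  apply: le_trans (le_normr_Rintegral mA (cIA _ cD)) _.
  have cI := continuous_integrable_itv a b cnD.
  apply: le_trans (le_Rintegral_subset _ mA Aab cI _) => //; last first.
    by move=> t _; exact: avg_ge0.
  apply: le_Rintegral => //; first by apply: integrable_norm; exact: cIA.
    exact: cIA.
  move=> t _; rewrite /avg normrM ger0_norm// ler_wpM2l//.
  by apply: le_normr_Rintegral => //; exact: integrableS iD.
have le3 : `|\int[leb]_(t in A) g m t - \int[leb]_(t in A) avg (g m) n t| <= e / 3.
  by near: n; have /cvgrPdist_le := avg_cvg_continuous (cg m) mA Aab; apply.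
apply: le_trans (ler_normD _ _) _; apply: le_trans (lerD (ler_normB _ _) le3) _.
by move: le1 le2; lra.
Unshelve. all: by end_near. Qed.

End averages.

(** * Increments of a function as integrals of its distributional derivative *)

Section weak_derivative.
Context (R : realType).
Local Notation leb := (@lebesgue_measure R).
Implicit Types (phi psi : R -> R) (a b c T : R).

(** The derivative of a smooth step rescaled to rise on [c, c + 1/(n+1)]: its integral over that
    interval is 1, and it approximates the Dirac mass at [c]. *)
Let bump n c (t : R) : R := n.+1%:R * 'D_1 (@smooth_step R) (n.+1%:R * (t - c)).

Let is_derive_step n c t : is_derive t (1 : R)
  (fun s => smooth_step (n.+1%:R * (s - c))) (bump n c t).
Proof.
have d0 : is_derive t (1 : R) (fun s => s - c) 1.
  by have := is_deriveB (is_derive_id t (1 : R)) (is_derive_cst c t (1 : R)); rewrite subr0.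
have d1 : is_derive t (1 : R) (fun s => n.+1%:R * (s - c)) n.+1%:R.
  by have := is_deriveZ n.+1%:R d0; rewrite /GRing.scale /= mulr1.
have := @is_derive1_comp _ (@smooth_step R) (fun s => n.+1%:R * (s - c)) t _ _
  (is_derive_smooth_step _) d1.
by rewrite /bump mulrC.
Qed.

Let bump_continuous n c : continuous (bump n c).
Proof.
move=> t; apply: cvgM; first exact: cvg_cst.
apply: (@continuous_comp _ _ _ (fun s : R => n.+1%:R * (s - c)) ('D_1 (@smooth_step R))); last exact: derive_smooth_step_continuous.
by apply: cvgM; [exact: cvg_cst|apply: cvgB; [exact: cvg_id|exact: cvg_cst]].
Qed.

Let smooth_step_affine n c : smooth (fun t => smooth_step (n.+1%:R * (t - c))).
Proof.
have E : (fun t : R => smooth_step (n.+1%:R * (t - c))) =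
    @smooth_step R \o (fun t => n.+1%:R * t + (- (n.+1%:R * c))).
  by apply/funext => t /=; rewrite mulrBr.
move=> k; rewrite E; exact/Ck_smooth_step/Ck_affine.
Qed.

Let bump_lt n c t : t < c -> bump n c t = 0.
Proof.
move=> tc; rewrite /bump derive_smooth_step_lt0 ?mulr0//.
by rewrite pmulr_rlt0// subr_lt0.
Qed.

Let bump_gt n c t : c + n.+1%:R^-1 < t -> bump n c t = 0.
Proof.
move=> tc; rewrite /bump derive_smooth_step_gt1 ?mulr0//.
by rewrite -ltr_pdivrMl// mulr1 ltrBrDl.
Qed.

Let step_diff_le (x y : R) : 0 <= x <= 1 -> 0 <= y <= 1 -> `|-1 * x + y| <= 1.
Proof. by move=> /andP[? ?] /andP[? ?]; rewrite ler_norml; apply/andP; split; lra. Qed.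

Lemma near_invSn (e : R) : 0 < e -> \forall n \near \oo, n.+1%:R^-1 < e.
Proof.
move=> e0; have /cvgrPdist_lt/(_ e e0) := @cvg_harmonic R.
apply: filterS => n; rewrite sub0r normrN; exact/le_lt_trans/ler_norm.
Qed.

Lemma bump_cvg phi T c : continuous phi -> 0 < c < T ->
  (\int[leb]_(t in `]0, T[) (bump n c t * phi t)) @[n --> \oo] --> phi c.
Proof.
move=> cphi /andP[c0 cT]; have [C C0 hC] := derive_smooth_step_bounded R.
apply/cvgrPdist_le => /= e e0.
(* The sign of the bump is not known, only that its absolute value is at most (n+1) C on an interval
   of length 1/(n+1). Its absolute mass is thus at most C, and the oscillation allowed to [phi] is e
   / C. *)
have [d /= d0 hd] : \forall t \near c, `|phi c - phi t| <= e / C.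
  by have /cvgrPdist_le := cphi c; apply; rewrite divr_gt0.
near=> n; have nd : n.+1%:R^-1 < d by near: n; exact: near_invSn.
have nT : n.+1%:R^-1 < T - c by near: n; apply: near_invSn; rewrite subr_gt0.
have cB : continuous (fun t => bump n c t * (phi t - phi c)).
  by move=> t; apply: cvgM; [exact: bump_continuous|apply: cvgB; [exact: cphi|exact: cvg_cst]].
have cBp : continuous (fun t => bump n c t * phi t).
  by move=> t; apply: cvgM; [exact: bump_continuous|exact: cphi].
have I1 : \int[leb]_(t in `[0, T]) bump n c t = 1.
  have T0 : 0 <= T by exact: ltW (lt_trans c0 cT).
  apply: etrans (Rintegral_is_derive T0 (@bump_continuous n c) (is_derive_step n c)) _.
  rewrite smooth_step_ge1; last by rewrite -ler_pdivrMl// mulr1 ltW.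
  by rewrite smooth_step_le0 ?subr0// sub0r mulrN oppr_le0 mulr_ge0// ltW.
rewrite Rintegral_itvoo_cc; last exact: continuous_integrable_itv.
have -> : \int[leb]_(t in `[0, T]) (bump n c t * phi t) =
    \int[leb]_(t in `[0, T]) (bump n c t * (phi t - phi c)) + phi c.
  rewrite -[X in _ + X]mul1r -I1 -RintegralZr//; last exact: continuous_integrable_itv.
  rewrite -RintegralD//; last 2 first.
  - exact: continuous_integrable_itv.
  - apply: continuous_integrable_itv => t.
    by apply: cvgM; [exact: bump_continuous|exact: cvg_cst].
  by apply: eq_Rintegral => t _; ring.
rewrite opprD addrCA subrr addr0 normrN.
have -> : \int[leb]_(t in `[0, T]) (bump n c t * (phi t - phi c)) =
    \int[leb]_(t in `[c, c + n.+1%:R^-1]) (bump n c t * (phi t - phi c)).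
  apply: Rintegral_support => t /=; rewrite !in_itv /=.
    move=> /andP[ct tc]; rewrite (le_trans (ltW c0) ct) (le_trans tc)//.
    by rewrite -lerBrDl ltW.
  move=> _ /negP; rewrite negb_and -!ltNge => /orP[/bump_lt->|/bump_gt->];
  by rewrite mul0r.
have -> : e = n.+1%:R * C * (e / C) * n.+1%:R^-1.
  by rewrite -(mulrA _ C) (mulrCA C) divff ?gt_eqF// mulr1 mulrAC divff ?mul1r// pnatr_eq0.
apply: ler_norm_Rintegral_cst => //; first exact: continuous_integrable_itv.
- have cc : c <= c + n.+1%:R^-1 by rewrite lerDl.
  by apply: etrans (lebesgue_measure_itv_le _ _ cc) _; congr (_%:E); ring.
- move=> t /=; rewrite in_itv /= => /andP[ct tc].
  rewrite normrM /bump normrM ger0_norm//.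
  apply: ler_pM => //; first by rewrite ler_wpM2l.
  rewrite distrC; apply: hd; rewrite /ball_/= distrC ger0_norm ?subr_ge0//.
  by rewrite ltrBlDl (le_lt_trans tc)// ltrD2l.
Unshelve. all: by end_near. Qed.

(** Test with a smooth step up just after [a] minus one just after [b]. Its derivative is a
    difference of bumps, which picks out [phi a] and [phi b]; the function itself tends pointwise to
    the indicator of ]a, b] and is bounded by 1. *)
Lemma weak_derivative_increment phi psi T a b :
  continuous phi -> leb.-integrable setT (EFin \o psi) ->
  (forall eta : R -> R, test_fun (`]0, T[ : set R) eta ->
    \int[leb]_(t in `]0, T[) (derive1 eta t * phi t) =
    - \int[leb]_(t in `]0, T[) (eta t * psi t)) ->
  0 < a -> a < b -> b < T ->
  phi b - phi a = \int[leb]_(t in `]a, b]) psi t.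
Proof.
move=> cphi ipsi weak a0 ab bT.
have b0 := lt_trans a0 ab; have aT := lt_trans ab bT.
pose eta n (t : R) : R := (-1) * smooth_step (n.+1%:R * (t - b)) + smooth_step (n.+1%:R * (t - a)).
have deta n t : derive1 (eta n) t = bump n a t - bump n b t.
  rewrite derive1E /eta.
  have d := is_deriveD (is_deriveZ (-1) (is_derive_step n b t)) (is_derive_step n a t).
  rewrite (@derive_val _ _ _ _ _ _ _ d).
  by rewrite /GRing.scale /= mulN1r addrC.
have L : (\int[leb]_(t in `]0, T[) (derive1 (eta n) t * phi t)) @[n --> \oo] --> phi a - phi b.
  rewrite (_ : (fun n => _) = (fun n => \int[leb]_(t in `]0, T[) (bump n a t * phi t) -
      \int[leb]_(t in `]0, T[) (bump n b t * phi t))).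
    by apply: cvgB; apply: bump_cvg => //; rewrite ?a0 ?b0.
  apply/funext => n.
  have ci c : leb.-integrable `]0, T[ (EFin \o (fun t => bump n c t * phi t)).
    apply: continuous_integrable_itvoo => t.
    by apply: cvgM; [exact: bump_continuous|exact: cphi].
  rewrite -RintegralB//; apply: eq_Rintegral => t _.
  by rewrite deta mulrBl.
have M : (- \int[leb]_(t in `]0, T[) (eta n t * psi t)) @[n --> \oo] --> phi a - phi b.
  apply: cvg_trans L; apply: near_eq_cvg; near=> n; apply: weak.
  (* The support of [eta n] lies in [a, b + 1/(n+1)], which is inside ]0, T[ only for large [n];
     hence the identity holds eventually. *)
  have nb : n.+1%:R^-1 < T - b by near: n; apply: near_invSn; rewrite subr_gt0.
  split; first by move=> k; apply: Ck_lin; exact: smooth_step_affine.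
  exists `[a, b + n.+1%:R^-1]%classic; split; first exact: segment_compact.
    move=> t /=; rewrite !in_itv /= => /andP[at_ tb].
    rewrite (lt_le_trans a0 at_) (le_lt_trans tb)//; by rewrite -ltrBrDl.
  move=> t /=; rewrite in_itv /= => /negP; rewrite negb_and -!ltNge => /orP[ta|bt].
    rewrite /eta !smooth_step_le0 ?mulr0 ?addr0// pmulr_rle0// subr_le0 ltW//.
    exact: lt_trans ab.
  have bt' : 1 <= n.+1%:R * (t - b) by rewrite -ler_pdivrMl// mulr1 lerBrDl ltW.
  rewrite /eta !smooth_step_ge1 ?mulr1 ?addNr//.
  by apply: le_trans bt' _; rewrite ler_wpM2l// lerB// ltW.
have N : (\int[leb]_(t in `]0, T[) (eta n t * psi t)) @[n --> \oo] -->
    \int[leb]_(t in `]0, T[) ((psi \_ `]a, b]) t).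
  have ip' : leb.-integrable `]0, T[ (EFin \o psi) by exact: integrableS ipsi.
  apply: (@Rintegral_dominated_cvg R _ (measurableTypeR R) leb `]0, T[%classic (fun n t => eta n t * psi t) (psi \_ `]a, b]) (fun t => `|psi t|)).
  - by [].
  - move=> n; apply: measurable_funM.
      apply: measurable_funTS; apply: continuous_measurable_fun.
      by apply: (@Ck_continuous _ _ 0); apply: Ck_lin; exact: smooth_step_affine.
    by apply/measurable_EFinP; exact: measurable_int ip'.
  - move=> t _; rewrite patchE.
    have [ta|at_] := leP t a.
      rewrite memNset; last by rewrite /= in_itv /= ltNge ta.
      apply: cvg_near_cst; near=> n.
      rewrite /eta !smooth_step_le0 ?mulr0 ?addr0 ?mul0r// pmulr_rle0// subr_le0//.
      exact: le_trans (ltW ab).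
    have [tb|bt] := leP t b.
      rewrite mem_set; last by rewrite /= in_itv /= at_ tb.
      apply: cvg_near_cst; near=> n.
      rewrite /eta (@smooth_step_le0 _ (_ * (t - b))); last by rewrite pmulr_rle0// subr_le0.
      rewrite mulr0 add0r smooth_step_ge1 ?mul1r// -ler_pdivrMl// mulr1.
      by apply: ltW; near: n; apply: near_invSn; rewrite subr_gt0.
    rewrite memNset; last by rewrite /= in_itv /= at_ leNgt bt.
    apply: cvg_near_cst; near=> n.
    have nb : n.+1%:R^-1 < t - b by near: n; apply: near_invSn; rewrite subr_gt0.
    have bt' : 1 <= n.+1%:R * (t - b) by rewrite -ler_pdivrMl// mulr1 ltW.
    rewrite /eta !smooth_step_ge1 ?mulr1 ?addNr ?mul0r//.
    by apply: le_trans bt' _; rewrite ler_wpM2l// lerB// ltW.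
  - exact: integrable_norm.
  - move=> n t _; rewrite normrM -[leRHS]mul1r ler_wpM2r//.
    by apply: step_diff_le; rewrite ?smooth_step_ge0 ?smooth_step_le1.
have := cvg_unique _ M (cvgN N); rewrite -Rintegral_mkcondr => /(_ _ _)/= E.
rewrite (_ : `]a, b] = `]0, T[ `&` `]a, b])%classic; last first.
  rewrite setIidr// => t /=; rewrite !in_itv /= => /andP[at_ tb].
  by rewrite (lt_trans a0 at_) (le_lt_trans tb bT).
by apply: oppr_inj; rewrite -E// opprB.
Unshelve. all: by end_near. Qed.

End weak_derivative.

(** * The energy inequality for abstract curves *)

Lemma Rintegral_indicM d (X : measurableType d) (R : realType)
    (mu : {measure set X -> \bar R}) (D A : set X) (f : X -> R) :
  \int[mu]_(t in D) (\1_A t * f t) = \int[mu]_(t in D `&` A) f t.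
Proof.
rewrite Rintegral_mkcondr; apply: eq_Rintegral => t _.
by rewrite patchE indicE; case: (t \in A); rewrite ?mul1r ?mul0r.
Qed.

Lemma integrable_indicM d (X : measurableType d) (R : realType)
    (mu : {measure set X -> \bar R}) (D A : set X) (f : X -> R) :
  measurable D -> measurable A -> mu.-integrable D (EFin \o f) ->
  mu.-integrable D (EFin \o (fun t => \1_A t * f t)).
Proof.
move=> mD mA fi; apply: le_integrable (fi) => //.
- apply/measurable_EFinP/measurable_funM; first exact: measurable_indic.
  by apply/measurable_EFinP; exact: measurable_int fi.
- move=> t _ /=; rewrite lee_fin indicE; case: (t \in A); rewrite ?mul1r ?mul0r//.
  by rewrite normr0.
Qed.

Section energy.
Context (R : realType) (V : lmodType R).
Local Notation leb := (@lebesgue_measure R).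
(* [S] stands for H^1_0 and [N] for its norm; [B z t], [q t] and [xi t z] stand for (e(t), z),
   ||e(t)||^2 and <e_t(t), z>, and [nu t] for the dual norm of e_t(t). *)
Variables (T : R) (S : set V) (N : V -> R) (B : V -> R -> R) (q : R -> R).
Variables (e : R -> V) (xi : R -> V -> R) (nu : R -> R) (E : set (measurableTypeR R)).

Definition simple_sum m (A : 'I_m -> set (measurableTypeR R)) (v : 'I_m -> V) (t : R) : V :=
  \sum_j \1_(A j) t *: v j.

(** [E] plays the set of times, of full measure in ]0, T[, at which e lies in H^1_0: every
    hypothesis on e is confined to it. In contrast [nu], and [xi] through [xi_le], live on the whole
    line and vanish outside ]0, T[, so that their averages make sense without care at the ends. [qB]
    is the polarisation inequality. *)
Hypothesis mE : measurable E.
Hypothesis ET : E `<=` `]0, T[.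
Hypothesis E_full : leb (`]0, T[ `\` E) = 0%E.
Hypothesis S0 : S 0.
Hypothesis S_lin : forall a w w', S w -> S w' -> S (a *: w + w').
Hypothesis xi_lin : forall t a w w', S w -> S w' ->
  xi t (a *: w + w') = a * xi t w + xi t w'.
Hypothesis q_cont : continuous q.
Hypothesis B_cont : forall z, S z -> continuous (B z).
Hypothesis qB : forall s t, E t -> (q t - q s) / 2 <= B (e t) t - B (e t) s.
Hypothesis weak : forall z, S z -> forall eta : R -> R, test_fun (`]0, T[ : set R) eta ->
  \int[leb]_(t in `]0, T[) (derive1 eta t * B z t) =
  - \int[leb]_(t in `]0, T[) (eta t * xi t z).
Hypothesis N_ge0 : forall z, 0 <= N z.
Hypothesis nu_ge0 : forall t, 0 <= nu t.
Hypothesis nu_supp : forall t, ~ `]0, T[%classic t -> nu t = 0.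
Hypothesis nu_int : leb.-integrable setT (EFin \o (fun t => nu t ^+ 2)).
Hypothesis xi_le : forall t z, S z -> `|xi t z| <= nu t * N z.
Hypothesis xi_meas : forall z, S z -> measurable_fun setT (fun t : measurableTypeR R => xi t z).
Hypothesis eS : forall t, E t -> S (e t).
Hypothesis xie_meas : measurable_fun E (fun t => xi t (e t)).
Hypothesis Ne_int : leb.-integrable E (EFin \o (fun t => N (e t) ^+ 2)).
Hypothesis approx : forall eps : R, 0 < eps ->
  exists m (A : 'I_m -> set (measurableTypeR R)) (v : 'I_m -> V),
  [/\ forall j, measurable (A j), forall j, S (v j),
      leb.-integrable E (EFin \o (fun t => N (e t - simple_sum A v t) ^+ 2)) &
      \int[leb]_(t in E) (N (e t - simple_sum A v t) ^+ 2) <= eps].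

Let xi0 t : xi t 0 = 0.
Proof. by have := xi_lin t 1 S0 S0; rewrite scale1r addr0 mul1r; lra. Qed.

Let S_sum m (c : 'I_m -> R) (v : 'I_m -> V) (P : pred 'I_m) :
  (forall j, S (v j)) -> S (\sum_(j | P j) c j *: v j).
Proof.
move=> Sv; elim/big_rec: _ => // j x _ Sx; exact: S_lin.
Qed.

Let xi_sum t m (c : 'I_m -> R) (v : 'I_m -> V) : (forall j, S (v j)) ->
  xi t (\sum_j c j *: v j) = \sum_j c j * xi t (v j).
Proof.
move=> Sv; have : S (\sum_j c j *: v j) /\ xi t (\sum_j c j *: v j) = \sum_j c j * xi t (v j).
  elim/big_ind2: _ => [|x1 x2 y1 y2 [Sx1 <-] [Sx2 <-]|j _] //.
  - split; first by rewrite -[x2]scale1r; exact: S_lin.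
    by rewrite -[x2 in LHS]scale1r xi_lin// mul1r.
  - split; first by rewrite -[_ *: _]addr0; exact: S_lin.
    by rewrite -[_ *: _]addr0 xi_lin// xi0 addr0.
by case.
Qed.

Let xiB t w w' : S w -> S w' -> xi t (w - w') = xi t w - xi t w'.
Proof.
by move=> Sw Sw'; rewrite addrC -scaleN1r xi_lin// mulN1r addrC.
Qed.

Let young (l x y : R) : 0 < l -> x * y <= l / 2 * x ^+ 2 + y ^+ 2 / (2 * l).
Proof.
move=> l0; rewrite -subr_ge0.
have -> : l / 2 * x ^+ 2 + y ^+ 2 / (2 * l) - x * y = (l * x - y) ^+ 2 / (2 * l).
  by field; rewrite gt_eqF.
by rewrite divr_ge0 ?sqr_ge0// mulr_ge0// ltW.
Qed.

Let xi_int z : S z -> leb.-integrable setT (EFin \o (fun t => xi t z)).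
Proof.
move=> Sz.
have I : leb.-integrable setT (EFin \o (fun t => N z * (nu t ^+ 2 + \1_(`]0, T[%classic) t))).
  apply: integrableZ_EFin => //; apply: integrableD_EFin => //.
  exact: integrable_indic_itv.
apply: le_integrable I => //; first by apply/measurable_EFinP; exact: xi_meas.
move=> t _ /=; rewrite lee_fin (le_trans (xi_le t Sz))// [leRHS]ger0_norm; last first.
  by rewrite mulr_ge0// addr_ge0// ?sqr_ge0.
rewrite mulrC ler_wpM2l// indicE.
have [t0|t0] := pselect (`]0, T[%classic t); last by rewrite nu_supp// expr0n add0r.
rewrite mem_set//=; have := sqr_ge0 (nu t - 1); have := sqr_ge0 (nu t + 1).
by rewrite !expr2; lra.
Qed.

Lemma xie_int : leb.-integrable E (EFin \o (fun t => xi t (e t))).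
Proof.
have I : leb.-integrable E (EFin \o (fun t => nu t ^+ 2 + N (e t) ^+ 2)).
  by apply: integrableD_EFin => //; exact: integrableS nu_int.
apply: le_integrable I => //; first exact/measurable_EFinP.
move=> t Et /=; rewrite lee_fin (le_trans (xi_le t (eS Et)))// [leRHS]ger0_norm; last first.
  by rewrite addr_ge0// ?sqr_ge0.
have := sqr_ge0 (nu t - N (e t)); have := sqr_ge0 (nu t); have := sqr_ge0 (N (e t)).
by rewrite !expr2; lra.
Qed.

(* Average the difference quotients of [q] over [a, b].  By [qB] and [weak] they are bounded by
   averages of [xi r (e t)] over [r] in ]t - h, t].  Replacing there [e t] by a simple curve [s t]
   costs at most [l * (Th + 1)] by Young's inequality, and for [s] one can let [h] tend to [0]. *)
Lemma energy_local a b : 0 < a -> a < b -> b < T ->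
  (q b - q a) / 2 <= \int[leb]_(t in E `&` `[a, b]) xi t (e t).
Proof.
move=> a0 ab bT; set F := E `&` `[a, b].
have mF : measurable F by exact: measurableI.
have FE : F `<=` E by exact: subIsetl.
have Fab : F `<=` `[a, b] by exact: subIsetr.
pose Th := \int[leb]_t (nu t ^+ 2).
have Th0 : 0 <= Th by apply: Rintegral_ge0 => t _; exact: sqr_ge0.
suff key l : 0 < l -> (q b - q a) / 2 <= \int[leb]_(t in F) xi t (e t) + l * (Th + 1).
  apply/ler_addgt0Pr => d d0; have d1 : 0 < d / (Th + 1) by rewrite divr_gt0// ltr_wpDl.
  by apply: le_trans (key _ d1) _; rewrite divfK// gt_eqF// ltr_wpDl.
move=> l0.
(* Young's inequality below carries the factor 1/(2 l) on the squared distance to the simple curve;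
   accuracy l^2 turns this term into l / 2. *)
have [m [A [v [mA Sv Xi Xe]]]] := approx (ltac:(by rewrite exprn_gt0) : 0 < l ^+ 2).
set s := simple_sum A v in Xi Xe.
have Ss t : S (s t) by exact: S_sum.
pose X t := N (e t - s t).
have xis r t : \sum_j (\1_(A j) t * xi r (v j)) = xi r (s t) by rewrite -xi_sum.
have XF : leb.-integrable F (EFin \o (fun t => X t ^+ 2)) by exact: integrableS Xi.
have XFle : \int[leb]_(t in F) (X t ^+ 2) <= l ^+ 2.
  by apply: le_trans Xe; apply: le_Rintegral_subset => // t _; exact: sqr_ge0.
have nuF : leb.-integrable F (EFin \o (fun t => nu t ^+ 2)) by exact: integrableS nu_int.
have nuFle : \int[leb]_(t in F) (nu t ^+ 2) <= Th.
  by apply: le_Rintegral_subset => // t _; exact: sqr_ge0.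
have psiF j : leb.-integrable F (EFin \o (fun t => \1_(A j) t * xi t (v j))).
  by apply: integrable_indicM => //; apply: integrableS (xi_int (Sv j)).
have xieF : leb.-integrable F (EFin \o (fun t => xi t (e t))) by exact: integrableS xie_int.
have half2 : l ^+ 2 / (2 * l) = l / 2 by field; rewrite gt_eqF.
have l2 : 0 < 2 * l by rewrite mulr_gt0.
(* After the limit, the simple curve is replaced by [e] again; this uses one half of the error l (Th
   + 1). *)
have final : \sum_j \int[leb]_(t in F) (\1_(A j) t * xi t (v j)) <=
    \int[leb]_(t in F) xi t (e t) + (l / 2 * Th + l / 2).
  rewrite -Rintegral_sum//.
  apply: (@le_trans _ _ (\int[leb]_(t in F) (xi t (e t) +
     (l / 2 * nu t ^+ 2 + (2 * l)^-1 * X t ^+ 2)))).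
    apply: le_Rintegral => //; first exact: integrable_sum_EFin.
      apply: integrableD_EFin => //; apply: integrableD_EFin => //;
      exact: integrableZ_EFin.
    move=> t /FE Et; rewrite xis -lerBlDl -xiB//; last exact: eS.
    rewrite -opprB.
    have Sd : S (e t - s t) by rewrite addrC -scaleN1r; apply: S_lin => //; exact: eS.
    have -> : xi t (- (e t - s t)) = - xi t (e t - s t).
      by rewrite -[- _]addr0 -scaleN1r xi_lin// xi0 addr0 mulN1r.
    apply: le_trans (ler_norm _) _; rewrite normrN (le_trans (xi_le _ Sd))//.
    by rewrite [X in _ <= _ + X]mulrC; exact: young.
  rewrite RintegralD//; last first.
    by apply: integrableD_EFin => //; exact: integrableZ_EFin.
  rewrite lerD2l RintegralD//; [|exact: integrableZ_EFin..].
  rewrite !RintegralZl//; apply: lerD; first by rewrite ler_wpM2l// divr_ge0// ltW.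
  by rewrite -half2 mulrC ler_wpM2r// invr_ge0 ltW.
have Eq : (avg q n b - avg q n a) / 2 @[n --> \oo] --> (q b - q a) / 2.
  have [P dP] := antiderivative_continuous q_cont.
  apply: cvgM; last exact: cvg_cst.
  by apply: cvgB; under eq_fun do rewrite (avg_antiderivative _ _ q_cont dP);
    exact: derive_shifted_quotient.
have Epsi : (\sum_j \int[leb]_(t in F) (\1_(A j) t * avg (xi^~ (v j)) n t) + (l / 2 * Th + l / 2)) @[n --> \oo] -->
   \sum_j \int[leb]_(t in F) (\1_(A j) t * xi t (v j)) + (l / 2 * Th + l / 2).
  apply: cvgD; last exact: cvg_cst.
  apply: cvg_big => [|j _]; first exact: add_continuous.
  rewrite Rintegral_indicM; under eq_fun do rewrite Rintegral_indicM.
  apply: (avg_cvg (a := a) (b := b)) => //.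
  - exact: xi_int.
  - exact: ltW.
  - exact: measurableI.
  - by move=> t [/Fab].
(* The other half of the error pays for replacing [e] by the simple curve before the limit. *)
suff le_n : \forall n \near \oo, (avg q n b - avg q n a) / 2 <=
    \sum_j \int[leb]_(t in F) (\1_(A j) t * avg (xi^~ (v j)) n t) + (l / 2 * Th + l / 2).
  apply: le_trans (ler_cvg_to Eq Epsi le_n) _.
  apply: le_trans (lerD final (lexx _)) _.
  by rewrite -addrA lerD2l; lra.
near=> n.
(* This keeps t - h positive for all t in [a, b], as [weak_derivative_increment] requires. *)
have na : n.+1%:R^-1 < a by near: n; exact: near_invSn.
have [P dP] := antiderivative_continuous q_cont.
rewrite -(Rintegral_quotient n q_cont dP (ltW ab)).
set h := n.+1%:R^-1 in na *.
have qc : continuous (fun t => n.+1%:R * (q t - q (t - h))).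
  move=> t; apply: cvgM; first exact: cvg_cst.
  apply: cvgB; first exact: q_cont.
  apply: (@continuous_comp _ _ _ (fun t => t - h) q); last exact: q_cont.
  by apply: cvgB; [exact: cvg_id|exact: cvg_cst].
have abF : (`[a, b] `\` (`]0, T[ `\` E) = F :> set R)%classic.
  apply/seteqP; split => t.
    move=> [tab /not_andP[h1|/contrapT Et]]; last by [].
    by exfalso; apply: h1; move: tab; rewrite /= !in_itv /= => /andP[at_ tb];
      rewrite (lt_le_trans a0 at_) (le_lt_trans tb bT).
  by move=> [Et tab]; split => // -[].
rewrite (Rintegral_setD_null _ _ _ E_full)//; last exact: measurableD.
rewrite abF mulrC -RintegralZl//; last first.
  exact: integrableS (continuous_integrable_itv a b qc).
have cavg j : continuous (avg (xi^~ (v j)) n) by apply: avg_integrable_continuous; exact: xi_int.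
have cavgnu : continuous (avg (fun t => nu t ^+ 2) n) by exact: avg_integrable_continuous.
have iavg j : leb.-integrable F (EFin \o (fun t => \1_(A j) t * avg (xi^~ (v j)) n t)).
  apply: integrable_indicM => //.
  exact: integrableS (continuous_integrable_itv a b (cavg j)).
have iavgnu : leb.-integrable F (EFin \o avg (fun t => nu t ^+ 2) n).
  exact: integrableS (continuous_integrable_itv a b cavgnu).
apply: (@le_trans _ _ (\int[leb]_(t in F) (\sum_j (\1_(A j) t * avg (xi^~ (v j)) n t) +
    (l / 2 * avg (fun t => nu t ^+ 2) n t + (2 * l)^-1 * X t ^+ 2)))); last first.
  rewrite RintegralD//; last 2 first.
  - exact: integrable_sum_EFin.
  - by apply: integrableD_EFin => //; exact: integrableZ_EFin.
  rewrite Rintegral_sum// lerD2l RintegralD//; [|exact: integrableZ_EFin..].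
  rewrite (RintegralZl _ mF iavgnu) (RintegralZl _ mF XF); apply: lerD.
    apply: ler_wpM2l; first by rewrite divr_ge0// ltW.
    have := @Rintegral_avg_le _ (fun t => nu t ^+ 2) a b n nu_int
      (fun s => sqr_ge0 _) (ltW ab).
    apply: le_trans; apply: le_Rintegral_subset => //.
      exact: continuous_integrable_itv.
    by move=> t _; apply: avg_ge0 => ?; exact: sqr_ge0.
  by rewrite -half2 mulrC ler_wpM2r// invr_ge0 ltW.
apply: le_Rintegral => //.
- apply: integrableZ_EFin => //.
  exact: integrableS (continuous_integrable_itv a b qc).
- apply: integrableD_EFin => //; first exact: integrable_sum_EFin.
  by apply: integrableD_EFin => //; exact: integrableZ_EFin.
move=> t [Et tab]; have Se := eS Et.
have /andP[at_ tb] : a <= t <= b by move: tab; rewrite /= in_itv.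
have h0 : 0 < h by rewrite invr_gt0.
have Sd : S (e t - s t) by rewrite addrC -scaleN1r; exact: S_lin.
(* For fixed [t] the element [e t] is a constant test element, so the weak formulation applies
   although e has no regularity in time here. *)
have E1 : B (e t) t - B (e t) (t - h) = \int[leb]_(r in `]t - h, t]) xi r (e t).
  apply: (weak_derivative_increment (T := T) (B_cont Se) (xi_int Se)); first exact: weak.
  - by rewrite subr_gt0 (lt_le_trans na at_).
  - by rewrite gtrBl.
  - exact: le_lt_trans bT.
have iS z : S z -> leb.-integrable `]t - h, t] (EFin \o (fun r => xi r z)).
  by move=> Sz; exact: integrableS (xi_int Sz).
have inu : leb.-integrable `]t - h, t] (EFin \o (fun r => nu r ^+ 2)) by exact: integrableS nu_int.
have icst k : leb.-integrable `]t - h, t] (EFin \o (fun=> k)).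
  by apply: continuous_integrable_itvoc => ?; exact: cvg_cst.
(* Young's inequality is applied under the integral over [r], where the distance [X t] is constant
   and only [nu r] varies. Multiplication by n + 1 then turns the integrals into averages and
   cancels the factor [h]. *)
have E2 : \int[leb]_(r in `]t - h, t]) xi r (e t) <=
    \sum_j (\1_(A j) t * \int[leb]_(r in `]t - h, t]) xi r (v j)) +
    (l / 2 * \int[leb]_(r in `]t - h, t]) (nu r ^+ 2) + (2 * l)^-1 * X t ^+ 2 * h).
  have -> : (2 * l)^-1 * X t ^+ 2 * h = \int[leb]_(r in `]t - h, t]) ((2 * l)^-1 * X t ^+ 2).
    rewrite Rintegral_cst//; congr (_ * _).
    have th : t - h <= t by rewrite gerBl ltW.
    by apply: esym; apply: etrans (f_equal fine (lebesgue_measure_itv_le _ _ th)) _ => /=; ring.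
  under eq_bigr do rewrite -RintegralZl ?(iS _ (Sv _))//.
  rewrite -Rintegral_sum//; last by move=> j; apply: integrableZ_EFin => //; exact: iS.
  rewrite -RintegralZl// -RintegralD//; last exact: integrableZ_EFin.
  rewrite -RintegralD//; last 2 first.
  - by apply: integrable_sum_EFin => // j; apply: integrableZ_EFin => //; exact: iS.
  - by apply: integrableD_EFin => //; exact: integrableZ_EFin.
  apply: le_Rintegral => //; first exact: iS.
    apply: integrableD_EFin => //.
      by apply: integrable_sum_EFin => // j; apply: integrableZ_EFin => //; exact: iS.
    by apply: integrableD_EFin => //; exact: integrableZ_EFin.
  move=> r _; rewrite xis -lerBlDl -xiB//.
  apply: le_trans (ler_norm _) _; rewrite (le_trans (xi_le _ Sd))//.
  by rewrite [X in _ <= _ + X]mulrC; exact: young.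
apply: (@le_trans _ _ (n.+1%:R * \int[leb]_(r in `]t - h, t]) xi r (e t))).
  rewrite -E1 mulrCA; apply: ler_wpM2l => //.
  by rewrite mulrC; exact: qB.
apply: le_trans (ler_wpM2l _ E2) _ => //.
rewrite le_eqVlt; apply/orP; left; apply/eqP.
rewrite !mulrDr mulr_sumr /avg -/h; congr (_ + (_ + _)).
- by apply: eq_bigr => j _; ring.
- by ring.
- by rewrite mulrCA divff ?mulr1// pnatr_eq0.
Unshelve. all: by end_near. Qed.

(** Test functions are supported inside ]0, T[, so [energy_local] cannot reach the endpoints. They
    are reached by continuity of [q] on the left and dominated convergence on the right. *)
Lemma energy_inequality : 0 < T ->
  (q T - q 0) / 2 <= \int[leb]_(t in E) xi t (e t).
Proof.
move=> T0.
(* The offset 3 gives 2 / (n + 3) < 1, that is a n < b n, already for n = 0. *)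
pose a n := T * n.+3%:R^-1; pose b n := T - a n.
have a0 n : 0 < a n by rewrite mulr_gt0.
have an : a n @[n --> \oo] --> 0.
  rewrite -(mulr0 T); apply: cvgM; first exact: cvg_cst.
  have := @cvg_harmonic R; rewrite -(cvg_shiftn 2); apply: cvg_trans.
  by apply: near_eq_cvg; near=> n; rewrite /harmonic /= addn2.
have bn : b n @[n --> \oo] --> T.
  by rewrite -[X in _ --> X]subr0; apply: cvgB => //; exact: cvg_cst.
have ab n : a n < b n.
  have h2 : T * (2 * n.+3%:R^-1) < T.
    by rewrite gtr_pMr// ltr_pdivrMr// mul1r ltr_nat.
  by rewrite /b /a; move: (n.+3%:R^-1) h2 => y; lra.
have bT n : b n < T by rewrite gtrBl.
have L : (q (b n) - q (a n)) / 2 @[n --> \oo] --> (q T - q 0) / 2.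
  apply: cvgM; last exact: cvg_cst.
  by apply: cvgB; apply: continuous_cvg => //; exact: q_cont.
have M : (\int[leb]_(t in E) (\1_(`[a n, b n]%classic) t * xi t (e t))) @[n --> \oo] -->
    \int[leb]_(t in E) xi t (e t).
  have I := xie_int.
  apply: (@Rintegral_dominated_cvg R _ (measurableTypeR R) leb E _ _ (fun t => `|xi t (e t)|)).
  - exact: mE.
  - by move=> n; apply: measurable_funM => //; exact: measurable_indic.
  - move=> t Et; apply: cvg_near_cst.
    have /andP[t0 tT] : 0 < t < T by have := ET Et; rewrite /= in_itv.
    near=> n; rewrite indicE mem_set ?mul1r//= in_itv /=; apply/andP; split.
      by near: n; apply: (cvgr_le _ an).
    by near: n; apply: (cvgr_ge _ bn).
  - exact: integrable_norm.
  - move=> n t _; rewrite indicE; case: (t \in _); rewrite ?mul1r ?mul0r ?normr0//.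
apply: (ler_cvg_to L M); near=> n.
by rewrite Rintegral_indicM; exact: energy_local.
Unshelve. all: by end_near. Qed.

End energy.

(** * Lebesgue measure on row vectors *)

Section row_vectors.
Context (R : realType).
Implicit Types n : nat.

Lemma measurable_coord_preimage n (i : 'I_n) (A : set R) : measurable A ->
  measurable [set x : 'rV[R]_n | A (x ord0 i)].
Proof.
by move=> mA; rewrite -[X in measurable X]setTI; exact: (@measurable_rV_coord R n i).
Qed.

Lemma measurable_box n (A : 'I_n -> set R) : (forall i, measurable (A i)) ->
  measurable [set x : 'rV[R]_n | forall i, A i (x ord0 i)].
Proof.
move=> mA; rewrite (_ : [set x | _] =
    \bigcap_(i in [set: 'I_n]) [set x : 'rV[R]_n | A i (x ord0 i)]).
  by apply: fin_bigcap_measurable => // i _; exact: measurable_coord_preimage.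
by apply/seteqP; split => x /= Ax i => [_|]; exact: Ax.
Qed.

(** This links the topology of the max norm with the product sigma-algebra: an open set is the union
    of the boxes with rational centre and radius 1/(k+1) that it contains, and there are countably
    many of them. *)
Lemma open_rV_measurable n (U : set 'rV[R]_n) : open U -> measurable U.
Proof.
move=> oU.
pose box (p : 'rV[rat]_n * nat) := [set x : 'rV[R]_n |
  forall i, `]ratr (p.1 ord0 i) - p.2.+1%:R^-1, ratr (p.1 ord0 i) + p.2.+1%:R^-1[%classic (x ord0 i)].
pose F p := if `[< box p `<=` U >] then box p else set0.
have -> : U = \bigcup_p F p.
  apply/seteqP; split=> [x Ux|x [p _]]; last by rewrite /F; case: asboolP => // pU /pU.
  have /nbhs_ballP[e /= e0 xe] := oU x Ux.
  (* A rational centre is chosen within h of [x], so the points of the box of radius h are within 2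
     h of [x]; hence the bound e / 2. *)
  have [k k0] : exists k, (k.+1%:R^-1 : R) < e / 2.
    have [k _ hk] := near_invSn (ltac:(by rewrite divr_gt0) : 0 < e / 2).
    by exists k; apply: (hk k) => /=.
  set h := k.+1%:R^-1 in k0; have h0 : 0 < h by rewrite invr_gt0.
  have hx i : {r : rat | x ord0 i - h < ratr r < x ord0 i + h}.
    apply: cid; have [|r] := @rat_in_itvoo R (x ord0 i - h) (x ord0 i + h).
      by rewrite ltrBlDr -addrA ltrDl addr_gt0.
    by rewrite in_itv /= => hr; exists r.
  exists (\row_i sval (hx i), k) => //.
  have xb : box (\row_i sval (hx i), k) x.
    move=> i /=; rewrite mxE in_itv /= -/h; case: (hx i) => r /= /andP[].
    by move: (ratr r) => y ? ?; apply/andP; split; lra.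
  rewrite /F; case: asboolP => // -[]; move=> y /= hy; apply: xe; split => //.
  move=> i j; rewrite (ord1 i) /ball /= ltr_norml.
  have := hy j; have := xb j; rewrite /= !in_itv /= -/h.
  move: (ratr _) => r /andP[? ?] /andP[? ?]; apply/andP; split; lra.
apply: countable_bigcupT_measurable; first exact: countableP.
move=> p; rewrite /F; case: asboolP => // _.
pose I i : set R := `]ratr (p.1 ord0 i) - p.2.+1%:R^-1, ratr (p.1 ord0 i) + p.2.+1%:R^-1[%classic.
by apply: (@measurable_box n I) => i; exact: measurable_itv.
Qed.

Lemma continuous_rV_measurable n (f : 'rV[R]_n -> R) : continuous f ->
  measurable_fun setT f.
Proof.
move=> cf; apply: (measurability (RGenOInfty.G (R := R))).
  exact: RGenOInfty.measurableE.
move=> _ [_ [r ->] <-]; rewrite setTI; apply: open_rV_measurable.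
by apply: open_comp => //= x _; exact: cf.
Qed.

Definition cube n (k : R) : set 'rV[R]_n := [set x | forall i, `[- k, k]%classic (x ord0 i)].

Lemma measurable_cube n k : measurable (@cube n k).
Proof. by apply: (@measurable_box n (fun=> `[- k, k]%classic)) => i; exact: measurable_itv. Qed.

Lemma lebesgue_rV_cube n k : (lebesgue_rV R n (@cube n k) < +oo)%E.
Proof.
elim: n => [|n IH] /=.
  by rewrite /dirac /= indicE; case: (_ \in _); rewrite ltry.
rewrite /product_step /pushforward.
rewrite (_ : _ @^-1` _ = @cube n k `*` `[- k, k]%classic).
  rewrite product_measure1E//; last exact: measurable_cube.
  apply: lte_mul_pinfty => //.
    by rewrite ge0_fin_numE.
  exact: lebesgue_measure_itv_lty.
apply/seteqP; split => -[x r]; rewrite /cube /rV_cons /=.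
  move=> h; split => [i|].
    have := h (rshift 1 i : 'I_(1 + n)); by rewrite (@row_mxEr _ 1 1 n).
  by have := h (lshift n (ord0 : 'I_1) : 'I_(1 + n)); rewrite (@row_mxEl _ 1 1 n) mxE.
move=> [h hr] i; case: (split_ordP (i : 'I_(1 + n))) => j ->.
  by rewrite (@row_mxEl _ 1 1 n) mxE.
by rewrite (@row_mxEr _ 1 1 n).
Qed.

Lemma bounded_sub_cube n (U : set 'rV[R]_n) : bounded_set U ->
  exists k, U `<=` @cube n k.
Proof.
move=> [M [_ hM]]; exists (`|M| + 1) => x Ux i.
have := hM _ (ltac:(by rewrite ltr_pwDr// ler_norm) : M < `|M| + 1) x Ux.
rewrite /= in_itv /= -ler_norml; apply: le_trans.
rewrite [leRHS]mx_normrE.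
by apply: (@le_trans _ _ `|x (ord0, i).1 (ord0, i).2|) => //; apply: le_bigmax.
Qed.

Lemma lebesgue_rV_sigma_finite n : sigma_finite setT (lebesgue_rV R n).
Proof.
exists (fun k : nat => @cube n k%:R) => [|k]; last first.
  by split; [exact: measurable_cube|exact: lebesgue_rV_cube].
apply/esym/seteqP; split => // x _.
have bx : bounded_set [set x].
  by exists `|x|; split; [exact: num_real|move=> y hy _ ->; exact: ltW].
have [k hk] := bounded_sub_cube bx.
exists (Num.truncn `|k|).+1 => // i.
have := hk x erefl i; rewrite /= !in_itv /= -!ler_norml => /le_trans; apply.
rewrite (le_trans (ler_norm k))//; apply: ltW; exact: truncnS_gt.
Qed.

Lemma bounded_lebesgue_rV n (U : set 'rV[R]_n) : measurable U -> bounded_set U ->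
  (lebesgue_rV R n U < +oo)%E.
Proof.
move=> mU /bounded_sub_cube[k Uk]; apply: le_lt_trans (lebesgue_rV_cube n k).
by apply: le_measure => //; rewrite inE//; exact: measurable_cube.
Qed.

Lemma continuous_bounded_set n (U : set 'rV[R]_n) (f : 'rV[R]_n -> R) :
  bounded_set U -> continuous f -> exists M, forall x, U x -> `|f x| <= M.
Proof.
move=> bU cf.
have [M [_ hM]] := bU.
pose K := [set x : 'rV[R]_n | `|x| <= `|M| + 1].
have UK : U `<=` K by move=> x Ux; apply: (hM (`|M| + 1)) => //; rewrite ltr_pwDr// ler_norm.
have cK : compact K.
  apply: bounded_closed_compact.
    exists (`|M| + 1); split; first exact: num_real.
    by move=> y hy x Kx; exact: le_trans Kx (ltW hy).
  rewrite (_ : K = (fun x : 'rV[R]_n => `|x|) @^-1` [set y : R | y <= `|M| + 1])//.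
  by apply: closed_comp => [x _|]; [exact: norm_continuous|exact: closed_le].
have [C [_ hC]] := compact_bounded (continuous_compact (continuous_subspaceT cf) cK).
exists (`|C| + 1) => x Ux; apply: (hC (`|C| + 1)).
  by rewrite ltr_pwDr// ler_norm.
by exists x => //; exact: UK.
Qed.

End row_vectors.

Section sigma_finite_copy.
Context d (T : measurableType d) (R : realType).
Variable m : {measure set T -> \bar R}.

(* Library statements ask for sigma-finiteness as a canonical structure. *)
Definition sigma_finite_copy (m_sf : sigma_finite setT m) : set T -> \bar R := m.

Variable m_sf : sigma_finite setT m.

HB.instance Definition _ := isMeasure.Build _ _ _ (sigma_finite_copy m_sf)
  (measure0 m) (measure_ge0 m) (@measure_semi_sigma_additive _ _ _ m).
HB.instance Definition _ :=
  Measure_isSigmaFinite.Build _ _ _ (sigma_finite_copy m_sf) m_sf.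

End sigma_finite_copy.

Section tonelli.
Context d1 d2 (T1 : measurableType d1) (T2 : measurableType d2) (R : realType).
Variables (m1 : {measure set T1 -> \bar R}) (m2 : {sigma_finite_measure set T2 -> \bar R}).
Hypothesis m1_sf : sigma_finite setT m1.
Variables (D1 : set T1) (D2 : set T2).
Hypotheses (mD1 : measurable D1) (mD2 : measurable D2).
Variable f : T1 * T2 -> \bar R.
Hypothesis mf : measurable_fun (D1 `*` D2) f.
Hypothesis f0 : forall p, (D1 `*` D2) p -> (0 <= f p)%E.

Let m1' : {sigma_finite_measure set T1 -> \bar R} := sigma_finite_copy m1_sf.

Let F := f \_ (D1 `*` D2).

Let mF : measurable_fun setT F.
Proof.
by apply/measurable_restrict => //; [exact: measurableX|rewrite setIidr].
Qed.

Let F0 p : (0 <= F p)%E.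
Proof. by rewrite /F patchE; case: ifPn => //; rewrite inE => /f0. Qed.

Let FE y : (\int[m1']_x F (x, y) = ((fun y => \int[m1]_(x in D1) f (x, y)) \_ D2) y)%E.
Proof.
rewrite patchE; have [y2|y2] := pselect (D2 y).
  rewrite (mem_set y2).
  rewrite [RHS]integral_mkcond; apply: eq_integral => x _; rewrite /F !patchE in_setX.
  by rewrite (mem_set y2) andbT.
rewrite (memNset y2) integral0_eq// => x _; rewrite /F patchE in_setX.
by rewrite (memNset y2) andbF.
Qed.

Lemma tonelli : (\int[m1 \x m2]_(p in D1 `*` D2) f p =
  \int[m2]_(y in D2) \int[m1]_(x in D1) f (x, y))%E.
Proof.
rewrite integral_mkcond [RHS]integral_mkcond.
have := @fubini_tonelli2 _ _ _ _ _ m1' m2 F mF F0 => -> /=.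
by apply: eq_integral => y _; exact: FE.
Qed.

Lemma tonelli_measurable : measurable_fun D2 (fun y => \int[m1]_(x in D1) f (x, y))%E.
Proof.
have := @measurable_fun_fubini_tonelli_G _ _ _ _ _ m1' F mF F0.
rewrite /fubini_G (_ : (fun y => _) = (fun y => \int[m1]_(x in D1) f (x, y))%E \_ D2).
  by move/measurable_restrict => /(_ mD2); rewrite setTI; apply.
by apply/funext => y; exact: FE.
Qed.

End tonelli.

(** * Strongly measurable curves *)

Lemma squeeze_cvgn0 (R : realType) (a b : nat -> R) :
  (\forall k \near \oo, 0 <= a k <= b k) -> b k @[k --> \oo] --> 0 ->
  a k @[k --> \oo] --> 0.
Proof.
move=> ab b0; apply/cvgrPdist_le => /= e e0.
have /cvgrPdist_le/(_ e e0) := b0.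
apply: filterS2 ab => k /andP[a0 le_ab]; rewrite !sub0r !normrN (ger0_norm a0) => h.
by apply: le_trans le_ab (le_trans (ler_norm _) h).
Qed.

Section simple_curves.
Context (R : realType) (V : lmodType R).
Variable S : set V.
Hypothesis S0 : S 0.
Hypothesis S_lin : forall a w w', S w -> S w' -> S (a *: w + w').

Lemma subspace_sum m (c : 'I_m -> R) (v : 'I_m -> V) :
  (forall j, S (v j)) -> S (\sum_j c j *: v j).
Proof. by move=> Sv; elim/big_rec: _ => // j x _ Sx; exact: S_lin. Qed.

Lemma subspaceB w w' : S w -> S w' -> S (w - w').
Proof. by move=> Sw Sw'; rewrite addrC -scaleN1r; exact: S_lin. Qed.

Lemma simple_curve_in s t : simple_curve S s -> S (s t).
Proof. by move=> [m [A [v [_ Sv ->]]]]; exact: subspace_sum. Qed.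

Lemma simple_curveB s s' : simple_curve S s -> simple_curve S s' ->
  simple_curve S (fun t => s t - s' t).
Proof.
move=> [m [A [v [mA Sv ->]]]] [m' [A' [v' [mA' Sv' ->]]]].
exists (m + m')%N, (fun j => match fintype.split j with inl i => A i | inr i => A' i end),
  (fun j => match fintype.split j with inl i => v i | inr i => - v' i end); split.
- by move=> j; case: (fintype.split j).
- move=> j; case: (fintype.split j) => // i; rewrite -[- _]addr0 -scaleN1r; exact: S_lin.
- apply/funext => t; rewrite big_split_ord /= -sumrN; congr (_ + _).
    by apply: eq_bigr => i _; rewrite (unsplitK (inl i)).
  by apply: eq_bigr => i _; rewrite (unsplitK (inr i)) scalerN.
Qed.

(** No structure on [V] and no property of [F] is involved: a simple curve takes finitely many
    values, so a preimage is a finite union of cells cut out by the sets [A j]. *)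
Lemma simple_curve_measurable (F : V -> R) s : simple_curve S s ->
  measurable_fun setT (fun t : measurableTypeR R => F (s t)).
Proof.
move=> [m [A [v [mA Sv ->]]]] _ Y mY; rewrite setTI.
(* The sets [A j] may overlap, so cells are indexed by the pattern of memberships; on each cell the
   curve is constant. *)
pose P (c : {ffun 'I_m -> bool}) : set (measurableTypeR R) :=
  \bigcap_(j in [set: 'I_m]) (if c j then A j else ~` A j).
pose C := [set c : {ffun 'I_m -> bool} | Y (F (\sum_j (c j)%:R *: v j))].
rewrite (_ : _ @^-1` _ = \bigcup_(c in C) P c).
  apply: fin_bigcup_measurable => [|c _]; first exact: finite_finset.
  apply: fin_bigcap_measurable => // j _.
  by case: (c j) => //; exact: measurableC.
apply/seteqP; split => [t /= Yt|t [c Cc Pc] /=].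
  exists [ffun j => t \in A j].
    rewrite /C /=; move: Yt; congr (Y (F _)).
    by apply: eq_bigr => j _; rewrite ffunE indicE.
  by move=> j _; rewrite ffunE; case: ifPn; rewrite ?notin_setE ?inE.
move: Cc; rewrite /C /=; congr (Y (F _)); apply: eq_bigr => j _; rewrite indicE.
by have := Pc j I; case: (c j) => [Aj|Aj]; [rewrite mem_set|rewrite memNset].
Qed.

End simple_curves.

(** * Pointwise limits of simple curves in a seminorm *)

Section seminorm_limits.
Context (R : realType) (V : lmodType R).
Local Notation leb := (@lebesgue_measure R).
Variables (S : set V) (N : V -> R).
Hypothesis S0 : S 0.
Hypothesis S_lin : forall a w w', S w -> S w' -> S (a *: w + w').
Hypothesis N_ge0 : forall v, 0 <= N v.
Hypothesis N0 : N 0 = 0.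
Hypothesis NB : forall v w, S v -> S w -> N (v - w) <= N v + N w.

Let SB := subspaceB S_lin.

Let N_opp w : S w -> N (- w) <= N w.
Proof. by move=> Sw; have := NB S0 Sw; rewrite sub0r N0 add0r. Qed.

Let N_distC v w : S v -> S w -> N (v - w) = N (w - v).
Proof.
move=> Sv Sw; apply/eqP; rewrite eq_le -{1}opprB -[X in _ && (N X <= _)]opprB.
by rewrite !N_opp//; exact: SB.
Qed.

Lemma seminorm_dist v w : S v -> S w -> `|N v - N w| <= N (v - w).
Proof.
move=> Sv Sw; have key x y : S x -> S y -> N x <= N (x - y) + N y.
  move=> Sx Sy; have Sny : S (- y) by rewrite -sub0r; exact: SB.
  have := NB (SB Sx Sy) Sny; rewrite opprK subrK => /le_trans; apply.
  by rewrite lerD2l; exact: N_opp.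
have := key v w Sv Sw; have := key w v Sw Sv; rewrite (N_distC Sw Sv) => h1 h2.
by rewrite ler_distl; apply/andP; split; lra.
Qed.

(** Strong measurability once the exceptional null sets are gone: membership and convergence hold at
    every time of [E], and the norm is real-valued. The same notion serves H^1_0 and its dual. *)
Definition seminorm_limit (E : set (measurableTypeR R)) (s : nat -> R -> V) (w : R -> V) :=
  [/\ forall k, simple_curve S (s k), forall t, E t -> S (w t) &
      forall t, E t -> N (s k t - w t) @[k --> \oo] --> 0].

Variable E : set (measurableTypeR R).
Hypothesis mE : measurable E.

Lemma seminorm_limitB s s' w w' : seminorm_limit E s w -> seminorm_limit E s' w' ->
  seminorm_limit E (fun k t => s k t - s' k t) (fun t => w t - w' t).
Proof.
move=> [sS wS sw] [sS' wS' sw']; split.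
- by move=> k; exact: simple_curveB.
- by move=> t Et; apply: SB; [exact: wS|exact: wS'].
- move=> t Et.
  apply: (@squeeze_cvgn0 _ _ (fun k => N (s k t - w t) + N (s' k t - w' t))); last first.
    by rewrite -[X in _ --> X](addr0 0); apply: cvgD; [exact: sw|exact: sw'].
  near=> k; rewrite N_ge0 /=.
  rewrite (_ : s k t - s' k t - (w t - w' t) = (s k t - w t) - (s' k t - w' t)).
    apply: NB; apply: SB; do ?[exact: wS|exact: wS'];
    exact: (simple_curve_in S0 S_lin).
  by rewrite !opprD !opprK addrACA.
Unshelve. all: by end_near. Qed.

Lemma seminorm_limit_cvg s w t : seminorm_limit E s w -> E t ->
  N (s k t) @[k --> \oo] --> N (w t).
Proof.
move=> [sS wS sw] Et; apply/cvgrPdist_le => /= e e0.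
have /cvgrPdist_le/(_ e e0) := sw t Et; apply: filterS => k.
rewrite sub0r normrN ger0_norm// => h; rewrite distrC.
by apply: le_trans (seminorm_dist _ (wS t Et)) h; exact: (simple_curve_in S0 S_lin).
Qed.

Lemma seminorm_limit_measurable s w : seminorm_limit E s w ->
  measurable_fun E (fun t => N (w t)).
Proof.
move=> sw; apply: (measurable_fun_cvg (h := fun k t => N (s k t))).
  move=> k; apply: measurable_funTS; apply: simple_curve_measurable.
  by case: sw.
by move=> t Et; exact: (seminorm_limit_cvg sw).
Qed.

Lemma seminorm_dist_measurable s w k : seminorm_limit E s w ->
  measurable_fun E (fun t => N (w t - s k t)).
Proof.
move=> sw; have [sS wS cw] := sw.
have St l t : S (s l t) by exact: (simple_curve_in S0 S_lin).
apply: (measurable_fun_cvg (h := fun l t => N (s l t - s k t))).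
  move=> l; apply: measurable_funTS.
  by apply: (@simple_curve_measurable _ _ S N (fun t => s l t - s k t)); exact: simple_curveB.
move=> t Et; apply/cvgrPdist_le => /= e e0.
have /cvgrPdist_le/(_ e e0) := cw t Et; apply: filterS => l.
rewrite sub0r normrN ger0_norm// => h; rewrite distrC.
apply: le_trans h; rewrite (_ : s l t - w t = (s l t - s k t) - (w t - s k t)); last first.
  by rewrite opprB addrA subrK.
by apply: seminorm_dist; apply: SB => //; exact: wS.
Qed.

(** The approximants converge only pointwise and may be large, so they are truncated until dominated
    convergence applies to the squared distances. *)
Lemma seminorm_limit_approx s w : seminorm_limit E s w ->
  leb.-integrable E (EFin \o (fun t => N (w t) ^+ 2)) ->
  forall eps : R, 0 < eps ->
  exists m (A : 'I_m -> set (measurableTypeR R)) (v : 'I_m -> V),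
  [/\ forall j, measurable (A j), forall j, S (v j),
      leb.-integrable E (EFin \o (fun t => N (w t - simple_sum A v t) ^+ 2)) &
      \int[leb]_(t in E) (N (w t - simple_sum A v t) ^+ 2) <= eps].
Proof.
move=> sw Nw eps eps0; have [sS wS cw] := sw.
have St l t : S (s l t) by exact: (simple_curve_in S0 S_lin).
have mN := seminorm_limit_measurable sw.
(* Where the approximant exceeds twice the norm of [w] it is replaced by 0. The distance to [w] is
   then at most 3 N (w t), which explains the factor 9 below. *)
pose C k := E `&` [set t | N (s k t) <= 2 * N (w t)].
have mC k : measurable (C k).
  have mh : measurable_fun E (fun t => 2 * N (w t) - N (s k t)).
    apply: measurable_funB; first exact: measurable_funM.
    by apply: measurable_funTS; apply: simple_curve_measurable; exact: (sS k).
  have := mh mE `[0, +oo[%classic (measurable_itv _).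
  rewrite (_ : E `&` _ @^-1` _ = C k)//.
  by apply/seteqP; split => t [Et]; rewrite /= in_itv /= andbT subr_ge0.
pose sig k t : V := \1_(C k) t *: s k t.
have sigE k t : sig k t = if t \in C k then s k t else 0.
  by rewrite /sig indicE; case: ifP; rewrite ?scale1r ?scale0r.
pose X k t := N (w t - sig k t) ^+ 2.
have mX k : measurable_fun E (X k).
  apply: measurable_funX.
  rewrite (_ : (fun t => _) = (fun t =>
      \1_(C k) t * N (w t - s k t) + \1_(~` C k) t * N (w t))).
    apply: measurable_funD; apply: measurable_funM => //; try exact: measurable_indic.
      exact: seminorm_dist_measurable sw.
    by apply: measurable_indic; exact: measurableC.
  apply/funext => t; rewrite sigE !indicE in_setC.
  by case: ifP => _ /=; rewrite ?mul1r ?mul0r ?addr0 ?add0r ?subr0.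
have Xb k t : E t -> X k t <= 9 * N (w t) ^+ 2.
  move=> Et; rewrite /X (_ : 9 = 3 ^+ 2); last by ring.
  rewrite -exprMn lerXn2r ?nnegrE ?mulr_ge0//.
  rewrite sigE; case: ifPn => [|_]; last first.
    by rewrite subr0; have := N_ge0 (w t); lra.
  rewrite inE => -[_ /= h]; apply: le_trans (NB (wS _ Et) (St _ _)) _; lra.
have X0 t : E t -> X k t @[k --> \oo] --> 0.
  move=> Et.
  have c : N (s k t - w t) ^+ 2 @[k --> \oo] --> 0.
    by rewrite -[X in _ --> X](mulr0 0); under eq_fun do rewrite expr2; apply: cvgM; exact: cw.
  have c2 : 0 < N (w t) -> \forall k \near \oo, N (s k t) < N (w t) + N (w t).
    by move=> Nw0; apply: (cvgr_lt _ (seminorm_limit_cvg sw Et)); rewrite ltrDl.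
  (* If the norm of [w t] is positive, [t] is eventually kept by the truncation. If it is 0 this may
     fail, but replacing the approximant by 0 then costs nothing. *)
  have [Nw0|Nw0] := leP (N (w t)) 0.
    apply: squeeze_cvgn0 c; near=> k; rewrite sqr_ge0 /=.
    rewrite /X lerXn2r ?nnegrE// sigE; case: ifPn => [_|_].
      by rewrite N_distC//; exact: wS.
    by rewrite subr0 (le_trans Nw0).
  have {}c2 := c2 Nw0.
  apply: squeeze_cvgn0 c; near=> k; rewrite sqr_ge0 /=.
  rewrite /X lerXn2r ?nnegrE// sigE; case: ifPn => [_|].
    by rewrite N_distC//; exact: wS.
  rewrite notin_setE => nC; rewrite subr0.
  exfalso; apply: nC; split => //=.
  have : N (s k t) < N (w t) + N (w t) by near: k.
  by move=> /ltW; rewrite -mulr2n mulr_natl.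
have XI k : leb.-integrable E (EFin \o X k).
  apply: le_integrable (integrableZ_EFin mE 9 Nw) => //; first exact/measurable_EFinP.
  by move=> t Et /=; rewrite lee_fin !ger0_norm ?mulr_ge0 ?sqr_ge0// Xb.
have lim : (\int[leb]_(t in E) X k t) @[k --> \oo] --> \int[leb]_(t in E) (0 : R).
  apply: (@Rintegral_dominated_cvg R _ (measurableTypeR R) leb E X _ (fun t => 9 * N (w t) ^+ 2)) => //.
    exact: integrableZ_EFin.
  by move=> k t Et; rewrite ger0_norm ?sqr_ge0// Xb.
have {}lim : (\int[leb]_(t in E) X k t) @[k --> \oo] --> 0.
  by move: lim; rewrite {2}/Rintegral integral0.
have [k kE] : exists k, \int[leb]_(t in E) X k t <= eps.
  have /cvgrPdist_le/(_ _ eps0)[k _ hk] := lim; exists k.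
  by have := hk k (leqnn k); rewrite /= sub0r normrN; apply: le_trans; exact: ler_norm.
have [m [A [v [mA Sv sE]]]] := sS k.
(* Truncation only shrinks the sets, so the truncated curve is still simple. *)
exists m, (fun j => A j `&` C k), v.
have -> : simple_sum (fun j => A j `&` C k) v = sig k.
  apply/funext => t; rewrite /simple_sum /sig sE scaler_sumr; apply: eq_bigr => j _.
  by rewrite indicI scalerA mulrC.
by split; [move=> j; exact: measurableI|exact: Sv|exact: XI|exact: kE].
Unshelve. all: by end_near. Qed.

End seminorm_limits.

Lemma ae_measurable_null d (X : measurableType d) (R : realType)
    (mu : {measure set X -> \bar R}) (P : X -> Prop) : {ae mu, forall x, P x} ->
  exists M, [/\ measurable M, mu M = 0%E & forall x, ~ M x -> P x].
Proof.
move=> [M [mM M0 sM]]; exists M; split => // x nM.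
by apply: contrapT => nP; apply: nM; exact: sM.
Qed.

(** * H^1_0 and its dual *)

Section semi_inner_product.
Context (R : realType) (V : lmodType R).
Variables (S : set V) (B : V -> V -> R).
Hypothesis S_lin : forall a w w', S w -> S w' -> S (a *: w + w').
Hypothesis B_sym : forall v w, B v w = B w v.
Hypothesis B_lin : forall a v w z, S v -> S w -> S z -> B (a *: v + w) z = a * B v z + B w z.
Hypothesis B_ge0 : forall v, 0 <= B v v.

Lemma form_lin_sqr a v w : S v -> S w ->
  B (a *: v + w) (a *: v + w) = a ^+ 2 * B v v + 2 * a * B v w + B w w.
Proof.
move=> Sv Sw; have Svw : S (a *: v + w) by exact: S_lin.
rewrite B_lin// (B_sym v) (B_sym w) !B_lin// (B_sym w v); ring.
Qed.

Lemma form_CS v w : S v -> S w -> B v w ^+ 2 <= B v v * B w w.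
Proof.
move=> Sv Sw; have key a : 0 <= a ^+ 2 * B v v + 2 * a * B v w + B w w.
  by rewrite -form_lin_sqr.
(* The form is only semidefinite. When [B v v] vanishes the quadratic in [a] is affine, and a
   nonzero slope would make it equal to -1 for the chosen [a]. *)
have [v0|v0] := eqVneq (B v v) 0.
  have [->|b0] := eqVneq (B v w) 0; first by rewrite expr0n mulr_ge0.
  have := key (- (B w w + 1) / (2 * B v w)); rewrite v0 mulr0 add0r.
  rewrite (_ : 2 * _ * _ = - (B w w + 1)); last by field.
  by lra.
have {}v0 : 0 < B v v by rewrite lt_neqAle eq_sym v0 B_ge0.
have := key (- B v w / B v v).
rewrite (_ : _ + _ + _ = (B v v * B w w - B v w ^+ 2) / B v v); last first.
  by field; rewrite gt_eqF.
by rewrite pmulr_lge0 ?invr_gt0// subr_ge0.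
Qed.

Lemma form_norm_CS v w : S v -> S w ->
  `|B v w| <= Num.sqrt (B v v) * Num.sqrt (B w w).
Proof.
by move=> Sv Sw; rewrite -sqrtrM// -sqrtr_sqr ler_wsqrtr// form_CS.
Qed.

Lemma form_norm_lin a v w : S v -> S w ->
  Num.sqrt (B (a *: v + w) (a *: v + w)) <=
  `|a| * Num.sqrt (B v v) + Num.sqrt (B w w).
Proof.
move=> Sv Sw; set x := Num.sqrt (B v v); set y := Num.sqrt (B w w).
have x0 : 0 <= x by exact: sqrtr_ge0.
have y0 : 0 <= y by exact: sqrtr_ge0.
have r0 : 0 <= `|a| * x + y by rewrite addr_ge0// mulr_ge0.
rewrite -(ger0_norm r0) -sqrtr_sqr ler_wsqrtr// form_lin_sqr//.
rewrite -(sqr_sqrtr (B_ge0 v)) -(sqr_sqrtr (B_ge0 w)) -/x -/y.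
rewrite (_ : (`|a| * x + y) ^+ 2 = `|a| ^+ 2 * x ^+ 2 + 2 * (`|a| * (x * y)) + y ^+ 2); last by ring.
rewrite real_normK ?num_real// lerD2r lerD2l -mulrA ler_wpM2l//.
apply: le_trans (ler_norm _) _; rewrite normrM ler_wpM2l//.
exact: form_norm_CS.
Qed.

End semi_inner_product.

Section L2_form.
Context d (T : measurableType d) (R : realType) (mu : {measure set T -> \bar R}).
Variable D : set T.
Hypothesis mD : measurable D.

Definition L2form (f g : T -> R) : R := \int[mu]_(x in D) (f x * g x).

Lemma L2formC f g : L2form f g = L2form g f.
Proof. by apply: eq_Rintegral => x _; rewrite mulrC. Qed.

Lemma L2form_ge0 f : 0 <= L2form f f.
Proof. by apply: Rintegral_ge0 => x _; rewrite -expr2 sqr_ge0. Qed.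

Lemma L2form_lin (a : R) f g h : L2 mu D f -> L2 mu D g -> L2 mu D h ->
  L2form (fun x => a * f x + g x) h = a * L2form f h + L2form g h.
Proof.
move=> Lf Lg Lh; rewrite /L2form -RintegralZl//; last exact: L2_mul_integrable.
rewrite -RintegralD//; last 2 first.
- by apply: integrableZ_EFin => //; exact: L2_mul_integrable.
- exact: L2_mul_integrable.
by apply: eq_Rintegral => x _; ring.
Qed.

Lemma L2norm_form f : L2 mu D f -> L2norm mu D f = (Num.sqrt (L2form f f))%:E.
Proof.
by move=> Lf; rewrite L2normE.
Qed.

Lemma L2form_CS f g : L2 mu D f -> L2 mu D g ->
  `|L2form f g| <= Num.sqrt (L2form f f) * Num.sqrt (L2form g g).
Proof.
move=> Lf Lg.
apply: (@form_norm_CS R (T -> R^o) [set f | L2 mu D f] L2form) => //.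
- by move=> a w w'; exact: L2_lin.
- exact: L2formC.
- by move=> a v w z; exact: L2form_lin.
- exact: L2form_ge0.
Qed.

End L2_form.

Section sobolev_theory.
Context (R : realType) (n : nat).
Local Notation Rn := 'rV[R]_n.
Local Notation mu := (lebesgue_rV R n).
Variable Omega : set Rn.
Hypothesis Omega_open : open Omega.
Hypothesis Omega_bdd : bounded_set Omega.

Local Notation V := ((Rn -> R^o) * (Rn -> Rn))%type.
Implicit Types (p q : V) (w : Rn -> R).

Lemma mOmega : measurable Omega. Proof. exact: open_rV_measurable. Qed.
Local Hint Resolve mOmega : core.

Lemma continuous_L2 w : continuous w -> L2 mu Omega w.
Proof.
move=> cw; have [M hM] := continuous_bounded_set Omega_bdd cw.
apply: (@bounded_L2 _ _ _ _ _ _ _ M) => //.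
  exact: bounded_lebesgue_rV.
by apply: measurable_funTS; exact: continuous_rV_measurable.
Qed.

Lemma test_fun_L2 psi : test_fun Omega psi -> L2 mu Omega psi.
Proof. by move=> [s _]; apply: continuous_L2; exact: (Ck_continuous (s 0)). Qed.

Lemma test_fun_partial_L2 psi i : test_fun Omega psi -> L2 mu Omega (partial i psi).
Proof.
move=> [s _]; apply: continuous_L2.
by have [_ /(_ (delta_mx ord0 i))[_ [c _]]] := s 1.
Qed.

Lemma test_fun_partial_lin (a : R) psi psi' i : test_fun Omega psi -> test_fun Omega psi' ->
  partial i (fun x => a * psi x + psi' x) = (fun x => a * partial i psi x + partial i psi' x).
Proof.
move=> [s _] [s' _]; apply/funext => x; rewrite /partial.
have [_ /(_ (delta_mx ord0 i))[d _]] := s 1.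
have [_ /(_ (delta_mx ord0 i))[d' _]] := s' 1.
rewrite (deriveD (f := a *: psi))//; last exact: derivableZ.
by rewrite deriveZ.
Qed.

(** The value and the gradient component are not yet related: square integrability is what makes
    [H1form] bilinear, and this covers test functions, H^1 pairs and their differences alike. *)
Definition L2pair : set V := [set p : V |
  L2 mu Omega p.1 /\ forall i, L2 mu Omega (fun x => p.2 x ord0 i)].

Definition H1form p q : R :=
  L2form mu Omega p.1 q.1 + \sum_i L2form mu Omega (fun x => p.2 x ord0 i) (fun x => q.2 x ord0 i).

Definition H1n p : R := Num.sqrt (H1form p p).

Lemma L2pair_lin (a : R) p q : L2pair p -> L2pair q -> L2pair (a *: p + q).
Proof.
move=> [p1 p2] [q1 q2]; split; first exact: L2_lin.
move=> i; have := L2_lin mOmega a (p2 i) (q2 i).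
by congr L2; apply/funext => x; rewrite /= /GRing.scale /= !mxE.
Qed.

Lemma H1formC p q : H1form p q = H1form q p.
Proof. by rewrite /H1form L2formC; congr (_ + _); apply: eq_bigr => i _; rewrite L2formC. Qed.

Lemma H1form_ge0 p : 0 <= H1form p p.
Proof. by rewrite addr_ge0 ?L2form_ge0// sumr_ge0// => i _; exact: L2form_ge0. Qed.

Lemma H1form_lin (a : R) p q r : L2pair p -> L2pair q -> L2pair r ->
  H1form (a *: p + q) r = a * H1form p r + H1form q r.
Proof.
move=> [p1 p2] [q1 q2] [r1 r2]; rewrite /H1form mulrDr mulr_sumr addrACA -big_split /=.
congr (_ + _); first by rewrite -L2form_lin.
apply: eq_bigr => i _; rewrite -L2form_lin//; congr (L2form _ _ _ _).
by apply/funext => x; rewrite /= !mxE.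
Qed.

Lemma sqr_enorm (a : Rn) : enorm a ^+ 2 = \sum_i a ord0 i ^+ 2.
Proof.
rewrite /enorm sqr_sqrtr; last by apply: sumr_ge0 => i _; rewrite -expr2 sqr_ge0.
by apply: eq_bigr => i _; rewrite expr2.
Qed.

Lemma L2_sqrt_sum (I : Type) (s : seq I) (h : I -> Rn -> R) :
  (forall i, L2 mu Omega (h i)) ->
  L2 mu Omega (fun x => Num.sqrt (\sum_(i <- s) h i x ^+ 2)).
Proof.
move=> hi; have E x : Num.sqrt (\sum_(i <- s) h i x ^+ 2) ^+ 2 = \sum_(i <- s) h i x ^+ 2.
  by rewrite sqr_sqrtr// sumr_ge0// => i _; exact: sqr_ge0.
apply: sqr_integrable_L2 => //.
  have ms : measurable_fun setT (@Num.sqrt R) by apply: continuous_measurable_fun; exact: sqrt_continuous.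
  apply: (measurableT_comp (f := @Num.sqrt R)) => //.
  by apply: measurable_sum => i; apply: measurable_funX; exact: (hi i).1.
under [X in _.-integrable _ X]eq_fun do rewrite /= E.
by apply: (@integrable_sum_EFin _ _ _ _ _ _ _ s (fun i x => h i x ^+ 2)) => // i; exact: L2_integrable_sqr.
Qed.

Lemma enorm_L2 (G : Rn -> Rn) : (forall i, L2 mu Omega (fun x => G x ord0 i)) ->
  L2 mu Omega (fun x => enorm (G x)).
Proof.
by move=> hG; exact: (L2_sqrt_sum (index_enum 'I_n) hG).
Qed.

Lemma enorm_form (G : Rn -> Rn) : (forall i, L2 mu Omega (fun x => G x ord0 i)) ->
  \int[mu]_(x in Omega) (enorm (G x) ^+ 2) =
  \sum_i L2form mu Omega (fun x => G x ord0 i) (fun x => G x ord0 i).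
Proof.
move=> hG; under eq_Rintegral do rewrite sqr_enorm.
by rewrite Rintegral_sum// => i; exact: L2_integrable_sqr.
Qed.

Lemma H1normE p : L2pair p -> H1norm Omega p = (H1n p)%:E.
Proof.
move=> [p1 p2].
(* The value and the entries of the gradient form one family, so that the integrand of the norm is
   the root of a single sum of squares. *)
pose h (o : option 'I_n) x : R := if o is Some i then p.2 x ord0 i else p.1 x.
have E x : p.1 x ^+ 2 + enorm (p.2 x) ^+ 2 = \sum_(o <- None :: [seq Some i | i <- index_enum 'I_n]) h o x ^+ 2.
  by rewrite big_cons big_map /= sqr_enorm.
have Lh : L2 mu Omega (fun x => Num.sqrt (p.1 x ^+ 2 + enorm (p.2 x) ^+ 2)).
  under eq_fun do rewrite E.
  by apply: L2_sqrt_sum => -[i|]; [exact: p2|exact: p1].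
rewrite /H1norm L2normE//; congr (Num.sqrt _)%:E.
under eq_Rintegral do rewrite sqr_sqrtr ?addr_ge0 ?sqr_ge0//.
rewrite RintegralD//; last 2 first.
- exact: L2_integrable_sqr.
- by apply: L2_integrable_sqr => //; exact: enorm_L2.
by rewrite enorm_form.
Qed.

Lemma H1n_lin (a : R) p q : L2pair p -> L2pair q ->
  H1n (a *: p + q) <= `|a| * H1n p + H1n q.
Proof.
by apply: form_norm_lin; [exact: L2pair_lin|exact: H1formC|exact: H1form_lin|exact: H1form_ge0].
Qed.

Lemma H1_L2pair p : H1 Omega p.1 p.2 -> L2pair p.
Proof. by case. Qed.

Lemma H10_L2pair p : H10 Omega p.1 p.2 -> L2pair p.
Proof. by case => /H1_L2pair. Qed.

Definition H10set : set V := [set p : V | H10 Omega p.1 p.2].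

Lemma H1_lin (a : R) p q : H1 Omega p.1 p.2 -> H1 Omega q.1 q.2 ->
  H1 Omega (a *: p + q).1 (a *: p + q).2.
Proof.
move=> Hp Hq; have [l1 l2] := L2pair_lin a (H1_L2pair Hp) (H1_L2pair Hq).
split => // i psi tpsi; have [p1 p2 pw] := Hp; have [q1 q2 qw] := Hq.
have Ld := test_fun_partial_L2 i tpsi; have Lp := test_fun_L2 tpsi.
have := L2form_lin mOmega a p1 q1 Ld; rewrite /L2form => E1.
have := L2form_lin mOmega a (p2 i) (q2 i) Lp; rewrite /L2form => E2.
rewrite [LHS]E1 pw// qw// mulrN -opprD -E2; congr (- _).
by apply: eq_Rintegral => x _ /=; rewrite !mxE.
Qed.

Let tpair (psi : Rn -> R) : V := (psi, grad psi).

Lemma test_fun_L2pair psi : test_fun Omega psi -> L2pair (tpair psi).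
Proof.
move=> tpsi; split; first exact: test_fun_L2.
move=> i; have := test_fun_partial_L2 i tpsi; congr L2.
by apply/funext => x; rewrite mxE.
Qed.

Let L2pairB p q : L2pair p -> L2pair q -> L2pair (p - q).
Proof. by move=> Lp Lq; rewrite addrC -scaleN1r; exact: L2pair_lin. Qed.

Let H10_cvg p : L2pair p -> forall psi : nat -> Rn -> R, (forall k, test_fun Omega (psi k)) ->
  (H1norm Omega (psi k \- p.1, grad (psi k) \- p.2) @[k --> \oo] --> 0%E <->
   H1n (tpair (psi k) - p) @[k --> \oo] --> 0).
Proof.
move=> Lp psi tpsi.
have E k : H1norm Omega (psi k \- p.1, grad (psi k) \- p.2) = (H1n (tpair (psi k) - p))%:E.
  by rewrite -H1normE//; apply: L2pairB => //; exact: test_fun_L2pair.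
under eq_fun do rewrite E.
split; last by move=> h; apply/cvg_EFin => //; exact: nearW.
by move=> /fine_cvg.
Qed.

Lemma H10_lin (a : R) p q : H10set p -> H10set q -> H10set (a *: p + q).
Proof.
move=> Hp Hq; have Lp := H10_L2pair Hp; have Lq := H10_L2pair Hq.
have [[H1p [psi [tpsi cpsi]]] [H1q [psi' [tpsi' cpsi']]]] := (Hp, Hq).
split; first exact: H1_lin.
exists (fun k x => a * psi k x + psi' k x); split.
  by move=> k; exact: test_fun_lin.
apply/H10_cvg; first exact: L2pair_lin.
  by move=> k; exact: test_fun_lin.
have {}cpsi : H1n (tpair (psi k) - p) @[k --> \oo] --> 0 by apply/H10_cvg.
have {}cpsi' : H1n (tpair (psi' k) - q) @[k --> \oo] --> 0 by apply/H10_cvg.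
apply: (@squeeze_cvgn0 _ _ (fun k => `|a| * H1n (tpair (psi k) - p) + H1n (tpair (psi' k) - q))).
  near=> k; rewrite sqrtr_ge0 /=.
  rewrite (_ : tpair _ - _ = a *: (tpair (psi k) - p) + (tpair (psi' k) - q)).
    by apply: H1n_lin; apply: L2pairB => //; exact: test_fun_L2pair.
  rewrite scalerBr opprD addrACA; congr (_ + _).
  rewrite /tpair; congr (_, _); apply/funext => x; apply/rowP => i; rewrite !mxE.
  by rewrite test_fun_partial_lin.
rewrite -[X in _ --> X](addr0 0) -{1}(mulr0 `|a|); apply: cvgD; last exact: cpsi'.
by apply: cvgM; [exact: cvg_cst|exact: cpsi].
Unshelve. all: by end_near. Qed.

Let tpair0 : tpair (fun=> 0 : R) = 0.
Proof.
rewrite /tpair; congr (_, _); apply/funext => x; apply/rowP => i; rewrite !mxE.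
by rewrite /partial; exact: derive_cst.
Qed.

Lemma L2pair0 : L2pair 0.
Proof. by rewrite -tpair0; apply: test_fun_L2pair; exact: test_fun0. Qed.

Lemma H1n0 : H1n 0 = 0.
Proof.
have := H1form_lin 1 L2pair0 L2pair0 L2pair0; rewrite scale1r addr0 mul1r => h.
by rewrite /H1n (_ : H1form 0 0 = 0) ?sqrtr0//; lra.
Qed.

Lemma H10_0 : H10set 0.
Proof.
have L0 := L2pair0; split.
  split; [exact: L0.1|exact: L0.2|move=> i psi _].
  rewrite (_ : Rintegral _ _ _ = 0); last first.
    by rewrite /Rintegral integral0_eq// => x _ /=; rewrite mul0r.
  by rewrite (_ : Rintegral _ _ _ = 0) ?oppr0// /Rintegral integral0_eq// => x _ /=; rewrite mxE mul0r.
exists (fun _ _ => 0); split; first by move=> _; exact: test_fun0.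
apply/H10_cvg => //; first by move=> _; exact: test_fun0.
by rewrite tpair0 subr0 H1n0; exact: cvg_cst.
Qed.

Lemma H1nB p q : L2pair p -> L2pair q -> H1n (p - q) <= H1n p + H1n q.
Proof.
move=> Lp Lq; rewrite addrC -scaleN1r; apply: le_trans (H1n_lin _ Lq Lp) _.
by rewrite normrN normr1 mul1r addrC.
Qed.

Lemma H1nZ (a : R) p : L2pair p -> H1n (a *: p) <= `|a| * H1n p.
Proof.
by move=> Lp; have := H1n_lin a Lp L2pair0; rewrite !addr0 H1n0 addr0.
Qed.

(** Nothing is lost on H^{-1}, where the norm is finite by [Hm1normE]; being real-valued, it fits
    the seminorm lemmas that also serve H^1_0. *)
Definition Hm1n (xi : (Rn -> R) -> R^o) : R := fine (Hm1norm Omega xi).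

Lemma Hm1_norm_ge0 (xi : (Rn -> R) -> R^o) : (0 <= Hm1norm Omega xi)%E.
Proof.
apply: le_trans (_ : (`|xi 0|%:E <= _)%E); first by rewrite lee_fin.
apply: ereal_sup_ubound; exists 0, 0; split => //; first exact: H10_0.
by rewrite (H1normE L2pair0) H1n0 lee_fin.
Qed.

Lemma Hm1normE (xi : (Rn -> R) -> R^o) : Hm1 Omega xi -> Hm1norm Omega xi = (Hm1n xi)%:E.
Proof.
move=> [_ [C hC]]; rewrite fineK// ge0_fin_numE; last exact: Hm1_norm_ge0.
apply: (@le_lt_trans _ _ `|C|%:E); last exact: ltry.
apply: ge_ereal_sup => _ [w [G [HwG N1 ->]]].
apply: le_trans (hC _ _ HwG) _; move: N1.
rewrite (H1normE (H10_L2pair (p := (w, G)) HwG)) -EFinM !lee_fin => N1.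
apply: le_trans (ler_norm _) _; rewrite normrM (ger0_norm (sqrtr_ge0 _)).
by rewrite -[leRHS]mulr1 ler_wpM2l.
Qed.

Lemma Hm1n_ge0 (xi : (Rn -> R) -> R^o) : 0 <= Hm1n xi.
Proof. by rewrite fine_ge0// Hm1_norm_ge0. Qed.

Lemma Hm1_linear (xi : (Rn -> R) -> R^o) (a : R) p q : Hm1 Omega xi ->
  H10set p -> H10set q -> xi (a *: p + q).1 = a * xi p.1 + xi q.1.
Proof. by move=> [l _] Hp Hq; exact: l Hp Hq. Qed.

Lemma Hm1_0 (xi : (Rn -> R) -> R^o) : Hm1 Omega xi -> xi 0 = 0.
Proof.
move=> Hxi; have := Hm1_linear 1 Hxi H10_0 H10_0; rewrite scale1r addr0 mul1r /=.
by move=> h; lra.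
Qed.

Lemma Hm1Z (xi : (Rn -> R) -> R^o) (a : R) p : Hm1 Omega xi ->
  H10set p -> xi (a *: p).1 = a * xi p.1.
Proof.
by move=> Hxi Hp; have := Hm1_linear a Hxi Hp H10_0; rewrite addr0 (Hm1_0 Hxi) addr0.
Qed.

Lemma Hm1_bound (xi : (Rn -> R) -> R^o) p : Hm1 Omega xi -> H10set p ->
  `|xi p.1| <= Hm1n xi * H1n p.
Proof.
move=> Hxi Hp; have Lp := H10_L2pair Hp.
(* A pair of norm 0 cannot be normalised for the supremum; there the boundedness constant in [Hm1]
   forces the value of [xi] to be 0. *)
have [p0|p0] := eqVneq (H1n p) 0.
  have [_ [C hC]] := Hxi; have := hC _ _ Hp.
  by rewrite -surjective_pairing H1normE// p0 mulr0 mule0 lee_fin.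
have {}p0 : 0 < H1n p by rewrite lt_neqAle eq_sym p0 sqrtr_ge0.
have i0 : 0 <= (H1n p)^-1 by rewrite invr_ge0 ltW.
rewrite -ler_pdivrMr// -lee_fin -Hm1normE//.
apply: ereal_sup_ubound; exists ((H1n p)^-1 *: p).1, ((H1n p)^-1 *: p).2; split.
- by have := H10_lin (H1n p)^-1 Hp H10_0; rewrite addr0.
- rewrite -surjective_pairing H1normE ?lee_fin; last first.
    by have := L2pair_lin (H1n p)^-1 Lp L2pair0; rewrite addr0.
  apply: le_trans (H1nZ _ Lp) _.
  by rewrite (ger0_norm i0) mulVf// gt_eqF.
- by rewrite Hm1Z// normrM (ger0_norm i0) mulrC.
Qed.

Definition Hm1set : set ((Rn -> R) -> R^o) := [set xi | Hm1 Omega xi].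

Lemma Hm1_lin (a : R) (xi xi' : (Rn -> R) -> R^o) :
  Hm1set xi -> Hm1set xi' -> Hm1set (a *: xi + xi').
Proof.
move=> Hxi Hxi'; have [l _] := Hxi; have [l' _] := Hxi'; split.
  move=> c w G w' G' H H'; rewrite /= /GRing.scale /= !fctE /=.
  rewrite (l c _ _ _ _ H H') (l' c _ _ _ _ H H') /GRing.scale /=; ring.
exists (`|a| * Hm1n xi + Hm1n xi') => w G H.
rewrite (H1normE (H10_L2pair (p := (w, G)) H)) -EFinM lee_fin.
rewrite fctE /= (le_trans (ler_normD _ _))// mulrDl; apply: lerD.
  rewrite /GRing.scale /= normrM -mulrA ler_wpM2l//.
  exact: (Hm1_bound (p := (w, G)) Hxi H).
exact: (Hm1_bound (p := (w, G)) Hxi' H).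
Qed.

Lemma Hm1set0 : Hm1set 0.
Proof.
split; first by move=> *; rewrite /= mulr0 addr0.
by exists 0 => w G _; rewrite mul0e normr0.
Qed.

Lemma Hm1n0 : Hm1n 0 = 0.
Proof.
apply/eqP; rewrite eq_le Hm1n_ge0 andbT -lee_fin -Hm1normE; last exact: Hm1set0.
by apply: ge_ereal_sup => _ [w [G [_ _ ->]]]; rewrite normr0.
Qed.

Lemma Hm1nB (xi xi' : (Rn -> R) -> R^o) : Hm1set xi -> Hm1set xi' ->
  Hm1n (xi - xi') <= Hm1n xi + Hm1n xi'.
Proof.
move=> Hxi Hxi'.
have H : Hm1set (xi - xi') by rewrite addrC -scaleN1r; exact: Hm1_lin.
rewrite -lee_fin -Hm1normE//; apply: ge_ereal_sup => _ [w [G [HwG N1 ->]]].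
rewrite lee_fin; move: N1; rewrite (H1normE (H10_L2pair (p := (w, G)) HwG)) lee_fin => N1.
rewrite (le_trans (ler_normB _ _))//; apply: lerD.
  apply: le_trans (Hm1_bound (p := (w, G)) Hxi HwG) _.
  by rewrite -[leRHS]mulr1 ler_wpM2l// Hm1n_ge0.
apply: le_trans (Hm1_bound (p := (w, G)) Hxi' HwG) _.
by rewrite -[leRHS]mulr1 ler_wpM2l// Hm1n_ge0.
Qed.

End sobolev_theory.

(** * The energy inequality for admissible functions *)

(** Joining the null sets of the two almost-everywhere clauses of [bochner_L2] leaves times at which
    the curve lies in [S], so that the extended norm can be replaced there by the real one. *)
Lemma bochner_seminorm_limit (R : realType) (V : lmodType R) (S : set V)
    (Ne : V -> \bar R) (N : V -> R) (D : set (measurableTypeR R)) (w : R -> V) :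
  S 0 -> (forall a v v', S v -> S v' -> S (a *: v + v')) ->
  (forall v, 0 <= N v) -> N 0 = 0 ->
  (forall v v', S v -> S v' -> N (v - v') <= N v + N v') ->
  (forall v, S v -> Ne v = (N v)%:E) -> measurable D -> bochner_L2 D S Ne w ->
  exists M s, [/\ measurable M, @lebesgue_measure R M = 0%E,
    seminorm_limit S N (D `\` M) s w &
    lebesgue_measure.-integrable (D `\` M) (EFin \o (fun t => N (w t) ^+ 2))].
Proof.
move=> S0 S_lin N_ge0 N0 NB NeE mD [/ae_measurable_null[M1 [mM1 M10 wS]]].
move=> [s [sS /ae_measurable_null[M2 [mM2 M20 sw]]]] Nw.
have mM : measurable (M1 `|` M2) by exact: measurableU.
have M0 : @lebesgue_measure R (M1 `|` M2) = 0%E by apply: null_set_setU.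
have mE : measurable (D `\` (M1 `|` M2)) by exact: measurableD.
have wE t : (D `\` (M1 `|` M2)) t -> S (w t).
  by move=> [Dt /not_orP[nM1 _]]; exact: wS.
have L : seminorm_limit S N (D `\` (M1 `|` M2)) s w.
  split => // t [Dt /not_orP[nM1 nM2]]; have St := wS t nM1 Dt.
  have E k : Ne (s k t - w t) = (N (s k t - w t))%:E.
    by apply: NeE; apply: (subspaceB S_lin) => //; exact: (simple_curve_in S0 S_lin).
  by have := sw t nM2 Dt; under eq_fun do rewrite E; move=> /fine_cvg.
exists (M1 `|` M2), s; split => //; apply/integrableP; split.
  apply/measurable_EFinP/measurable_funX.
  by apply: (@seminorm_limit_measurable R V S N _ _ _ _ _ _ s) => //; exact: mE.
apply: le_lt_trans Nw; rewrite [leRHS](integral_setD_null _ _ mM M0).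
rewrite le_eqVlt; apply/orP; left; apply/eqP; apply: eq_integral => t.
by rewrite inE => /wE Sw; rewrite gee0_abs ?lee_fin ?sqr_ge0//= NeE// EFin_expe.
Qed.

Section admissible_theory.
Context (R : realType) (n : nat).
Local Notation Rn := 'rV[R]_n.
Local Notation leb := (@lebesgue_measure R).
Local Notation mu := (lebesgue_rV R n).
Local Notation muQ := (lebesgue_rV R n \x lebesgue_measure)%E.
Variable Omega : set Rn.
Hypothesis Omega_open : open Omega.
Hypothesis Omega_bdd : bounded_set Omega.
Local Notation V := ((Rn -> R^o) * (Rn -> Rn))%type.
Local Notation H10S := (H10set Omega).
Local Notation Hm1S := (Hm1set Omega).
Local Notation N1 := (H1n Omega).
Local Notation Nm1 := (Hm1n Omega).
Local Notation form := (L2form mu Omega).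
Let mO : measurable Omega := mOmega Omega_open.

Let H10_lin' := H10_lin Omega_open Omega_bdd.
Let H10_0' := H10_0 Omega_open Omega_bdd.
Let H1n_ge0' p : 0 <= N1 p. Proof. exact: sqrtr_ge0. Qed.
Let H1n0' : N1 0 = 0. Proof. exact: H1n0. Qed.
Let H1nB' p q : H10S p -> H10S q -> N1 (p - q) <= N1 p + N1 q.
Proof. by move=> Hp Hq; apply: H1nB => //; exact: H10_L2pair. Qed.
Let Hm1_lin' := Hm1_lin Omega_open Omega_bdd.
Let Hm1set0' : Hm1S 0. Proof. exact: Hm1set0. Qed.
Let Hm1n0' : Nm1 0 = 0. Proof. exact: Hm1n0. Qed.
Let Hm1n_ge0' xi : 0 <= Nm1 xi. Proof. exact: Hm1n_ge0. Qed.
Let Hm1nB' xi xi' : Hm1S xi -> Hm1S xi' -> Nm1 (xi - xi') <= Nm1 xi + Nm1 xi'.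
Proof. exact: Hm1nB. Qed.

Lemma Hm1B (xi : (Rn -> R) -> R^o) (p q : V) : Hm1S xi -> H10S p -> H10S q ->
  xi (p - q).1 = xi p.1 - xi q.1.
Proof.
move=> Hxi Hp Hq; rewrite (_ : p - q = -1 *: q + p); last by rewrite scaleN1r addrC.
by rewrite (Hm1_linear (-1) Hxi Hq Hp) mulN1r addrC.
Qed.

Lemma Hm1_sum (xi : (Rn -> R) -> R^o) m (c : 'I_m -> R) (v : 'I_m -> V) :
  Hm1S xi -> (forall j, H10S (v j)) ->
  xi (\sum_j c j *: v j).1 = \sum_j c j * xi (v j).1.
Proof.
move=> Hxi Sv.
suff : H10S (\sum_j c j *: v j) /\ xi (\sum_j c j *: v j).1 = \sum_j c j * xi (v j).1 by case.
elim/big_ind2: _ => [|x1 x2 y1 y2 [Sx1 <-] [Sx2 <-]|j _].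
- by rewrite (Hm1_0 Omega_open Omega_bdd Hxi).
- split; first by rewrite -[x2]scale1r; exact: H10_lin'.
  by have := Hm1_linear 1 Hxi Sx1 Sx2; rewrite scale1r mul1r.
- split; last exact: (Hm1Z Omega_open Omega_bdd).
  by rewrite -[_ *: _]addr0; exact: H10_lin'.
Qed.

(** Evaluation at [p] is measurable along simple curves of functionals, and convergence in the dual
    norm implies convergence of the values at [p]. *)
Lemma pairing_cst_measurable (E : set (measurableTypeR R)) xs x p : measurable E ->
  seminorm_limit Hm1S Nm1 E xs x -> H10S p -> measurable_fun E (fun t => x t p.1).
Proof.
move=> mE [xsS xS xc] Hp.
apply: (measurable_fun_cvg (h := fun k t => xs k t p.1)).
  move=> k; apply: measurable_funTS.
  exact: (@simple_curve_measurable _ _ Hm1S (fun xi : (Rn -> R) -> R^o => xi p.1) _ (xsS k)).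
move=> t Et; apply/cvgrPdist_le => /= e e0.
have c : Nm1 (xs k t - x t) * N1 p @[k --> \oo] --> 0.
  by rewrite -[X in _ --> X](mul0r (N1 p)); apply: cvgM; [exact: xc|exact: cvg_cst].
have /cvgrPdist_le/(_ e e0) := c; apply: filterS => k.
rewrite sub0r normrN => h; rewrite distrC.
apply: le_trans (le_trans (ler_norm _) h).
have Hd : Hm1S (xs k t - x t).
  apply: subspaceB; [exact: Hm1_lin'| |exact: xS].
  exact: (simple_curve_in Hm1set0' Hm1_lin').
exact: (Hm1_bound Omega_open Omega_bdd Hd Hp).
Qed.

(** The second argument is approximated by simple curves: for these the pairing is a finite sum of
    indicators times pairings with constants, and boundedness of [x t] gives the pointwise limit. *)
Lemma pairing_measurable (E : set (measurableTypeR R)) xs x s w : measurable E ->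
  seminorm_limit Hm1S Nm1 E xs x -> seminorm_limit H10S N1 E s w ->
  measurable_fun E (fun t => x t (w t).1).
Proof.
move=> mE lx [sS wS wc]; have [xsS xS xc] := lx.
apply: (measurable_fun_cvg (h := fun k t => x t (s k t).1)).
  move=> k; have [m [A [v [mA Sv sE]]]] := sS k.
  apply: (eq_measurable_fun (fun t => \sum_j \1_(A j) t * x t (v j).1)).
    move=> t; rewrite inE => /xS Hx; by rewrite sE Hm1_sum.
  apply: measurable_sum => j; apply: measurable_funM; first exact: measurable_indic.
  exact: (pairing_cst_measurable mE lx (Sv j)).
move=> t Et; apply/cvgrPdist_le => /= e e0.
have c : Nm1 (x t) * N1 (s k t - w t) @[k --> \oo] --> 0.
  by rewrite -[X in _ --> X](mulr0 (Nm1 (x t))); apply: cvgM; [exact: cvg_cst|exact: wc].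
have /cvgrPdist_le/(_ e e0) := c; apply: filterS => k.
rewrite sub0r normrN => h; rewrite distrC.
apply: le_trans (le_trans (ler_norm _) h).
have Hs : H10S (s k t) by exact: (simple_curve_in H10_0' H10_lin').
have Hw := wS t Et.
have -> : x t (s k t).1 - x t (w t).1 = x t (s k t - w t).1.
  by rewrite (Hm1B (xS t Et) Hs Hw).
by apply: (Hm1_bound Omega_open Omega_bdd (xS t Et)); exact: subspaceB.
Qed.

Section one_curve.
Variables (T : R) (phi : Rn -> R) (w : R -> Rn -> R) (Dw : R -> Rn -> Rn).
Variable wt : R -> (Rn -> R) -> R.
Hypothesis T0 : 0 < T.
Hypothesis adm : admissible Omega T phi w Dw wt.

Lemma admissible_limits : exists M s xs,
  [/\ measurable M, leb M = 0%E,
    seminorm_limit H10S N1 (`]0, T[ `\` M) s (fun t => (w t, Dw t)),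
    leb.-integrable (`]0, T[ `\` M) (EFin \o (fun t => N1 (w t, Dw t) ^+ 2)) &
    seminorm_limit Hm1S Nm1 (`]0, T[ `\` M) xs wt /\
    leb.-integrable (`]0, T[ `\` M) (EFin \o (fun t => Nm1 (wt t) ^+ 2))].
Proof.
pose I : set (measurableTypeR R) := `]0, T[%classic.
have mI : measurable I by exact: measurable_itv.
have [M1 [s [mM1 M10 sw sI]]] := bochner_seminorm_limit H10_0' H10_lin' H1n_ge0'
  H1n0' H1nB' (fun v Hv => H1normE Omega_open (H10_L2pair Hv)) mI (adm_L2H10 adm).
have [M2 [xs [mM2 M20 xw xI]]] := bochner_seminorm_limit Hm1set0' Hm1_lin' Hm1n_ge0'
  Hm1n0' Hm1nB' (fun v Hv => Hm1normE Omega_open Omega_bdd Hv) mI (adm_L2Hm1 adm).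
have sub1 : I `\` (M1 `|` M2) `<=` I `\` M1.
  by move=> t [Tt nM]; split => // M1t; apply: nM; left.
have sub2 : I `\` (M1 `|` M2) `<=` I `\` M2.
  by move=> t [Tt nM]; split => // M2t; apply: nM; right.
have mM : measurable (M1 `|` M2) by exact: measurableU.
have mE : measurable (I `\` (M1 `|` M2)) by exact: measurableD.
exists (M1 `|` M2), s, xs; split.
- exact: mM.
- exact: null_set_setU.
- by have [sS wS sc] := sw; split => // t /sub1; [exact: wS|exact: sc].
- exact: (integrableS (measurableD mI mM1) mE sub1 sI).
- split; last exact: (integrableS (measurableD mI mM2) mE sub2 xI).
  by have [sS wS sc] := xw; split => // t /sub2; [exact: wS|exact: sc].
Qed.

(** Composition with this projection onto [0, T] extends a curve constantly beyond the interval;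
    [adm_cont] gives continuity on [0, T] only, whereas [energy_inequality] asks for functions
    continuous on the whole line. *)
Definition clamp (t : R) : R := Num.min T (Num.max 0 t).

Lemma clamp_in t : clamp t \in `[0, T].
Proof.
rewrite in_itv /= /clamp ge_min lexx andbT le_min (ltW T0) /= le_max lexx //.
Qed.

Lemma clamp_id t : `]0, T[%classic t -> clamp t = t.
Proof.
rewrite /= in_itv /= => /andP[t0 tT]; rewrite /clamp max_r ?ltW// min_r// ltW//.
Qed.

Lemma clamp_continuous : continuous clamp.
Proof.
move=> t; apply: continuous_min; first exact: cvg_cst.
by apply: continuous_max; [exact: cvg_cst|exact: cvg_id].
Qed.

Lemma adm_L2 t : L2 mu Omega (w (clamp t)).
Proof. by have [] := adm_cont adm (clamp_in t). Qed.

Lemma adm_clamp_cvg t :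
  Num.sqrt (form (fun x => w (clamp s) x - w (clamp t) x) (fun x => w (clamp s) x - w (clamp t) x))
    @[s --> t] --> 0.
Proof.
have [_ c] := adm_cont adm (clamp_in t).
(* As [clamp] takes all its values in [0, T], its ordinary continuity is already continuity for the
   restricted filter. *)
have cc : clamp s @[s --> t] --> within `[0, T] (nbhs (clamp t)).
  move=> A hA.
  have h : \forall s \near t, `[0, T]%classic (clamp s) -> A (clamp s).
    exact: (@clamp_continuous t _ hA).
  change (\forall s \near t, A (clamp s)).
  by apply: filterS h => s; apply; rewrite /= clamp_in.
have := cvg_comp _ _ cc c; rewrite /comp.
have LE s : L2norm mu Omega (w (clamp s) \- w (clamp t)) =
  (Num.sqrt (form (fun x => w (clamp s) x - w (clamp t) x) (fun x => w (clamp s) x - w (clamp t) x)))%:E.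
  by rewrite -L2norm_form//; apply: L2B => //; exact: adm_L2.
by under eq_fun do rewrite LE; move=> /fine_cvg.
Qed.

End one_curve.

Lemma L2form_norm_lin (a : R) f g : L2 mu Omega f -> L2 mu Omega g ->
  Num.sqrt (form (fun x => a * f x + g x) (fun x => a * f x + g x)) <=
  `|a| * Num.sqrt (form f f) + Num.sqrt (form g g).
Proof.
move=> Lf Lg.
apply: (@form_norm_lin R (Rn -> R^o) [set f | L2 mu Omega f] form) => //.
- by move=> b w w'; exact: L2_lin.
- exact: L2formC.
- by move=> b v w z; exact: L2form_lin.
- exact: L2form_ge0.
Qed.

Lemma L2formB f g h : L2 mu Omega f -> L2 mu Omega g -> L2 mu Omega h ->
  form (fun x => f x - g x) h = form f h - form g h.
Proof.
move=> Lf Lg Lh; rewrite (_ : (fun x => f x - g x) = (fun x => (-1) * g x + f x)).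
  by rewrite L2form_lin// mulN1r addrC.
by apply/funext => x; rewrite mulN1r addrC.
Qed.

Lemma L2form_sqrB f g : L2 mu Omega f -> L2 mu Omega g ->
  form (fun x => f x - g x) (fun x => f x - g x) = form f f - 2 * form f g + form g g.
Proof.
move=> Lf Lg; have Lfg := L2B mO Lf Lg.
rewrite L2formB// [form f _]L2formC [form g _]L2formC !L2formB// (L2formC _ _ g f); ring.
Qed.

Section L2_curve.
Variable d : R -> Rn -> R.
Hypothesis Ld : forall t, L2 mu Omega (d t).
Hypothesis d_cvg : forall t,
  Num.sqrt (form (fun x => d s x - d t x) (fun x => d s x - d t x)) @[s --> t] --> 0.

Lemma L2_curve_form_continuous z : L2 mu Omega z -> continuous (fun t => form (d t) z).
Proof.
move=> Lz t; apply/cvgrPdist_le => /= e e0.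
have c : Num.sqrt (form (fun x => d s x - d t x) (fun x => d s x - d t x)) * Num.sqrt (form z z)
    @[s --> t] --> 0.
  by rewrite -[X in _ --> X](mul0r (Num.sqrt (form z z))); apply: cvgM; [exact: d_cvg|exact: cvg_cst].
have /cvgrPdist_le/(_ e e0) := c; apply: filterS => s.
rewrite sub0r normrN => h; rewrite distrC -L2formB//.
apply: le_trans (le_trans (ler_norm _) h).
by apply: L2form_CS => //; exact: L2B.
Qed.

(** Expand ||d s||^2 = ||d s - d t||^2 + 2 (d s, d t) - ||d t||^2: the first term tends to 0 and the
    second is continuous by the previous lemma. *)
Lemma L2_curve_sqr_continuous : continuous (fun t => form (d t) (d t)).
Proof.
move=> t; have cz := L2_curve_form_continuous (Ld t).
have c1 : 2 * form (d s) (d t) - form (d t) (d t) @[s --> t] --> form (d t) (d t).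
  rewrite -[X in _ --> X](_ : 2 * form (d t) (d t) - form (d t) (d t) = _); last by ring.
  by apply: cvgB; [apply: cvgM; [exact: cvg_cst|exact: cz]|exact: cvg_cst].
have c2 : Num.sqrt (form (fun x => d s x - d t x) (fun x => d s x - d t x)) ^+ 2 @[s --> t] --> 0.
  by rewrite -[X in _ --> X](mulr0 0); under eq_fun do rewrite expr2; apply: cvgM; exact: d_cvg.
rewrite /continuous_at -[X in _ --> X]add0r.
under eq_fun => s.
  rewrite (_ : form (d s) (d s) = Num.sqrt (form (fun x => d s x - d t x) (fun x => d s x - d t x)) ^+ 2
     + (2 * form (d s) (d t) - form (d t) (d t))); last first.
    by rewrite sqr_sqrtr ?L2form_ge0// L2form_sqrB//; ring.
  over.
exact: cvgD.
Qed.

End L2_curve.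

Section pairing_integrable.
Variables (E : set (measurableTypeR R)).
Hypothesis mE : measurable E.
Hypothesis E_fin : (leb E < +oo)%E.

Lemma pairing_integrable xs (x : R -> (Rn -> R) -> R^o) s (w : R -> V) :
  seminorm_limit Hm1S Nm1 E xs x -> seminorm_limit H10S N1 E s w ->
  leb.-integrable E (EFin \o (fun t => Nm1 (x t) ^+ 2)) ->
  leb.-integrable E (EFin \o (fun t => N1 (w t) ^+ 2)) ->
  leb.-integrable E (EFin \o (fun t => x t (w t).1)).
Proof.
move=> lx lw Ix Iw; have [_ xS _] := lx; have [_ wS _] := lw.
apply: le_integrable (integrableD_EFin mE Ix Iw) => //.
  by apply/measurable_EFinP; exact: (pairing_measurable mE lx lw).
move=> t Et /=; rewrite lee_fin [leRHS]ger0_norm ?addr_ge0 ?sqr_ge0//.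
rewrite (le_trans (Hm1_bound Omega_open Omega_bdd (xS t Et) (wS t Et)))//.
move: (Nm1 _) (N1 _) => a b; have := sqr_ge0 (a - b); have := sqr_ge0 (a + b).
by rewrite !expr2; lra.
Qed.

Lemma pairing_cst_integrable xs (x : R -> (Rn -> R) -> R^o) (p : V) :
  seminorm_limit Hm1S Nm1 E xs x -> H10S p ->
  leb.-integrable E (EFin \o (fun t => Nm1 (x t) ^+ 2)) ->
  leb.-integrable E (EFin \o (fun t => x t p.1)).
Proof.
move=> lx Hp Ix; apply: (pairing_integrable (w := fun=> p) (s := fun _ _ => p)) lx _ Ix _.
- split => // [k|t _]; last by rewrite subrr H1n0'; exact: cvg_cst.
  exists 1%N, (fun=> setT), (fun=> p); split => //.
  by apply/funext => t; rewrite big_ord1 indicT scale1r.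
- exact: integrable_cst_EFin.
Qed.

End pairing_integrable.

Section two_curves.
Variables (T : R) (phi : Rn -> R) (u u' : R -> Rn -> R) (Du Du' : R -> Rn -> Rn).
Variables ut ut' : R -> (Rn -> R) -> R.
Hypothesis T0 : 0 < T.
Hypothesis adm : admissible Omega T phi u Du ut.
Hypothesis adm' : admissible Omega T phi u' Du' ut'.
Local Notation c := (clamp T).
Let I : set (measurableTypeR R) := `]0, T[%classic.
Let d t : Rn -> R := fun x => u (c t) x - u' (c t) x.

Let Ld t : L2 mu Omega (d t).
Proof. by apply: L2B => //; [exact: (adm_L2 T0 adm)|exact: (adm_L2 T0 adm')]. Qed.

Let d_cvg t :
  Num.sqrt (form (fun x => d s x - d t x) (fun x => d s x - d t x)) @[s --> t] --> 0.
Proof.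
have c1 := adm_clamp_cvg T0 adm t; have c2 := adm_clamp_cvg T0 adm' t.
have {c1 c2} := @cvgD _ _ _ _ (nbhs_filter t) _ _ _ _ c1 c2; rewrite addr0 => c12.
apply/cvgrPdist_le => /= e e0; have /cvgrPdist_le/(_ e e0) := c12; apply: filterS => s.
rewrite sub0r normrN => h; rewrite sub0r normrN ger0_norm ?sqrtr_ge0//.
apply: le_trans (le_trans (ler_norm _) h).
pose f x := u (c s) x - u (c t) x; pose g x := u' (c s) x - u' (c t) x.
have Lf : L2 mu Omega f by apply: L2B => //; exact: (adm_L2 T0 adm).
have Lg : L2 mu Omega g by apply: L2B => //; exact: (adm_L2 T0 adm').
have -> : (fun x => d s x - d t x) = (fun x => (-1) * g x + f x).
  by apply/funext => x; rewrite /d /f /g; ring.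
apply: le_trans (L2form_norm_lin (-1) Lg Lf) _.
by rewrite normrN normr1 mul1r addrC.
Qed.

(* The Lions-Magenes inequality for [u - u']. *)
Lemma energy_difference :
  (form (d T) (d T) - form (d 0) (d 0)) / 2 <=
  - (\int[leb]_(t in `]0, T[) ut t (u' t \- u t) +
     \int[leb]_(t in `]0, T[) ut' t (u t \- u' t)).
Proof.
have [M [s [xs [mM M0 lu Iu [lx Ix]]]]] := admissible_limits adm.
have [M' [s' [xs' [mM' M0' lu' Iu' [lx' Ix']]]]] := admissible_limits adm'.
have mI : measurable I by exact: measurable_itv.
pose E := I `\` (M `|` M').
have mMM : measurable (M `|` M') by exact: measurableU.
have mE : measurable E by exact: measurableD.
have EI : E `<=` I by exact: subDsetl.
have MM0 : leb (M `|` M') = 0%E by exact: null_set_setU.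
(* It holds for arbitrary [f], hence also for the pairings in the statement and in [weak_dt], whose
   measurability is known only on [E]. *)
have intE (f : R -> R) : \int[leb]_(t in I) f t = \int[leb]_(t in E) f t.
  exact: Rintegral_setD_null.
have Efin : (leb E < +oo)%E.
  apply: le_lt_trans (lebesgue_measure_itv_lty false true 0 T).
  by apply: le_measure => //; rewrite inE.
have subM : E `<=` I `\` M by move=> t [It nM]; split => // Mt; apply: nM; left.
have subM' : E `<=` I `\` M' by move=> t [It nM]; split => // Mt; apply: nM; right.
have {}Iu := integrableS (measurableD mI mM) mE subM Iu.
have {}Ix := integrableS (measurableD mI mM) mE subM Ix.
have {}Iu' := integrableS (measurableD mI mM') mE subM' Iu'.
have {}Ix' := integrableS (measurableD mI mM') mE subM' Ix'.
have {}lu : seminorm_limit H10S N1 E s (fun t => (u t, Du t)).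
  by have [sS wS sc] := lu; split => // t /subM; [exact: wS|exact: sc].
have {}lu' : seminorm_limit H10S N1 E s' (fun t => (u' t, Du' t)).
  by have [sS wS sc] := lu'; split => // t /subM'; [exact: wS|exact: sc].
have {}lx : seminorm_limit Hm1S Nm1 E xs ut.
  by have [sS wS sc] := lx; split => // t /subM; [exact: wS|exact: sc].
have {}lx' : seminorm_limit Hm1S Nm1 E xs' ut'.
  by have [sS wS sc] := lx'; split => // t /subM'; [exact: wS|exact: sc].
pose e t : V := (u t, Du t) - (u' t, Du' t).
pose x t : (Rn -> R) -> R^o := (ut t : (Rn -> R) -> R^o) - (ut' t : (Rn -> R) -> R^o).
have le : seminorm_limit H10S N1 E (fun k t => s k t - s' k t) e.
  exact: (seminorm_limitB H10_0' H10_lin' H1n_ge0' H1nB' lu lu').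
(* The pairing of [ut] is with u' - u, so the opposite difference is needed as a limit too, to make
   that integral finite. *)
have le' : seminorm_limit H10S N1 E (fun k t => s' k t - s k t) (fun t => (u' t, Du' t) - (u t, Du t)).
  exact: (seminorm_limitB H10_0' H10_lin' H1n_ge0' H1nB' lu' lu).
have lxx : seminorm_limit Hm1S Nm1 E (fun k t => xs k t - xs' k t) x.
  exact: (seminorm_limitB Hm1set0' Hm1_lin' Hm1n_ge0' Hm1nB' lx lx').
have [_ uS _] := lu; have [_ uS' _] := lu'; have [_ xS _] := lx; have [_ xS' _] := lx'.
have sqr_sum (a b r : R) : 0 <= r -> r <= a + b -> r ^+ 2 <= 2 * a ^+ 2 + 2 * b ^+ 2.
  move=> r0 rab; apply: (@le_trans _ _ ((a + b) ^+ 2)).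
    by rewrite lerXn2r ?nnegrE// (le_trans r0).
  by have := sqr_ge0 (a - b); rewrite !expr2; lra.
have Ie : leb.-integrable E (EFin \o (fun t => N1 (e t) ^+ 2)).
  apply: le_integrable (integrableD_EFin mE (integrableZ_EFin mE 2 Iu) (integrableZ_EFin mE 2 Iu')) => //.
    by apply/measurable_EFinP/measurable_funX; exact: (seminorm_limit_measurable H10_0' H10_lin' H1n_ge0' H1n0' H1nB' le).
  move=> t Et /=; rewrite lee_fin !ger0_norm ?addr_ge0 ?mulr_ge0 ?sqr_ge0//.
  by apply: sqr_sum => //; apply: H1nB'; [exact: uS|exact: uS'].
have Ie' : leb.-integrable E (EFin \o (fun t => N1 ((u' t, Du' t) - (u t, Du t)) ^+ 2)).
  apply: le_integrable (integrableD_EFin mE (integrableZ_EFin mE 2 Iu') (integrableZ_EFin mE 2 Iu)) => //.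
    by apply/measurable_EFinP/measurable_funX; exact: (seminorm_limit_measurable H10_0' H10_lin' H1n_ge0' H1n0' H1nB' le').
  move=> t Et /=; rewrite lee_fin !ger0_norm ?addr_ge0 ?mulr_ge0 ?sqr_ge0//.
  by apply: sqr_sum => //; apply: H1nB'; [exact: uS'|exact: uS].
have Ixx : leb.-integrable E (EFin \o (fun t => Nm1 (x t) ^+ 2)).
  apply: le_integrable (integrableD_EFin mE (integrableZ_EFin mE 2 Ix) (integrableZ_EFin mE 2 Ix')) => //.
    by apply/measurable_EFinP/measurable_funX; exact: (seminorm_limit_measurable Hm1set0' Hm1_lin' Hm1n_ge0' Hm1n0' Hm1nB' lxx).
  move=> t Et /=; rewrite lee_fin !ger0_norm ?addr_ge0 ?mulr_ge0 ?sqr_ge0//.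
  by apply: sqr_sum => //; apply: Hm1nB'; [exact: xS|exact: xS'].
(* Off [E] nothing guarantees that [x t] is a bounded functional; extending it by 0 there gives
   linearity, the bound by [nu] and integrability at every time. *)
pose xi t (p : V) : R := \1_E t * x t p.1.
pose nu t : R := \1_E t * Nm1 (x t).
have [_ eS _] := le; have [_ xxS _] := lxx.
have xiE t p : E t -> xi t p = x t p.1 by move=> Et; rewrite /xi indicE mem_set// mul1r.
have xi0 t p : ~ E t -> xi t p = 0 by move=> Et; rewrite /xi indicE memNset// mul0r.
have nuE t : E t -> nu t = Nm1 (x t) by move=> Et; rewrite /nu indicE mem_set// mul1r.
have nu0 t : ~ E t -> nu t = 0 by move=> Et; rewrite /nu indicE memNset// mul0r.
have cform z : L2 mu Omega z -> continuous (fun t => form (u (c t)) z).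
  apply: (L2_curve_form_continuous (d := fun t => u (c t))).
  - by move=> t; exact: (adm_L2 T0 adm).
  - by move=> t; exact: (adm_clamp_cvg T0 adm).
have cform' z : L2 mu Omega z -> continuous (fun t => form (u' (c t)) z).
  apply: (L2_curve_form_continuous (d := fun t => u' (c t))).
  - by move=> t; exact: (adm_L2 T0 adm').
  - by move=> t; exact: (adm_clamp_cvg T0 adm').
have key : (form (d T) (d T) - form (d 0) (d 0)) / 2 <= \int[leb]_(t in E) xi t (e t).
  apply: (@energy_inequality R V T H10S N1 (fun z t => form (d t) z.1)
    (fun t => form (d t) (d t)) e xi nu E) => //.
  - apply: (subset_measure0 _ _ _ MM0) => //; first exact: measurableD.
    by move=> t [It]; apply: contra_notP => nM.
  - move=> t a p q Hp Hq; rewrite /xi.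
    have [Et|Et] := pselect (E t); last by rewrite indicE memNset// !mul0r mulr0 addr0.
    by rewrite indicE mem_set// !mul1r (Hm1_linear a (xxS t Et) Hp Hq).
  - exact: L2_curve_sqr_continuous.
  - move=> z Hz; apply: L2_curve_form_continuous => //.
    exact: (H10_L2pair Hz).1.
  (* The polarisation inequality is the nonnegativity of ||d r - d t||^2, expanded. *)
  - move=> r t Et.
    have -> : (e t).1 = d t by rewrite /d (clamp_id (EI _ Et)).
    have := L2form_ge0 mu Omega (fun y => d r y - d t y); rewrite L2form_sqrB//.
    by lra.
  - move=> z Hz eta eta_test; have Lz := (H10_L2pair Hz).1; have [sm _] := eta_test.
    have ce : continuous eta := Ck_continuous (sm 0%N).
    have ce' : continuous (derive1 eta).
      have [_ /(_ 1)[_ [ce' _]]] := sm 1%N.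
      by rewrite (_ : derive1 eta = 'D_1 eta)//; apply/funext => t; rewrite derive1E.
    have ie' h : continuous h -> leb.-integrable I (EFin \o (fun t => derive1 eta t * h t)).
      move=> ch; apply: continuous_integrable_itvoo => t.
      by apply: cvgM; [exact: ce'|exact: ch].
    have [C _ eta_le] := continuous_bounded_itv 0 T ce.
    have ie h : leb.-integrable E (EFin \o h) -> leb.-integrable E (EFin \o (fun t => eta t * h t)).
      move=> ih; apply: le_integrable (integrableZ_EFin mE C (integrable_norm ih)) => //.
        apply/measurable_EFinP/measurable_funM; last by apply/measurable_EFinP; exact: measurable_int ih.
        by apply: measurable_funTS; exact: continuous_measurable_fun.
      move=> t Et /=; rewrite lee_fin !normrM normr_id ler_wpM2r//.
      have /andP[t0 tT] : 0 < t < T by have := EI _ Et; rewrite /I /= in_itv.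
      by apply: le_trans (ler_norm _); rewrite eta_le// (ltW t0) (ltW tT).
    have wu (v : R -> Rn -> R) Dv vt : admissible Omega T phi v Dv vt ->
        \int[leb]_(t in I) (derive1 eta t * form (v (c t)) z.1) =
        - \int[leb]_(t in E) (eta t * vt t z.1).
      move=> av; rewrite -intE -(adm_dt av eta_test Hz).
      by apply: eq_Rintegral => t; rewrite inE => It; rewrite clamp_id.
    transitivity (\int[leb]_(t in I) (derive1 eta t * form (u (c t)) z.1) -
        \int[leb]_(t in I) (derive1 eta t * form (u' (c t)) z.1)).
      rewrite -RintegralB//; [|by apply: ie'; exact: cform|by apply: ie'; exact: cform'].
      apply: eq_Rintegral => t _; rewrite /d L2formB//.
      + by rewrite mulrBr.
      + exact: (adm_L2 T0 adm).
      + exact: (adm_L2 T0 adm').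
    rewrite (wu _ _ _ adm) (wu _ _ _ adm') -opprD -RintegralB//; first last.
    + by apply: ie; exact: (pairing_cst_integrable mE Efin lx' Hz Ix').
    + by apply: ie; exact: (pairing_cst_integrable mE Efin lx Hz Ix).
    rewrite intE; congr (- _); apply: eq_Rintegral => t; rewrite inE => Et.
    by rewrite xiE// -mulrBr.
  - by move=> t It; apply: nu0 => /EI.
  - have : leb.-integrable setT ((EFin \o (fun t => Nm1 (x t) ^+ 2)) \_ E).
      by rewrite -integrable_mkcond.
    apply: eq_integrable => // t _; rewrite /= patchE.
    have [Et|Et] := pselect (E t); first by rewrite mem_set// nuE.
    by rewrite memNset// nu0// expr0n.
  - move=> t z Hz; have [Et|Et] := pselect (E t); last by rewrite xi0// nu0// mul0r normr0.
    by rewrite xiE// nuE//; exact: (Hm1_bound Omega_open Omega_bdd (xxS t Et) Hz).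
  - move=> z Hz; have := pairing_cst_measurable mE lxx Hz.
    move=> /(measurable_restrictT _ mE); apply: eq_measurable_fun => t _; rewrite patchE.
    have [Et|Et] := pselect (E t); first by rewrite mem_set// xiE.
    by rewrite memNset// xi0.
  - apply: (eq_measurable_fun (fun t => x t (e t).1)); last exact: (pairing_measurable mE lxx le).
    by move=> t; rewrite inE => Et; rewrite xiE.
  - exact: (seminorm_limit_approx H10_0' H10_lin' H1n_ge0' H1n0' H1nB' mE le Ie).
apply: le_trans key _.
have IA : leb.-integrable E (EFin \o (fun t => ut t (u' t \- u t))).
  exact: (pairing_integrable mE lx le' Ix Ie').
have IA' : leb.-integrable E (EFin \o (fun t => ut' t (u t \- u' t))).
  exact: (pairing_integrable mE lx' le Ix' Ie).
rewrite !intE -RintegralD// -[X in _ <= X]mulN1r -RintegralZl//; last exact: integrableD_EFin.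
rewrite le_eqVlt; apply/orP; left; apply/eqP; apply: eq_Rintegral => t; rewrite inE => Et.
rewrite xiE//.
(* With these expansions the claim is the pointwise identity <ut - ut', u - u'> = - (<ut, u' - u> +
   <ut', u - u'>). *)
have h1 : ut t (u' t \- u t) = ut t (u' t) - ut t (u t).
  exact: (Hm1B (xS t Et) (uS' t Et) (uS t Et)).
have h2 : ut' t (u t \- u' t) = ut' t (u t) - ut' t (u' t).
  exact: (Hm1B (xS' t Et) (uS t Et) (uS' t Et)).
have h3 : x t (e t).1 = x t (u t) - x t (u' t).
  exact: (Hm1B (xxS t Et) (uS t Et) (uS' t Et)).
rewrite h1 h2 h3 /x !fctE; ring.
Qed.

End two_curves.

End admissible_theory.

(** * Stability of the obstacle problem *)

Section cylinder.
Context (R : realType) (n : nat).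
Local Notation Rn := 'rV[R]_n.
Local Notation leb := (@lebesgue_measure R).
Local Notation mu := (lebesgue_rV R n).
Local Notation muQ := (lebesgue_rV R n \x lebesgue_measure)%E.
Variables (Omega : set Rn) (T : R).
Hypothesis Omega_open : open Omega.
Hypothesis Omega_bdd : bounded_set Omega.
Local Notation Q := (cyl Omega T).
Let I : set (measurableTypeR R) := `]0, T[%classic.
Let mO : measurable Omega := mOmega Omega_open.
Let mI : measurable I. Proof. exact: measurable_itv. Qed.

Lemma measurable_cyl : measurable Q.
Proof. exact: measurableX. Qed.

Let mQ := measurable_cyl.

Lemma tonelli_cyl (h : Rn * measurableTypeR R -> R) : measurable_fun Q h ->
  (forall p, 0 <= h p) ->
  (\int[muQ]_(p in Q) (h p)%:E = \int[leb]_(t in I) \int[mu]_(x in Omega) (h (x, t))%:E)%E.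
Proof.
move=> mh h0.
apply: (@tonelli _ _ _ _ _ _ _ (@lebesgue_rV_sigma_finite R n) _ _ mO mI (EFin \o h)).
  exact/measurable_EFinP.
by move=> p _; rewrite lee_fin.
Qed.

Lemma tonelli_cyl_measurable (h : Rn * measurableTypeR R -> R) : measurable_fun Q h ->
  (forall p, 0 <= h p) ->
  measurable_fun I (fun t => \int[mu]_(x in Omega) (h (x, t))%:E)%E.
Proof.
move=> mh h0.
apply: (@tonelli_measurable _ _ _ _ _ _ (@lebesgue_rV_sigma_finite R n) _ _ mO mI (EFin \o h)).
  exact/measurable_EFinP.
by move=> p _; rewrite lee_fin.
Qed.

Section admissible_cyl.
Variables (phi : Rn -> R) (w : R -> Rn -> R) (Dw : R -> Rn -> Rn).
Variable wt : R -> (Rn -> R) -> R.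
Hypothesis adm : admissible Omega T phi w Dw wt.

Let H1density p : R := onQ w p ^+ 2 + enorm (onQ Dw p) ^+ 2.

Let H1density_meas : measurable_fun Q H1density.
Proof.
apply: measurable_funD; first by apply: measurable_funX; exact: (adm_meas adm).
under eq_fun do rewrite sqr_enorm.
by apply: measurable_sum => i; apply: measurable_funX; exact: (adm_meas_grad adm).
Qed.

Let H1density_ge0 p : 0 <= H1density p. Proof. by rewrite addr_ge0 ?sqr_ge0. Qed.

(** By Tonelli this integral is the time integral of the squared H^1 norm, finite by [adm_L2H10].
    The density dominates the squares of the function and of each entry of its gradient. *)
Let H1density_int : muQ.-integrable Q (EFin \o H1density).
Proof.
apply/integrableP; split; first exact/measurable_EFinP.
under eq_integral do rewrite /= ger0_norm//.
rewrite tonelli_cyl//; have [_ _] := adm_L2H10 adm; apply: le_lt_trans.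
rewrite le_eqVlt; apply/orP; left; apply/eqP; apply: eq_integral => t _.
rewrite /H1norm sqr_L2norm; apply: eq_integral => x _ /=.
by rewrite sqr_sqrtr// addr_ge0 ?sqr_ge0.
Qed.

Lemma adm_L2Q : L2 muQ Q (onQ w).
Proof.
apply: sqr_integrable_L2 => //; first exact: (adm_meas adm).
apply: le_integrable H1density_int => //.
  by apply/measurable_EFinP/measurable_funX; exact: (adm_meas adm).
by move=> p _; rewrite /= lee_fin !ger0_norm ?sqr_ge0// lerDl sqr_ge0.
Qed.

Lemma adm_grad_L2Q i : L2 muQ Q (fun p => onQ Dw p ord0 i).
Proof.
apply: sqr_integrable_L2 => //; first exact: (adm_meas_grad adm).
apply: le_integrable H1density_int => //.
  by apply/measurable_EFinP/measurable_funX; exact: (adm_meas_grad adm).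
move=> p _; rewrite /= lee_fin !ger0_norm ?sqr_ge0// /H1density sqr_enorm.
by rewrite (bigD1 i)//= addrCA lerDl addr_ge0 ?sqr_ge0// sumr_ge0// => j _; exact: sqr_ge0.
Qed.

End admissible_cyl.

Lemma friedrichs_sqr (C : R) w G : friedrichs_constant Omega C -> H10 Omega w G ->
  (\int[mu]_(x in Omega) (w x ^+ 2)%:E <=
   \int[mu]_(x in Omega) (C ^+ 2 * enorm (G x) ^+ 2)%:E)%E.
Proof.
move=> CF H; have [Lw LG] := H10_L2pair (p := (w, G)) H.
have {}LG := enorm_L2 Omega_open LG; have := CF _ _ H.
rewrite -(sqr_L2norm mu Omega w) (sqr_L2normE mO Lw) (L2normE mO Lw) (L2normE mO LG).
rewrite -EFinM lee_fin => h.
have iG := integrableZ_EFin mO (C ^+ 2) (L2_integrable_sqr LG).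
rewrite (_ : integral _ _ _ =
    (\int[mu]_(x in Omega) (C ^+ 2 * enorm (G x) ^+ 2))%:E); last first.
  by rewrite fineK//; exact: integrable_fin_num.
rewrite lee_fin RintegralZl//; last exact: L2_integrable_sqr.
have ge0 (v : Rn -> R) : 0 <= \int[mu]_(x in Omega) (v x ^+ 2).
  by apply: Rintegral_ge0 => x _; exact: sqr_ge0.
rewrite -(sqr_sqrtr (ge0 w)) -(sqr_sqrtr (ge0 (fun x => enorm (G x)))) -exprMn.
by rewrite lerXn2r ?nnegrE ?sqrtr_ge0// (le_trans _ h)// sqrtr_ge0.
Qed.

Section difference.
Variables (phi : Rn -> R) (u u' : R -> Rn -> R) (Du Du' : R -> Rn -> Rn).
Variables ut ut' : R -> (Rn -> R) -> R.
Hypothesis adm : admissible Omega T phi u Du ut.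
Hypothesis adm' : admissible Omega T phi u' Du' ut'.
Let e p := onQ u p - onQ u' p.
Let De p : Rn := onQ Du p - onQ Du' p.

Lemma difference_L2Q : L2 muQ Q e.
Proof. by apply: L2B => //; [exact: (adm_L2Q adm)|exact: (adm_L2Q adm')]. Qed.

Lemma difference_grad_L2Q i : L2 muQ Q (fun p => De p ord0 i).
Proof.
have := L2B mQ (adm_grad_L2Q adm i) (adm_grad_L2Q adm' i).
by congr L2; apply/funext => p; rewrite !mxE.
Qed.

Lemma difference_grad_integrable : muQ.-integrable Q (EFin \o (fun p => enorm (De p) ^+ 2)).
Proof.
under [X in _.-integrable _ X]eq_fun do rewrite /= sqr_enorm.
apply: (@integrable_sum_EFin _ _ _ _ _ _ _ _ (fun i p => De p ord0 i ^+ 2)) => // i.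
by apply: L2_integrable_sqr => //; exact: difference_grad_L2Q.
Qed.

Lemma friedrichs_cyl (C : R) : friedrichs_constant Omega C ->
  \int[muQ]_(p in Q) (e p ^+ 2) <= C ^+ 2 * \int[muQ]_(p in Q) (enorm (De p) ^+ 2).
Proof.
move=> CF; have iD := difference_grad_integrable.
have ie := L2_integrable_sqr difference_L2Q.
rewrite -RintegralZl// -lee_fin !fineK; try exact: integrable_fin_num.
  2: exact: integrable_fin_num (integrableZ_EFin mQ (C ^+ 2) iD).
have me : measurable_fun Q (fun p => e p ^+ 2) by apply: measurable_funX; exact: difference_L2Q.1.
have mD : measurable_fun Q (fun p => C ^+ 2 * enorm (De p) ^+ 2).
  by apply/measurable_EFinP; exact: measurable_int (integrableZ_EFin mQ (C ^+ 2) iD).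
have e0 p : 0 <= e p ^+ 2 by exact: sqr_ge0.
have D0 p : 0 <= C ^+ 2 * enorm (De p) ^+ 2 by rewrite mulr_ge0 ?sqr_ge0.
rewrite !tonelli_cyl//.
have [/ae_measurable_null[M [mM M0 HM]] _ _] := adm_L2H10 adm.
have [/ae_measurable_null[M' [mM' M0' HM']] _ _] := adm_L2H10 adm'.
have mN : measurable (M `|` M') by exact: measurableU.
have N0 : leb (M `|` M') = 0%E by exact: null_set_setU.
rewrite (integral_setD_null I _ mN N0) [leRHS](integral_setD_null I _ mN N0).
apply: ge0_le_integral.
- exact: measurableD.
- by move=> t _; apply: integral_ge0 => x _; rewrite lee_fin.
- by apply: measurable_funS (tonelli_cyl_measurable me e0) => //; exact: subDsetl.
- by apply: measurable_funS (tonelli_cyl_measurable mD D0) => //; exact: subDsetl.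
move=> t [It /not_orP[nM nM']].
apply: (friedrichs_sqr (w := fun x => e (x, t)) (G := fun x => De (x, t)) CF).
exact: (subspaceB (H10_lin Omega_open Omega_bdd) (HM t nM It) (HM' t nM' It)).
Qed.

End difference.

End cylinder.

Section contact.
Context (R : realType) (n : nat).
Local Notation Rn := 'rV[R]_n.
Local Notation muQ := (lebesgue_rV R n \x lebesgue_measure)%E.
Variables (Omega : set Rn) (T : R).
Hypothesis Omega_open : open Omega.
Local Notation Q := (cyl Omega T).
Variables (phi : Rn -> R) (v : R -> Rn -> R) (h : Rn * measurableTypeR R -> R).
Let g := contact_data phi v h.

Lemma contact_data_le p : `|g p| <= `|h p|.
Proof.
rewrite /g /contact_data; case: ifP => // _.
by have [h0|h0] := leP 0 (h p); rewrite ?normr0.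
Qed.

Lemma contact_data_L2 : measurable_fun Omega phi -> measurable_fun Q (onQ v) ->
  L2 muQ Q h -> L2 muQ Q g.
Proof.
move=> mphi mv Lh; have mQ := measurable_cyl T Omega_open.
apply: (le_L2 mQ) (Lh) _ => [|p _]; last exact: contact_data_le.
have mphiQ : measurable_fun Q (fun p => phi p.1).
  apply: (measurable_comp (F := Omega)) => //.
  - exact: mOmega.
  - by move=> _ [p [Op _] <-].
  - by apply: measurable_funTS; exact: measurable_fst.
rewrite /g /contact_data; apply: measurable_fun_if => //.
- exact: measurable_fun_ltr.
- by apply: measurable_funS Lh.1 => //; exact: subIsetl.
- have : measurable_fun Q (cst 0 \max h) by apply: measurable_maxr => //; exact: Lh.1.
  by apply: measurable_funS => //; exact: subIsetl.
Qed.

(* On the contact set [w] lies above [v], so replacing a negative [h] by [0] increases [h (w - v)]. *)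
Lemma contact_data_mul_le (w : R -> Rn -> R) p : phi p.1 <= onQ w p -> phi p.1 <= onQ v p ->
  h p * (onQ w p - onQ v p) <= g p * (onQ w p - onQ v p).
Proof.
move=> pw pv; rewrite /g /contact_data; case: ltP => // vp.
by rewrite ler_wpM2r ?le_max ?lexx ?orbT// subr_ge0 (le_trans vp).
Qed.

End contact.

Section stability.
Context (R : realType) (n : nat).
Local Notation Rn := 'rV[R]_n.
Local Notation leb := (@lebesgue_measure R).
Local Notation mu := (lebesgue_rV R n).
Local Notation muQ := (lebesgue_rV R n \x lebesgue_measure)%E.
Variables (Omega : set Rn) (T : R).
Hypothesis Omega_open : open Omega.
Hypothesis Omega_bdd : bounded_set Omega.
Hypothesis T0 : 0 < T.
Local Notation Q := (cyl Omega T).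
Variables (phi : Rn -> R) (f f' : Rn * measurableTypeR R -> R) (u0 u0' : Rn -> R).
Hypothesis phi_meas : measurable_fun Omega phi.
Hypothesis Lf : L2 muQ Q f.
Hypothesis Lf' : L2 muQ Q f'.
Variables (u u' : R -> Rn -> R) (Du Du' : R -> Rn -> Rn) (ut ut' : R -> (Rn -> R) -> R).
Hypothesis u_sol : obstacle_solution Omega T phi f u0 u Du ut.
Hypothesis u_sol' : obstacle_solution Omega T phi f' u0' u' Du' ut'.
Let g := contact_data phi u' (f \- f').
Let e p := onQ u p - onQ u' p.
Let De p : Rn := onQ Du p - onQ Du' p.
Let mQ : measurable Q := measurable_cyl T Omega_open.
Let adm : admissible Omega T phi u Du ut. Proof. by case: u_sol. Qed.
Let adm' : admissible Omega T phi u' Du' ut'. Proof. by case: u_sol'. Qed.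
Let Le : L2 muQ Q e. Proof. exact: (difference_L2Q Omega_open adm adm'). Qed.

Lemma contact_L2 : L2 muQ Q g.
Proof.
apply: contact_data_L2 => //; first exact: (adm_meas adm').
exact: L2B.
Qed.

Lemma contact_mul_le :
  \int[muQ]_(p in Q) ((f p - f' p) * e p) <= \int[muQ]_(p in Q) (g p * e p).
Proof.
have [M [mM M0 HM]] := ae_measurable_null (adm_obstacle adm).
have [M' [mM' M0' HM']] := ae_measurable_null (adm_obstacle adm').
have mN : measurable (M `|` M') by exact: measurableU.
have N0 : muQ (M `|` M') = 0%E by exact: null_set_setU.
rewrite (Rintegral_setD_null Q _ mN N0) [leRHS](Rintegral_setD_null Q _ mN N0).
have mE : measurable (Q `\` (M `|` M')) by exact: measurableD.
have sE : Q `\` (M `|` M') `<=` Q by exact: subDsetl.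
apply: le_Rintegral => //.
- by apply: integrableS sE _ => //; apply: L2_mul_integrable => //; exact: L2B.
- by apply: integrableS sE _ => //; apply: L2_mul_integrable => //; exact: contact_L2.
move=> p [Qp /not_orP[nM nM']].
by apply: (@contact_data_mul_le _ _ phi u' (f \- f')); [exact: HM|exact: HM'].
Qed.

Let dotrV_integrable (G G' : Rn * measurableTypeR R -> Rn) :
  (forall i, L2 muQ Q (fun p => G p ord0 i)) -> (forall i, L2 muQ Q (fun p => G' p ord0 i)) ->
  muQ.-integrable Q (EFin \o (fun p => dotrV (G p) (G' p))).
Proof.
move=> LG LG'.
apply: (@integrable_sum_EFin _ _ _ _ _ _ _ _ (fun i p => G p ord0 i * G' p ord0 i)) => // i.
exact: L2_mul_integrable.
Qed.

Lemma variational_difference :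
  \int[muQ]_(p in Q) (enorm (De p) ^+ 2) <=
  \int[leb]_(t in `]0, T[) ut t (u' t \- u t) + \int[leb]_(t in `]0, T[) ut' t (u t \- u' t) +
  \int[muQ]_(p in Q) ((f p - f' p) * e p).
Proof.
have [_ _ /(_ _ _ _ adm') var] := u_sol; have [_ _ /(_ _ _ _ adm) var'] := u_sol'.
have LD := adm_grad_L2Q Omega_open adm; have LD' := adm_grad_L2Q Omega_open adm'.
have Lu := adm_L2Q Omega_open adm; have Lu' := adm_L2Q Omega_open adm'.
have LB (G G' : Rn * measurableTypeR R -> Rn) :
    (forall i, L2 muQ Q (fun p => G p ord0 i)) -> (forall i, L2 muQ Q (fun p => G' p ord0 i)) ->
    forall i, L2 muQ Q (fun p => (G p - G' p) ord0 i).
  move=> LG LG' i; have := L2B mQ (LG i) (LG' i).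
  by congr L2; apply/funext => p; rewrite !mxE.
have ED : \int[muQ]_(p in Q) dotrV (onQ Du p) (onQ Du' p - onQ Du p) +
    \int[muQ]_(p in Q) dotrV (onQ Du' p) (onQ Du p - onQ Du' p) =
    - \int[muQ]_(p in Q) (enorm (De p) ^+ 2).
  rewrite -RintegralD//; [|by apply: dotrV_integrable => //; exact: LB..].
  rewrite -mulN1r -RintegralZl//; last exact: (difference_grad_integrable Omega_open adm adm').
  apply: eq_Rintegral => p _; rewrite sqr_enorm mulN1r -big_split/= -sumrN.
  by apply: eq_bigr => i _; rewrite !mxE; ring.
have EF : \int[muQ]_(p in Q) (f p * (onQ u' p - onQ u p)) +
    \int[muQ]_(p in Q) (f' p * (onQ u p - onQ u' p)) =
    - \int[muQ]_(p in Q) ((f p - f' p) * e p).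
  rewrite -RintegralD//; [|by apply: L2_mul_integrable => //; exact: L2B..].
  rewrite -mulN1r -RintegralZl//; last by apply: L2_mul_integrable => //; exact: L2B.
  by apply: eq_Rintegral => p _; rewrite /e; ring.
move: var var' ED EF.
move: (\int[muQ]_(p in Q) dotrV _ _) (\int[muQ]_(p in Q) dotrV _ _) => G1 G2.
move: (\int[muQ]_(p in Q) (f p * _)) (\int[muQ]_(p in Q) (f' p * _)) => F1 F2.
move: (\int[leb]_(t in _) _) (\int[leb]_(t in _) _) => A1 A2.
by move=> *; lra.
Qed.

Lemma young_friedrichs (C a : R) : 0 < C -> 0 < a -> friedrichs_constant Omega C ->
  2 * \int[muQ]_(p in Q) (g p * e p) <=
  a * C ^+ 2 * \int[muQ]_(p in Q) (g p ^+ 2) + a^-1 * \int[muQ]_(p in Q) (enorm (De p) ^+ 2).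
Proof.
move=> C0 a0 CF; have Lg := contact_L2.
have ig := L2_integrable_sqr Lg; have ie := L2_integrable_sqr Le.
have k0 : 0 < a * C ^+ 2 by rewrite mulr_gt0// exprn_gt0.
(* Young in the form 2 x y <= k x^2 + y^2 / k with k = a C^2: Friedrichs bounds the integral of e^2
   by C^2 times that of the squared gradient, which cancels the C^2 in 1 / k. *)
apply: (@le_trans _ _ (a * C ^+ 2 * \int[muQ]_(p in Q) (g p ^+ 2) +
    (a * C ^+ 2)^-1 * \int[muQ]_(p in Q) (e p ^+ 2))); last first.
  rewrite lerD2l invfM -mulrA ler_wpM2l ?invr_ge0 ?(ltW a0)//.
  by rewrite ler_pdivrMl ?exprn_gt0//; exact: (friedrichs_cyl Omega_open Omega_bdd adm adm' CF).
rewrite -!RintegralZl//; last exact: L2_mul_integrable.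
rewrite -RintegralD//; [|exact: integrableZ_EFin..].
apply: le_Rintegral => //.
- by apply: integrableZ_EFin => //; exact: L2_mul_integrable.
- by apply: integrableD_EFin => //; exact: integrableZ_EFin.
move=> p _; move: (g p) (e p) (a * C ^+ 2) k0 => x y k k0.
rewrite -subr_ge0 (_ : _ - _ = (k * x - y) ^+ 2 / k).
  by rewrite divr_ge0 ?sqr_ge0// ltW.
by field; rewrite gt_eqF.
Qed.

Lemma initial_difference :
  (L2norm mu Omega (u 0 \- u' 0)%R ^+ 2 = L2norm mu Omega (u0 \- u0')%R ^+ 2)%E.
Proof.
have [_ /ae_measurable_null[M [mM M0 HM]] _] := u_sol.
have [_ /ae_measurable_null[M' [mM' M0' HM']] _] := u_sol'.
have mN : measurable (M `|` M') by exact: measurableU.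
have N0 : mu (M `|` M') = 0%E by exact: null_set_setU.
rewrite !sqr_L2norm (integral_setD_null Omega _ mN N0) [RHS](integral_setD_null Omega _ mN N0).
apply: eq_integral => x; rewrite inE => -[Ox /not_orP[nM nM']] /=.
by rewrite HM// HM'.
Qed.

Lemma obstacle_stability (C a : R) : 0 < C -> friedrichs_constant Omega C -> 2^-1 <= a ->
  (L2norm mu Omega (u T \- u' T)%R ^+ 2 +
     (2 - a^-1)%:E * L2norm muQ Q (fun p => enorm (De p)) ^+ 2 <=
   L2norm mu Omega (u0 \- u0')%R ^+ 2 + (a * C ^+ 2)%:E * L2norm muQ Q g ^+ 2)%E.
Proof.
move=> C0 CF a_ge; have a0 : 0 < a by apply: lt_le_trans a_ge; rewrite invr_gt0.
have mO := mOmega Omega_open.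
have cT : clamp T T = T by rewrite /clamp max_r ?minxx// ltW.
have c0 : clamp T 0 = 0 by rewrite /clamp maxxx min_r// ltW.
have normE t : (L2norm mu Omega (u (clamp T t) \- u' (clamp T t))%R ^+ 2 =
    (L2form mu Omega (fun x => u (clamp T t) x - u' (clamp T t) x)
      (fun x => u (clamp T t) x - u' (clamp T t) x))%:E)%E.
  rewrite sqr_L2normE//.
    by apply: L2B => //; [exact: (adm_L2 T0 adm)|exact: (adm_L2 T0 adm')].
have := energy_difference Omega_open Omega_bdd T0 adm adm'.
have := normE 0; have := normE T; rewrite cT c0 => {normE} -> nE.
rewrite -initial_difference nE {nE}.
have -> : (L2norm muQ Q (fun p => enorm (De p)) ^+ 2 =
    (\int[muQ]_(p in Q) (enorm (De p) ^+ 2))%:E)%E.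
  rewrite sqr_L2norm fineK//; apply: integrable_fin_num => //.
  exact: (difference_grad_integrable Omega_open adm adm').
rewrite (sqr_L2normE mQ contact_L2) -!EFinM -!EFinD lee_fin.
have := young_friedrichs C0 a0 CF; have := contact_mul_le; have := variational_difference.
move: (L2form _ _ _ _) (L2form _ _ _ _) => E0 ET.
move: (\int[leb]_(t in _) _) (\int[leb]_(t in _) _) => A1 A2.
move: (\int[muQ]_(p in Q) (enorm _ ^+ 2)) (\int[muQ]_(p in Q) (g p ^+ 2)) => D G.
move: (\int[muQ]_(p in Q) (g p * _)) (\int[muQ]_(p in Q) (_ * e p)) => J F.
(* Twice the energy inequality plus twice the variational one cancels the time pairings and leaves 2
   D on the left; Young's inequality takes back a^-1 D. The products are made atoms so that the
   combination is linear. *)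
rewrite [(2 - a^-1) * D]mulrBl; move: (a^-1 * D) (a * C ^+ 2 * G) => X Y *.
lra.
Qed.

End stability.

Theorem mainTheorem2 (R : realType) (n : nat) (hn : (0 < n)%N)
    (Omega : set 'rV[R]_n) (T : R)
    (Omega_open : open Omega) (Omega_conn : connected Omega)
    (Omega_bdd : bounded_set Omega) (Omega_lip : lipschitz_boundary Omega)
    (T_gt0 : 0 < T)
    (phi : 'rV[R]_n -> R) (phi_H2 : H2 Omega phi)
    (phi_trace : trace_le0 Omega phi)
    (f f' : 'rV[R]_n * measurableTypeR R -> R)
    (f_L2 : L2 (lebesgue_rV R n \x lebesgue_measure)%E (cyl Omega T) f)
    (f'_L2 : L2 (lebesgue_rV R n \x lebesgue_measure)%E (cyl Omega T) f')
    (u0 u0' : 'rV[R]_n -> R)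
    (u0_H10 : exists G, H10 Omega u0 G) (u0'_H10 : exists G, H10 Omega u0' G)
    (u0_phi : {ae lebesgue_rV R n, forall x, Omega x -> phi x <= u0 x})
    (u0'_phi : {ae lebesgue_rV R n, forall x, Omega x -> phi x <= u0' x})
    (CF : R) (CF_gt0 : 0 < CF) (CF_friedrichs : friedrichs_constant Omega CF)
    (u u' : R -> 'rV[R]_n -> R) (Du Du' : R -> 'rV[R]_n -> 'rV[R]_n)
    (ut ut' : R -> ('rV[R]_n -> R) -> R)
    (u_sol : obstacle_solution Omega T phi f u0 u Du ut)
    (u'_sol : obstacle_solution Omega T phi f' u0' u' Du' ut')
    (alpha : R) (alpha_ge : 2^-1 <= alpha) :
  let mu := lebesgue_rV R n in
  let Q := cyl Omega T in
  let L2normQ := L2norm (lebesgue_rV R n \x lebesgue_measure)%E Q in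
  let g := contact_data phi u' (f \- f') in
  let grad_diff := fun p => enorm (onQ Du p - onQ Du' p) in
  (L2norm mu Omega (u T \- u' T)%R ^+ 2
     + (2 - alpha^-1)%:E * L2normQ grad_diff ^+ 2
   <= L2norm mu Omega (u0 \- u0')%R ^+ 2
     + (alpha * CF ^+ 2)%:E * L2normQ g ^+ 2)%E /\
  (L2norm mu Omega (u T \- u' T)%R ^+ 2
     + (2 - alpha^-1)%:E * L2normQ grad_diff ^+ 2
   <= L2norm mu Omega (u0 \- u0')%R ^+ 2
     + (alpha * CF ^+ 2)%:E * L2normQ (f \- f')%R ^+ 2)%E.
Proof.
move=> mu Q L2normQ g grad_diff.
have mphi : measurable_fun Omega phi by have [G [[[]]]] := phi_H2.
have first := obstacle_stability Omega_open Omega_bdd T_gt0 mphi f_L2 f'_L2 u_sol u'_sol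
  CF_gt0 CF_friedrichs alpha_ge.
split; first exact: first.
apply: le_trans first _; rewrite leeD2l// lee_pmul2l ?fin_numE//; last first.
  by rewrite lte_fin mulr_gt0 ?exprn_gt0// (lt_le_trans _ alpha_ge)// invr_gt0.
have mQ := measurable_cyl T Omega_open.
have Lh : L2 (lebesgue_rV R n \x lebesgue_measure)%E Q (f \- f') by exact: L2B.
have Lg := contact_L2 Omega_open mphi f_L2 f'_L2 u'_sol.
rewrite (sqr_L2normE mQ Lg) (sqr_L2normE mQ Lh) lee_fin.
apply: le_Rintegral => //; [exact: L2_integrable_sqr..|].
move=> p _; rewrite -[leLHS]real_normK ?num_real// -[leRHS]real_normK ?num_real//.
by rewrite lerXn2r ?nnegrE//; exact: contact_data_le.
Qed.
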